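(* Let $\Gamma_+\subseteq\mathbb R^n_{\geq 0}$ be a convenient Newton polyhedron with $0\notin\Gamma_+$, with associated Newton filtration $\nu_\Gamma$ and ideals $\mathscr B_r=\{h\in\mathcal O_n:\nu_\Gamma(h)\geq r\}$. Let $J_1,\dots,J_n$ be proper ideals of $\mathcal O_n$ and let $r_i=\nu_\Gamma(J_i)$ for $i=1,\dots,n$. Suppose that $(J_1,\dots,J_n)$ is non-degenerate on $\Gamma_+$. Let $I$ be a non-zero proper ideal of $\mathcal O_n$. Then $$\mathscr L_I(J_1,\dots,J_n)\leq \mathscr L_I(\mathscr B_{r_1},\dots,\mathscr B_{r_n})\leq\frac{\max\{r_1,\dots,r_n\}}{\nu_\Gamma(I)},$$ and both inequalities are equalities if the pair $(I;J_1,\dots,J_n)$ is $\Gamma_+$-linked.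
   Context: $\mathcal O_n$ is the ring of germs at $0$ of holomorphic functions on $\mathbb C^n$, with maximal ideal $m$. Rees mixed multiplicities. For $m$-primary ideals $I_1,\dots,I_n$ of $\mathcal O_n$, $e(I_1,\dots,I_n)$ is the mixed multiplicity in the sense of Teissier and Risler. For proper ideals $I_1,\dots,I_n$ of $\mathcal O_n$, the Rees mixed multiplicity is $\sigma(I_1,\dots,I_n)=\max_{r\in\mathbb Z_{\geq 0}}e(I_1+m^r,\dots,I_n+m^r)$ if this set of integers is bounded, and $\sigma(I_1,\dots,I_n)=\infty$ otherwise (multiplicities in which all ideals equal the unit ideal, i.e. the term $r=0$, are taken to be $0$). If all $I_i$ are $m$-primary then $\sigma(I_1,\dots,I_n)=e(I_1,\dots,I_n)$. Łojasiewicz exponents. If $\sigma(I_1,\dots,I_n)<\infty$ and $J$ is a non-zero proper ideal, put $r_J(I_1,\dots,I_n)=\min\{r\in\mathbb Z_{\geq 0}:\sigma(I_1,\dots,I_n)=\sigma(I_1+J^r,\dots,I_n+J^r)\}$ and $$\mathscr L_J(I_1,\dots,I_n)=\inf_{s\geq 1}\frac{r_J(I_1^s,\dots,I_n^s)}{s}.$$ Newton filtration. A Newton polyhedron is a set $\Gamma_+\subseteq\mathbb R^n_{\geq0}$ that is the convex hull of $\{k+v:k\in A,\ v\in\mathbb R^n_{\geq 0}\}$ for some $A\subseteq\mathbb Z^n_{\geq 0}$; it is convenient if it meets every coordinate axis in a point different from the origin. For $v\in\mathbb R^n_{\geq0}\setminus\{0\}$ let $\ell(v,\Gamma_+)=\min\{\langle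 v,k\rangle:k\in\Gamma_+\}$ and $\Delta(v,\Gamma_+)=\{k\in\Gamma_+:\langle v,k\rangle=\ell(v,\Gamma_+)\}$; these sets are the faces of $\Gamma_+$, and a facet is a face of dimension $n-1$. Let $v^1,\dots,v^t$ be the primitive vectors of $\mathbb Z^n_{\geq 0}$ supporting the compact facets of $\Gamma_+$, and let $M=M_\Gamma$ be the least common multiple of $\ell(v^1,\Gamma_+),\dots,\ell(v^t,\Gamma_+)$. Put $\phi_\Gamma(k)=\min_{i}\frac{M}{\ell(v^i,\Gamma_+)}\langle k,v^i\rangle$ for $k\in\mathbb R^n_{\geq 0}$. For $0\neq h=\sum_k a_kx^k\in\mathcal O_n$, $\nu_\Gamma(h)=\min\{\phi_\Gamma(k):a_k\neq0\}$, and $\nu_\Gamma(0)=+\infty$. For an ideal $I$, $\nu_\Gamma(I)=\max\{r:I\subseteq\mathscr B_r\}$, equivalently the minimum of $\nu_\Gamma$ over any generating system of $I$. $\Gamma_-$ denotes the closure of $\mathbb R^n_{\geq0}\setminus\Gamma_+$ and $\mathrm V_n$ is $n$-dimensional volume. Non-degeneracy. If $\sigma(J_1,\dots,J_n)<\infty$ and $r_i=\nu_\Gamma(J_i)$, then $(J_1,\dots,J_n)$ is called non-degenerate on $\Gamma_+$ when $\sigma(J_1,\dots,J_n)=\frac{r_1\cdots r_n}{M^n}\,n!\,\mathrm V_n(\Gamma_-)$ (in particular this presupposes $\sigma(J_1,\dots,J_n)<\infty$). Linkage. Let $\sigma(J_1,\dots,J_n)<\infty$, $r_i=\nu_\Gamma(J_i)$,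 $p=\max\{r_1,\dots,r_n\}$. For a proper ideal $I$, the pair $(I;J_1,\dots,J_n)$ is $\Gamma_+$-linked when there is an index $i_0$ with $r_{i_0}=p$ such that $(J_1,\dots,J_{i_0-1},I,J_{i_0+1},\dots,J_n)$ is non-degenerate on $\Gamma_+$. *)

(* Defs.v *)
From HB Require Import structures.
From mathcomp Require Import all_boot all_order all_algebra.
From mathcomp Require Import complex.
From mathcomp Require Import all_classical all_reals all_analysis.
(* mpoly and analysis declare clashing notations; only the former's constants
   are used: [multinom n] is the type of multi-indices k in N^n, [mdeg k] is
   |k|, and [bmultinom n d] is the finite type of those with |k| < d. *)
From mathcomp Require Import -(notations) ssrcomplements freeg mpoly.

Set Implicit Arguments.
Unset Strict Implicit.
Unset Printing Implicit Defensive.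

Import Order.TTheory GRing.Theory Num.Theory.
Import numFieldNormedType.Exports.

Local Open Scope classical_set_scope.
Local Open Scope ring_scope.

Section Germs.
Variables (R : realType) (n : nat).
Local Notation C := R[i].

(* Absolute convergence of sum_k a_k x^k at x = (rho, ..., rho), hence on the
   closed polydisc of radius rho. The inequality in C forces K to be real. *)
Definition convergent_series (a : multinom n -> C) : Prop :=
  exists rho K : C, 0 < rho /\
    forall d, \sum_(k : bmultinom n d) `|a k| * rho ^+ mdeg k <= K.

(* A germ at 0 of a holomorphic function on C^n is identified with its Taylor
   series, i.e. O_n is taken to be the ring C{x_1, ..., x_n} of convergent power
   series; [hcoef h k] is the coefficient of x^k in h. *)
Record holo_germ := HoloGerm {
  hcoef :> multinom n -> C;
  hcoef_conv : convergent_series hcoef }.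

Lemma holo_germP (f g : holo_germ) : hcoef f =1 hcoef g -> f = g.
Proof.
case: f g => [f cf] [g cg] /= /funext fg.
by move: cf cg; rewrite fg => cf cg; congr HoloGerm; exact: Prop_irrelevance.
Qed.

HB.instance Definition _ := gen_eqMixin holo_germ.
HB.instance Definition _ := gen_choiceMixin holo_germ.

Lemma convergent_le_rho (a : multinom n -> C) (rho K : C) :
  (forall d, \sum_(k : bmultinom n d) `|a k| * rho ^+ mdeg k <= K) ->
  forall rho', 0 <= rho' <= rho ->
  forall d, \sum_(k : bmultinom n d) `|a k| * rho' ^+ mdeg k <= K.
Proof.
move=> aK rho' /andP[r0 rr] d; apply: le_trans (aK d).
apply: ler_sum => k _; apply: ler_wpM2l => //.
by apply: lerXn2r; rewrite ?nnegrE // (le_trans r0).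
Qed.

Lemma convergent_common (a b : multinom n -> C) :
  convergent_series a -> convergent_series b -> exists rho Ka Kb : C,
  [/\ 0 < rho, forall d, \sum_(k : bmultinom n d) `|a k| * rho ^+ mdeg k <= Ka &
      forall d, \sum_(k : bmultinom n d) `|b k| * rho ^+ mdeg k <= Kb].
Proof.
move=> [r [Ka [r0 aK]]] [s [Kb [s0 bK]]].
have /orP[rs|sr] : (r <= s) || (s <= r).
  by apply: real_leVge; apply: gtr0_real.
- exists r, Ka, Kb; split => // d; apply: (convergent_le_rho bK).
  by rewrite ltW.
- exists s, Ka, Kb; split => // d; apply: (convergent_le_rho aK).
  by rewrite ltW.
Qed.

Lemma convergent_const (c : C) :
  convergent_series (fun k => if k == mnm0 then c else 0).
Proof.
exists 1, `|c|; split => // d.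
have [d0|d0] := posnP d.
  rewrite big1 // => -[k hk] _; exfalso.
  by move: hk; rewrite d0.
have h0 : (mdeg (mnm0 : multinom n) < d)%N by rewrite mdeg0.
rewrite (bigD1 (BMultinom h0)) //= eqxx mdeg0 mulr1 big1 ?addr0 // => k kn0.
rewrite ifN ?normr0 ?mul0r //.
Qed.

Lemma convergent_add (a b : multinom n -> C) :
  convergent_series a -> convergent_series b ->
  convergent_series (fun k => a k + b k).
Proof.
move=> ca cb; have [r [Ka [Kb [r0 aK bK]]]] := convergent_common ca cb.
exists r, (Ka + Kb); split => // d; apply: le_trans (lerD (aK d) (bK d)).
rewrite -big_split /=; apply: ler_sum => k _; rewrite -mulrDl.
by apply: ler_wpM2r; [rewrite exprn_ge0 // ltW | exact: ler_normD].
Qed.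

Lemma convergent_opp (a : multinom n -> C) :
  convergent_series a -> convergent_series (fun k => - a k).
Proof.
move=> [r [K [r0 aK]]]; exists r, K; split => // d.
by under eq_bigr do rewrite normrN; exact: aK.
Qed.

Definition cauchy_prod (a b : multinom n -> C) (m : multinom n) : C :=
  \sum_(k : bmultinom n (mdeg m).+1 * bmultinom n (mdeg m).+1
        | m == mnm_add k.1 k.2) a k.1 * b k.2.

Definition truncation d (a : multinom n -> C) : mpoly n C :=
  \sum_(k : bmultinom n d) a k *: mpolyX C k.

Lemma mcoeff_truncation d (a : multinom n -> C) m :
  (mdeg m < d)%N -> mcoeff m (truncation d a) = a m.
Proof. exact: mcoeff_mpoly. Qed.

Lemma cauchy_prodE (a b : multinom n -> C) d m (p q : mpoly n C) :
  (mdeg m < d)%N ->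
  (forall k, (mdeg k < d)%N -> mcoeff k p = a k) ->
  (forall k, (mdeg k < d)%N -> mcoeff k q = b k) ->
  cauchy_prod a b m = mcoeff m (p * q).
Proof.
move=> md pa qb; rewrite mcoeffM /cauchy_prod; apply: eq_bigr => -[k l] /= _.
by rewrite pa ?qb // (leq_trans (bmdeg _)).
Qed.

Lemma cauchy_prod_widen (a b : multinom n -> C) d m : (mdeg m < d)%N ->
  cauchy_prod a b m =
  \sum_(k : bmultinom n d * bmultinom n d | m == mnm_add k.1 k.2)
    a k.1 * b k.2.
Proof.
move=> md; have H := @mcoeff_truncation d.
rewrite (cauchy_prodE md (H a) (H b)) (mcoeff_poly_mul _ _ md).
by apply: eq_bigr => -[k l] /= _; rewrite !H // bmdeg.
Qed.

Lemma convergent_cauchy_prod (a b : multinom n -> C) :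
  convergent_series a -> convergent_series b ->
  convergent_series (cauchy_prod a b).
Proof.
move=> ca cb; have [r [Ka [Kb [r0 aK bK]]]] := convergent_common ca cb.
exists r, (Ka * Kb); split => // d.
pose A := \sum_(k : bmultinom n d) `|a k| * r ^+ mdeg k.
pose B := \sum_(k : bmultinom n d) `|b k| * r ^+ mdeg k.
have A0 : 0 <= A.
  by apply: sumr_ge0 => k _; rewrite mulr_ge0 // exprn_ge0 // ltW.
have B0 : 0 <= B.
  by apply: sumr_ge0 => k _; rewrite mulr_ge0 // exprn_ge0 // ltW.
suff: \sum_(k : bmultinom n d) `|cauchy_prod a b k| * r ^+ mdeg k <= A * B.
  by move/le_trans; apply; apply: ler_pM => //; [exact: aK|exact: bK].
pose t (k : bmultinom n d * bmultinom n d) :=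
  (`|a k.1| * r ^+ mdeg k.1) * (`|b k.2| * r ^+ mdeg k.2).
have t0 k : 0 <= t k by rewrite !mulr_ge0 // exprn_ge0 // ltW.
have -> : A * B = \sum_k t k.
  rewrite /A /B mulr_suml -(pair_bigA _ (fun k l =>
    (`|a (bmnm k)| * r ^+ mdeg (bmnm k)) *
    (`|b (bmnm l)| * r ^+ mdeg (bmnm l)))) /=.
  by apply: eq_bigr => k _; rewrite mulr_sumr.
pose s k := \sum_(m : bmultinom n d | bmnm m == mnm_add (bmnm k.1) (bmnm k.2)) t k.
apply: (@le_trans _ _ (\sum_k s k)); last first.
  apply: ler_sum => k _; rewrite /s.
  have [h|h] := ltnP (mdeg (mnm_add (bmnm k.1) (bmnm k.2))) d.
    by rewrite (big_pred1 (BMultinom h)).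
  rewrite big_pred0 // => m; apply/negbTE/eqP => e.
  by move: (bmdeg m); rewrite e ltnNge h.
rewrite /s (exchange_big_dep xpredT) //=; apply: ler_sum => m _.
rewrite (cauchy_prod_widen _ _ (bmdeg m)).
apply: le_trans (ler_wpM2r _ (ler_norm_sum _ _ _)) _.
  by rewrite exprn_ge0 // ltW.
rewrite mulr_suml; apply: ler_sum => k /eqP ->.
by rewrite /t normrM mdegD exprD mulrACA.
Qed.

Definition germ_const (c : C) := HoloGerm (convergent_const c).
Definition germ_add (f g : holo_germ) :=
  HoloGerm (convergent_add (hcoef_conv f) (hcoef_conv g)).
Definition germ_opp (f : holo_germ) :=
  HoloGerm (convergent_opp (hcoef_conv f)).
Definition germ_mul (f g : holo_germ) :=
  HoloGerm (convergent_cauchy_prod (hcoef_conv f) (hcoef_conv g)).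

Lemma germ_addA : associative germ_add.
Proof. by move=> f g h; apply: holo_germP => k /=; rewrite addrA. Qed.
Lemma germ_addC : commutative germ_add.
Proof. by move=> f g; apply: holo_germP => k /=; rewrite addrC. Qed.
Lemma germ_add0 : left_id (germ_const 0) germ_add.
Proof. by move=> f; apply: holo_germP => k /=; case: ifP; rewrite add0r. Qed.
Lemma germ_addN : left_inverse (germ_const 0) germ_opp germ_add.
Proof. by move=> f; apply: holo_germP => k /=; rewrite addNr; case: ifP. Qed.

HB.instance Definition _ := GRing.isZmodule.Build holo_germ
  germ_addA germ_addC germ_add0 germ_addN.

Lemma germ_mulA : associative germ_mul.
Proof.
move=> f g h; apply: holo_germP => m /=.
have H := @mcoeff_truncation (mdeg m).+1.
have fg k : (mdeg k < (mdeg m).+1)%N ->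
    mcoeff k (truncation (mdeg m).+1 f * truncation (mdeg m).+1 g) =
    cauchy_prod f g k.
  by move=> km; rewrite -(cauchy_prodE km (H f) (H g)).
have gh k : (mdeg k < (mdeg m).+1)%N ->
    mcoeff k (truncation (mdeg m).+1 g * truncation (mdeg m).+1 h) =
    cauchy_prod g h k.
  by move=> km; rewrite -(cauchy_prodE km (H g) (H h)).
by rewrite (cauchy_prodE (ltnSn _) (H f) gh)
           (cauchy_prodE (ltnSn _) fg (H h)) mulrA.
Qed.

Lemma germ_mulC : commutative germ_mul.
Proof.
move=> f g; apply: holo_germP => m /=.
have H := @mcoeff_truncation (mdeg m).+1.
by rewrite (cauchy_prodE (ltnSn _) (H f) (H g))
           (cauchy_prodE (ltnSn _) (H g) (H f)) mulrC.
Qed.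

Lemma germ_mul1 : left_id (germ_const 1) germ_mul.
Proof.
move=> f; apply: holo_germP => m /=.
have H := @mcoeff_truncation (mdeg m).+1.
rewrite (@cauchy_prodE _ _ _ _ 1 _ (ltnSn _) _ (H f)) ?mul1r ?H //.
by move=> k _; rewrite mcoeff1; case: eqP.
Qed.

Lemma germ_mulD : left_distributive germ_mul germ_add.
Proof.
move=> f g h; apply: holo_germP => m /=.
by rewrite /cauchy_prod -big_split /=; apply: eq_bigr => k _; rewrite mulrDl.
Qed.

Lemma germ_1neq0 : germ_const 1 != germ_const 0.
Proof.
apply/eqP => /(congr1 (fun f : holo_germ => hcoef f mnm0)) /= /eqP.
by rewrite eqxx oner_eq0.
Qed.

HB.instance Definition _ := GRing.Zmodule_isComNzRing.Build holo_germ
  germ_mulA germ_mulC germ_mul1 germ_mulD germ_1neq0.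

End Germs.

Section Ideals.
Variable A : comNzRingType.
Implicit Types I J : set A.

Definition is_ideal I : Prop :=
  [/\ I 0, forall x y, I x -> I y -> I (x + y) & forall a x, I x -> I (a * x)].

Definition is_proper_ideal I : Prop := is_ideal I /\ I <> setT.

Definition ideal_add I J : set A := [set x + y | x in I & y in J].

Definition ideal_mul I J : set A :=
  smallest is_ideal [set x * y | x in I & y in J].

Definition ideal_exp I (k : nat) : set A := iter k (ideal_mul I) setT.

(* The A-module A / I has a strict chain of l + 1 submodules. *)
Definition colength_ge I (l : nat) : Prop :=
  exists K : nat -> set A,
    (forall j, (j <= l)%N -> is_ideal (K j) /\ I `<=` K j) /\
    (forall j, (j < l)%N -> K j `<` K j.+1).

Definition has_colength I (l : nat) : Prop :=
  colength_ge I l /\ ~ colength_ge I l.+1.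

End Ideals.

Section Multiplicities.
Variables (R : realType) (n : nat).
Local Notation O := (holo_germ R n).
Implicit Types J : 'I_n -> set O.

Definition max_ideal : set O := [set h | hcoef h mnm0 = 0].

(* Teissier-Risler: for m-primary J_i the length of O / J_1^r_1 ... J_n^r_n is,
   for r_1, ..., r_n >> 0, a polynomial P(r_1, ..., r_n) of degree n in which
   e(J_1, ..., J_n) is the coefficient of the monomial r_1 ... r_n. Such a P is
   unique. When every J_i is the unit ideal, P = 0 and e = 0. *)
Definition is_mixed_mult J (e : nat) : Prop :=
  exists P : mpoly n rat,
    [/\ (msize P <= n.+1)%N,
        mcoeff (Multinom [tuple 1%N | i < n]) P = e%:R &
        exists N : nat, forall r : 'I_n -> nat, (forall i, (N <= r i)%N) ->
          exists2 l : nat,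
            has_colength (\big[@ideal_mul O/setT]_(i < n) ideal_exp (J i) (r i)) l
            & meval (fun i => (r i)%:R) P = l%:R].

Definition mixed_mult J : nat := xget 0%N [set e | is_mixed_mult J e].

Definition rees_mixed_mult J : \bar R :=
  ereal_sup [set (mixed_mult (fun i => ideal_add (J i)
                                         (ideal_exp max_ideal r)))%:R%:E
            | r in [set: nat]].

(* r_I(J_1, ..., J_n), the minimum of a subset of N computed in \bar R. *)
Definition loj_order (I : set O) J : \bar R :=
  ereal_inf [set r%:R%:E | r in [set r : nat |
    rees_mixed_mult J =
    rees_mixed_mult (fun i => ideal_add (J i) (ideal_exp I r))]].

Definition loj_exponent (I : set O) J : \bar R :=
  ereal_inf [set (loj_order I (fun i => ideal_exp (J i) s) / s%:R%:E)%E
            | s in [set s : nat | (1 <= s)%N]].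

End Multiplicities.

Section Newton.
Variables (R : realType) (n : nat).
Implicit Types (G : set 'rV[R]_n) (x y : 'rV[R]_n).

Definition orthant : set 'rV[R]_n := [set x | forall i, 0 <= x 0 i].

Definition mnm_row (m : multinom n) : 'rV[R]_n := \row_i (m i)%:R.

(* [smallest convex_set] is the convex hull. *)
Definition newton_polyhedron G : Prop :=
  exists A : set (multinom n),
    G = smallest (@convex_set R 'rV[R]_n)
          [set mnm_row k + x | k in A & x in orthant].

Definition convenient G : Prop :=
  forall i : 'I_n, exists2 t : R, t != 0 & G (t *: delta_mx 0 i).

Definition dotv x y : R := \sum_(i < n) x 0 i * y 0 i.

Definition newton_ell x G : R := inf [set dotv x y | y in G].

Definition newton_face x G : set 'rV[R]_n :=
  [set y | G y /\ dotv x y = newton_ell x G].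

(* S contains d + 1 affinely independent points. *)
Definition affine_dim_ge (S : set 'rV[R]_n) (d : nat) : Prop :=
  exists p : 'rV[R]_n, exists B : 'M[R]_(d, n),
    [/\ S p, forall i, S (p + row i B) & row_free B].

Definition has_affine_dim (S : set 'rV[R]_n) (d : nat) : Prop :=
  affine_dim_ge S d /\ ~ affine_dim_ge S d.+1.

(* The primitive vectors v^1, ..., v^t supporting the compact facets, a facet
   being a face of dimension n - 1. *)
Definition newton_normals G : set (multinom n) :=
  [set v : multinom n |
    [/\ \big[gcdn/0%N]_(i < n) v i = 1%N,
        compact (newton_face (mnm_row v) G) &
        has_affine_dim (newton_face (mnm_row v) G) n.-1]].

(* M_Gamma, the least positive common multiple of the numbers l(v^i, Gamma_+),
   which are positive integers when 0 is not in Gamma_+. *)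
Definition newton_lcm G : nat :=
  let common_multiple (M : nat) := (0 < M)%N /\
    forall v, newton_normals G v ->
      exists c : nat, M%:R = c%:R * newton_ell (mnm_row v) G in
  xget 0%N [set M | common_multiple M /\
                    forall M', common_multiple M' -> (M <= M')%N].

Definition newton_phi G x : R :=
  inf [set (newton_lcm G)%:R / newton_ell (mnm_row v) G * dotv x (mnm_row v)
      | v in newton_normals G].

Definition newton_nu G (h : holo_germ R n) : \bar R :=
  ereal_inf [set (newton_phi G (mnm_row k))%:E | k in [set k | hcoef h k != 0]].

Definition newton_ideal G (r : \bar R) : set (holo_germ R n) :=
  [set h | (r <= newton_nu G h)%E].

Definition newton_nu_ideal G (I : set (holo_germ R n)) : \bar R :=
  ereal_sup [set r | I `<=` newton_ideal G r].

Definition newton_minus G : set 'rV[R]_n := closure (orthant `\` G).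

End Newton.

(* n-dimensional Lebesgue measure: the product measure
   [lebesgue_measure \x ... \x lebesgue_measure], unfolded over 'rV_n. *)
Fixpoint volume (R : realType) (n : nat) : set 'rV[R]_n -> \bar R :=
  match n with
  | 0 => fun S => (\1_S 0)%:E
  | n'.+1 => fun S => (\int[lebesgue_measure]_t
      volume [set y : 'rV[R]_n' | S (row_mx (t%:M : 'rV[R]_1) y)])%E
  end.

Section NonDegeneracy.
Variables (R : realType) (n : nat) (G : set 'rV[R]_n).
Implicit Types (J : 'I_n -> set (holo_germ R n)) (I : set (holo_germ R n)).

Definition newton_nondegenerate J : Prop :=
  (rees_mixed_mult J < +oo)%E /\
  rees_mixed_mult J =
    ((\prod_(i < n) newton_nu_ideal G (J i)) / (newton_lcm G ^ n)%:R%:E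
     * (n`!)%:R%:E * volume (newton_minus G))%E.

Definition max_nu J : \bar R :=
  \big[maxe/-oo%E]_(i < n) newton_nu_ideal G (J i).

Definition newton_linked I J : Prop :=
  (rees_mixed_mult J < +oo)%E /\
  exists i0 : 'I_n, newton_nu_ideal G (J i0) = max_nu J /\
    newton_nondegenerate (fun i => if i == i0 then I else J i).

End NonDegeneracy.

(* Main.v *)
(* The Hilbert function a |-> dim O / L_1^a_1 ... L_n^a_n of m-primary ideals is
   a finite sum of products of Hilbert functions of shifted polynomial rings, as
   one sees by counting leading monomials in a Rees algebra.  So is the change
   of this function when one L_i is enlarged, and mixed differences of such sums
   are eventually nonnegative.  Hence mixed multiplicities exist, decrease when
   the ideals grow and are multiplied by s_1 ... s_n when L_i is replaced by
   L_i^s_i; all this passes to the Rees mixed multiplicities sigma.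

   The ideal of the exponents in t Gamma_+ has colength at least of the order of
   t^n V_n(Gamma_-).  Passing to powers, this gives
   sigma(L) >= r_1 ... r_n / M^n * n! V_n(Gamma_-) when nu_Gamma(L_i) >= r_i, with
   equality for the J_i, hence also for the larger ideals B_{r_i}.  If
   u = nu_Gamma(I) and p = max r_i, then adding I^p to the B_{r_i}^u keeps
   nu_Gamma at least u r_i, hence keeps sigma: this is the upper bound p / u.
   In the linked case let sigma(J^s) = sigma(J^s + I^q).  Replacing J_i0^s by
   I^q gives smaller ideals than J_i^s + I^q, so that
   s^n p prod_{i <> i0} r_i <= q s^(n-1) u prod_{i <> i0} r_i, i.e. p / u <= q / s. *)

Require Import Defs.
From HB Require Import structures.
From mathcomp Require Import all_boot all_order all_algebra.
From mathcomp Require Import complex.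
From mathcomp Require Import all_classical all_reals all_analysis.
From mathcomp Require Import measurable_realfun.
From mathcomp Require Import -(notations) mpoly.
From mathcomp Require Import zify ring lra.

Set Implicit Arguments.
Unset Strict Implicit.
Unset Printing Implicit Defensive.

Import Order.TTheory GRing.Theory Num.Theory.
Import numFieldNormedType.Exports.

(** * Hilbert functions of Stanley decompositions *)

(** [mixed_mult] selects its value by [xget] with default 0, so nothing is known about it until the
    Hilbert function of an arbitrary family of m-primary ideals is shown to be eventually a
    polynomial of degree at most n. Stanley functions give this because their terms are nonnegative:
    leading terms cannot cancel, so the crude bound dim O/m^d <= d^n controls the degree. Beyond all
    shifts their factors are nondecreasing, whence the sign of mixed differences. The multiplicity
    is then always read off as a mixed difference of the Hilbert function, with freely chosen steps.
    On the convex side, M_Gamma and phi_Gamma are defined through compact facets, and these have to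
    be produced: the vertices of the polyhedron dual to the finitely many minimal exponents supply
    enough of them to cut out Gamma_+ inside the orthant. It follows that phi_Gamma is integral on
    exponents and that phi_Gamma(k) >= M t puts k/t into Gamma_+. *)

Fixpoint nmon (s x : nat) : nat :=
  if s is s'.+1 then \sum_(t < x.+1) nmon s' t else (x == 0)%N.

Definition nmons (s u x : nat) : nat := if u <= x then nmon s (x - u) else 0.

(** [nmon s] has generating series (1 - z)^(-s); this is the coefficientwise form of (1 - z)^(-s) (1
    - z)^(-s') = (1 - z)^(-s-s'). *)
Lemma nmon_conv s s' x :
  \sum_(t < x.+1) nmon s t * nmon s' (x - t) = nmon (s + s') x.
Proof.
elim: s x => [|s IH] x.
  rewrite big_ord_recl /= subn0 mul1n big1 ?addn0 //.
have step y : \sum_(t < y.+2) nmon s.+1 t * nmon s' (y.+1 - t) =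
    \sum_(t < y.+1) nmon s.+1 t * nmon s' (y - t) + nmon (s + s') y.+1.
  rewrite -IH big_ord_recl [X in _ = _ + X]big_ord_recl /=.
  rewrite big_ord_recl big_ord0 addn0 addnCA; congr (_ + _).
  rewrite -big_split /=; apply: eq_bigr => i _.
  by rewrite /bump /= add1n subSS -mulnDl; congr (_ * _); rewrite big_ord_recr.
elim: x => [|x IHx].
  rewrite !big_ord_recl !big_ord0 !addn0 /= !big_ord_recl !big_ord0 !addn0.
  by rewrite -IH big_ord_recl big_ord0 addn0.
by rewrite step IHx /= [RHS]big_ord_recr.
Qed.

Lemma nmons_conv s u s' u' x :
  \sum_(t < x.+1) nmons s u t * nmons s' u' (x - t) = nmons (s + s') (u + u') x.
Proof.
have nS s0 u0 y : nmons s0 u0.+1 y.+1 = nmons s0 u0 y by rewrite /nmons ltnS subSS.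
have n0 s0 u0 : nmons s0 u0.+1 0 = 0 by [].
have n00 s0 y : nmons s0 0 y = nmon s0 y by rewrite /nmons subn0.
elim: u x => [|u IH] x; last first.
  case: x => [|x]; first by rewrite big_ord_recl big_ord0 addSn.
  by rewrite big_ord_recl mul0n addSn nS -IH; apply: eq_bigr => i _; rewrite nS.
rewrite add0n; elim: u' x => [|u' IH] x.
  by rewrite n00 -nmon_conv; apply: eq_bigr => i _; rewrite !n00.
case: x => [|x]; first by rewrite big_ord_recl big_ord0 n0 muln0.
rewrite big_ord_recr /= subnn n0 muln0 addn0 nS -IH.
by apply: eq_bigr => i _; rewrite subSn ?nS // -ltnS.
Qed.

Lemma nmons0 u x : nmons 0 u x = (x == u).
Proof. by rewrite /nmons /= subn_eq0; case: ltngtP. Qed.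

Lemma nmon1 x : nmon 1 x = 1.
Proof. by rewrite /= big_ord_recl big1. Qed.

Lemma nmons1 u x : nmons 1 u x = (u <= x).
Proof. by rewrite /nmons nmon1; case: ifP. Qed.

Lemma nmonE s x : nmon s.+1 x = 'C(x + s, s).
Proof.
elim: s x => [|s IH] x; first by rewrite nmon1 bin0.
have -> : nmon s.+2 x = \sum_(t < x.+1) 'C(t + s, s) by apply: eq_bigr => t _; exact: IH.
elim: x => [|x IHx]; first by rewrite big_ord1 /= !add0n !binn.
by rewrite big_ord_recr /= IHx addSnnS [in RHS]addSn binS.
Qed.

(** The strict inequality matters: for s = 0 the function is the indicator of u, which drops right
    after u. *)
Lemma nmons_leS s u x : (u < x)%N -> nmons s u x <= nmons s u x.+1.
Proof.
case: s => [|s] ux; first by rewrite !nmons0 gtn_eqF.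
rewrite /nmons (ltnW ux) (leq_trans (ltnW ux) (leqnSn _)).
by rewrite !nmonE leq_bin2l // leq_add2r subSn // ltnW.
Qed.

Definition upd (Q : eqType) (T : Type) (a : Q -> T) b x : Q -> T :=
  fun c => if c == b then x else a c.

Section Stanley.
Variable Q : finType.
Implicit Types (a : Q -> nat) (f : (Q -> nat) -> nat).

(* Hilbert functions of Stanley decompositions: [nmons s u] counts the
   monomials of given degree in x^u k[y_1, ..., y_s], deg x = 1. *)
Definition stanley f : Prop := exists l : seq ((Q -> nat) * (Q -> nat)),
  forall a, f a = \sum_(t <- l) \prod_b nmons (t.1 b) (t.2 b) (a b).

Lemma stanley_ext f g : f =1 g -> stanley f -> stanley g.
Proof. by move=> fg [l fl]; exists l => a; rewrite -fg. Qed.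

Lemma stanley0 : stanley (fun=> 0).
Proof. by exists [::] => a; rewrite big_nil. Qed.

Lemma stanleyD f g : stanley f -> stanley g -> stanley (fun a => f a + g a).
Proof. by move=> [l fl] [k gk]; exists (l ++ k) => a; rewrite big_cat fl gk. Qed.

Lemma stanley_sum (I : Type) (r : seq I) (F : I -> (Q -> nat) -> nat) :
  (forall i, stanley (F i)) -> stanley (fun a => \sum_(i <- r) F i a).
Proof.
move=> sF; elim: r => [|i r IH].
  by apply: stanley_ext stanley0 => a; rewrite big_nil.
by apply: stanley_ext (stanleyD (sF i) IH) => a; rewrite big_cons.
Qed.

(** The generating series gets multiplied by z_b^u / (1 - z_b)^s: s more free variables of degree b
    and a shift by u. *)
Lemma stanley_conv b s u f : stanley f -> stanley (fun a =>
  \sum_(t < (a b).+1) nmons s u t * f (upd a b (a b - t))).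
Proof.
move=> [l fl].
exists [seq ((upd t.1 b (s + t.1 b)), (upd t.2 b (u + t.2 b)))
       | t <- l] => a /=.
under eq_bigr => t _ do rewrite fl big_distrr /=.
rewrite exchange_big big_map /=; apply: eq_bigr => t _.
rewrite (bigD1 b) //= /upd eqxx -nmons_conv big_distrl /=; apply: eq_bigr => x _.
rewrite (bigD1 b) //= eqxx -mulnA; congr (_ * (_ * _)).
by apply: eq_bigr => c /negbTE ->.
Qed.

Lemma stanley_const_b b s u : stanley (fun a =>
  nmons s u (a b) * [forall c, (c != b) ==> (a c == 0)]).
Proof.
exists [:: ((upd (fun=> 0) b (s)), (upd (fun=> 0) b (u)))] => a.
rewrite big_seq1 (bigD1 b) //= /upd eqxx; congr (_ * _).
case: (boolP [forall _, _]) => [/forallP h|].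
  rewrite big1 // => c cb; rewrite (negbTE cb) nmons0.
  by move: (h c); rewrite cb => /= ->.
rewrite negb_forall => /existsP[c]; rewrite negb_imply => /andP[cb ac].
by rewrite (bigD1 c) //= (negbTE cb) nmons0 (negbTE ac).
Qed.

End Stanley.

(* Exponent vectors are lists of naturals, aligned with a list of variables. *)
Definition down_closed (m : nat) (D : pred (seq nat)) : Prop :=
  forall mu i, size mu = m -> (i < m)%N -> D (incr_nth mu i) -> D mu.

Lemma down_closed_cons m D t :
  down_closed m.+1 D -> down_closed m (fun mu => D (t :: mu)).
Proof. by move=> dD mu i sm im; apply: (dD (t :: mu) i.+1) => //=; rewrite sm. Qed.

Lemma down_closed_le m D t t' mu : down_closed m.+1 D -> size mu = m ->
  (t <= t')%N -> D (t' :: mu) -> D (t :: mu).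
Proof.
move=> dD sm /subnK <-; elim: (t' - t) => // k IH Dk; apply: IH.
by apply: (dD _ 0) => //=; rewrite sm.
Qed.

(** Dickson's lemma as a descending chain condition. The diagonal slices [D t (t :: mu)] decrease
    and settle at some T0 by induction; by monotonicity this fixes [D t (s :: mu)] for all t, s >=
    T0, and each of the finitely many slices s < T0 settles by induction as well. *)
Lemma down_closed_dcc m (D : nat -> pred (seq nat)) :
  (forall t, down_closed m (D t)) ->
  (forall t t' mu, size mu = m -> t <= t' -> D t' mu -> D t mu) ->
  exists T, forall t, T <= t -> forall mu, size mu = m -> D t mu = D T mu.
Proof.
elim: m D => [|m IH] D dD Dle.
  case: (pselect (exists T, ~~ D T [::])) => [[T DT]|nD].
    exists T => t Tt mu /size0nil ->; rewrite (negbTE DT).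
    by apply: contraNF DT; apply: Dle.
  have DT T : D T [::] by apply: contrapT => /negP h; apply: nD; exists T.
  by exists 0 => t _ mu /size0nil ->; rewrite !DT.
have [T0 hT0] : exists T, forall t, T <= t -> forall mu, size mu = m ->
    D t (t :: mu) = D T (T :: mu).
  apply: (IH (fun t mu => D t (t :: mu))) => [t|t t' mu sm tt' h].
    exact: down_closed_cons.
  by apply: (Dle _ t') => //=; [rewrite sm|apply: down_closed_le tt' h].
have hT0' t s mu : size mu = m -> T0 <= t -> T0 <= s -> D t (s :: mu) = D T0 (T0 :: mu).
  move=> sm tT sT; apply/idP/idP => h.
    apply: (Dle _ t) => //=; rewrite ?sm //.
    exact: down_closed_le sT h.
  have := hT0 (maxn t s); rewrite leq_max tT => /(_ isT mu sm); rewrite h => h'.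
  apply: (Dle _ (maxn t s)); rewrite /= ?sm ?leq_maxl //.
  by apply: down_closed_le h'; rewrite ?leq_maxr.
have [T1 hT1] : exists T, forall s, s < T0 -> forall t, T <= t ->
    forall mu, size mu = m -> D t (s :: mu) = D T (s :: mu).
  elim: T0 {hT0 hT0'} => [|k [T hT]]; first by exists 0.
  have [T' hT'] := IH (fun t mu => D t (k :: mu))
    (fun t => down_closed_cons (dD t))
    (fun t t' mu sm => Dle t t' (k :: mu) (f_equal S sm)).
  exists (maxn T T') => s; rewrite ltnS => sk t.
  rewrite geq_max => /andP[Tt Tt'] mu sm.
  have [sk'|] := ltnP s k; first by rewrite !(hT s) // leq_maxl.
  by move=> ks; have -> : s = k by [apply/eqP; rewrite eqn_leq sk];
     rewrite !hT' // leq_maxr.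
exists (maxn T0 T1) => t; rewrite geq_max => /andP[T0t T1t] [|s mu] // [sm].
have [sT|sT] := ltnP s T0; first by rewrite !(hT1 s) // leq_maxr.
by rewrite !hT0' // leq_maxl.
Qed.

Section Monomials.
Variable Q : finType.
Implicit Types (a : Q -> nat) (bs : seq Q) (mu : seq nat).

(* The exponent vectors of multidegree a, in increasing lexicographic order;
   the i-th variable has multidegree the i-th element of bs. *)
Fixpoint mons bs a : seq (seq nat) :=
  if bs is b :: bs' then
    flatten [seq [seq t :: mu | mu <- mons bs' (upd a b (a b - t))]
            | t <- iota 0 (a b).+1]
  else if [forall b, a b == 0] then [:: [::]] else [::].

Fixpoint bdeg bs mu : Q -> nat := fun c =>
  if bs is b :: bs' then if mu is t :: mu' then (b == c) * t + bdeg bs' mu' c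
  else 0 else 0.

Fixpoint lexlt mu nu : bool :=
  if mu is t :: mu' then if nu is s :: nu' then (t < s) || ((t == s) && lexlt mu' nu')
  else false else false.

Lemma mons_cons b bs a : mons (b :: bs) a =
  flatten [seq [seq t :: mu | mu <- mons bs (upd a b (a b - t))]
          | t <- iota 0 (a b).+1].
Proof. by []. Qed.

Lemma mem_mons bs a mu :
  (mu \in mons bs a) = (size mu == size bs) && [forall c, bdeg bs mu c == a c].
Proof.
elim: bs a mu => [|b bs IH] a mu.
  case: mu => [|t mu] /=; last by case: ifP; rewrite ?inE.
  rewrite (eq_forallb (fun c => eq_sym 0 (a c))).
  by case: ifP.
rewrite mons_cons.
apply/idP/andP => [/flatten_mapP[t]|[]].
  rewrite mem_iota add0n ltnS => /= ta /mapP[nu]; rewrite IH => /andP[sn /forallP h] ->.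
  split; first by rewrite /= eqSS.
  apply/forallP => c; rewrite /= (eqP (h c)) /upd [c == b]eq_sym.
  by case: (b =P c) => [<-|]; rewrite ?mul1n ?mul0n // subnKC.
case: mu => [|t mu] //; rewrite [size (t :: mu)]/= eqSS => sm /forallP h.
have tab : t <= a b by rewrite -(eqP (h b)) /= eqxx mul1n leq_addr.
apply/flatten_mapP; exists t; first by rewrite mem_iota.
apply: map_f; rewrite IH sm; apply/forallP => c; rewrite /upd.
have := h c; rewrite /= [c == b]eq_sym; case: (b =P c) => [<-|_]; last by rewrite mul0n.
by rewrite mul1n => /eqP <-; rewrite addKn.
Qed.

Lemma lexlt_asym mu nu : lexlt mu nu -> ~~ lexlt nu mu.
Proof.
elim: mu nu => [|t mu IH] [|s nu] //= /orP[ts|/andP[/eqP -> /IH h]].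
  by rewrite negb_or -leqNgt (ltnW ts) /= gtn_eqF.
by rewrite ltnn eqxx.
Qed.

Lemma mons_lex bs a : pairwise lexlt (mons bs a).
Proof.
elim: bs a => [|b bs IH] a; first by rewrite /=; case: ifP.
rewrite mons_cons; elim: (a b).+1 0 => //= k IHk t.
rewrite pairwise_cat IHk andbT; apply/andP; split.
  apply/allrelP => x y /mapP[mu _ ->] /flatten_mapP[s].
  by rewrite mem_iota => /andP[ts _] /mapP[nu _ ->] /=; rewrite ts.
by rewrite pairwise_map; apply: sub_pairwise (IH _) => mu nu /=; rewrite eqxx ltnn.
Qed.

Lemma lexlt_incr mu nu i : size mu = size nu -> i < size mu ->
  lexlt mu nu -> lexlt (incr_nth mu i) (incr_nth nu i).
Proof.
elim: mu nu i => [|t mu IH] [|s nu] [|i] //= [sz].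

by rewrite ltnS => im /orP[->//|/andP[-> /IH->]//]; rewrite orbT.
Qed.

Lemma bdeg_incr bs mu i b c : size mu = size bs -> i < size bs ->
  bdeg bs (incr_nth mu i) c = (nth b bs i == c) + bdeg bs mu c.
Proof.
elim: bs mu i => [|b' bs IH] [|t mu] [|i] //= [sz].
  by rewrite mulnS addnA.
by rewrite ltnS => ib; rewrite IH // addnCA.
Qed.

(** The slices of D by the exponent t of the first variable decrease with t, hence are constant from
    some T on. Each t0 < T contributes a convolution with [nmons 0 t0] (this exponent only), and all
    t >= T together contribute one with [nmons 1 T] (a free variable). *)
Lemma count_mons_stanley bs (D : pred (seq nat)) :
  down_closed (size bs) D -> stanley (fun a => count D (mons bs a)).
Proof.
elim: bs D => [|b bs IH] D dD.
  have [b _|Q0] := pickP (fun _ : Q => true).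
    have := stanley_const_b b 0 0.
    case D0: (D [::]); last first.
      by move=> _; apply: stanley_ext (stanley0 _) => a /=; case: ifP => //= _; rewrite D0.
    apply: stanley_ext => a; rewrite nmons0 /=.
    transitivity ([forall c, a c == 0] : nat); last by case: ifP => //=; rewrite D0.
    rewrite mulnb; congr nat_of_bool; apply/andP/forallP => [[ab /forallP h] c|h].
      by have := h c; case: eqVneq => [->|].
    by split => //; apply/forallP => c; rewrite h implybT.
  exists (if D [::] then [:: (fun=> 0, fun=> 0)] else [::]) => a /=.
  have -> : [forall c, a c == 0] by apply/forallP => c; have := Q0 c.
  case D0: (D [::]) => /=; rewrite D0 ?big_nil // big_seq1 big1 // => c.
  by have := Q0 c.
pose Dt t mu := D (t :: mu).
have dDt t : down_closed (size bs) (Dt t) by exact: down_closed_cons.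
have [T hT] : exists T, forall t, T <= t -> forall mu, size mu = size bs -> Dt t mu = Dt T mu.
  by apply: down_closed_dcc => // t t' mu sm; exact: down_closed_le dD sm.
pose f t a := count (Dt t) (mons bs a).
have sf t : stanley (f t) by exact: IH.
have main : stanley (fun a =>
    \sum_(t0 <- iota 0 T) (\sum_(t < (a b).+1) nmons 0 t0 t * f t0 (upd a b (a b - t)))
    + \sum_(t < (a b).+1) nmons 1 T t * f T (upd a b (a b - t))).
  apply: stanleyD; last exact: stanley_conv.
  by apply: stanley_sum => t0; exact: stanley_conv.
apply: stanley_ext main => a; rewrite mons_cons count_flatten -map_comp sumnE big_map.
rewrite -[iota 0 (a b).+1]/(index_iota 0 (a b).+1) big_mkord.
rewrite exchange_big -big_split.
apply: eq_bigr => t _; rewrite /= count_map nmons1.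
under eq_bigr do rewrite nmons0.
have [Tt|tT] := leqP T t.
  rewrite mul1n big_seq big1 => [|t0]; last first.
    by rewrite mem_iota => /= t0T; rewrite gtn_eqF // (leq_trans t0T).
  rewrite add0n; apply: eq_in_count => mu; rewrite mem_mons => /andP[/eqP sm _].
  by rewrite /= -[D _]/(Dt t mu) hT.
rewrite mul0n addn0 (bigD1_seq (t : nat)) ?iota_uniq ?mem_iota //= eqxx mul1n big1 ?addn0 //.
by move=> s st; rewrite eq_sym (negbTE st).
Qed.

End Monomials.

Local Open Scope classical_set_scope.
Local Open Scope ring_scope.

(** * Dimensions *)

Section Flags.
Variables (K : fieldType) (A : comNzRingType) (iota : {rmorphism K -> A}).
Implicit Types (W V U : set A) (s t : seq A) (h x : A).

Definition is_subsp W : Prop :=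
  [/\ W 0, forall x y, W x -> W y -> W (x + y) & forall c x, W x -> W (iota c * x)].

Definition adds W s : set A := smallest is_subsp (W `|` [set` s]).

Lemma is_subspB W x y : is_subsp W -> W x -> W y -> W (x - y).
Proof.
move=> [W0 WD WZ] Wx Wy; apply: WD => //.
by have := WZ (-1) _ Wy; rewrite rmorphN1 mulN1r.
Qed.

Lemma is_subspZ W c x : is_subsp W -> W x -> W (iota c * x).
Proof. by move=> [_ _]; apply. Qed.

Lemma is_subspD W x y : is_subsp W -> W x -> W y -> W (x + y).
Proof. by move=> [_ + _]; apply. Qed.

Lemma adds_subsp W s : is_subsp (adds W s).
Proof.
split=> [V [[]]//|x y Vx Vy V hV|c x Vx V hV].
  by apply: is_subspD (hV.1) _ _; [exact: Vx|exact: Vy].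
by apply: is_subspZ (hV.1) _; exact: Vx.
Qed.

Lemma subset_adds W s : W `<=` adds W s.
Proof. by move=> x Wx V [_]; apply; left. Qed.

Lemma mem_adds W s x : x \in s -> adds W s x.
Proof. by move=> xs V [_]; apply; right. Qed.

Lemma adds_min W s V : is_subsp V -> W `<=` V -> (forall x, x \in s -> V x) ->
  adds W s `<=` V.
Proof. by move=> sV WV xV x; apply; split=> // y [/WV|/xV]. Qed.

Lemma adds_nil W : is_subsp W -> adds W [::] = W.
Proof. by move=> sW; apply/seteqP; split; [exact: adds_min|exact: subset_adds]. Qed.

Lemma addsS W W' s s' : W `<=` W' -> {subset s <= s'} -> adds W s `<=` adds W' s'.
Proof.
move=> WW ss; apply: adds_min; first exact: adds_subsp.
  by move=> x /WW; exact: subset_adds.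
by move=> x /ss; exact: mem_adds.
Qed.

Lemma adds_cat W s t : adds (adds W s) t = adds W (s ++ t).
Proof.
apply/seteqP; split; apply: adds_min; do ?exact: adds_subsp.
- by apply: addsS => // x xs; rewrite mem_cat xs.
- by move=> x xt; apply: mem_adds; rewrite mem_cat xt orbT.
- by move=> x Wx; do 2!apply: subset_adds.
- move=> x; rewrite mem_cat => /orP[xs|]; last exact: mem_adds.
  by apply: subset_adds; exact: mem_adds.
Qed.

Lemma adds1P W h x : is_subsp W ->
  adds W [:: h] x -> exists2 c, W (x - iota c * h) & True.
Proof.
move=> sW; apply: (@adds_min _ _ [set x | exists2 c, W (x - iota c * h) & True]).
- split=> [|y z [c Wy _] [d Wz _]|c y [d Wy _]].
  + by exists 0 => //; rewrite rmorph0 mul0r subr0; case: sW.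
  + exists (c + d) => //; rewrite rmorphD mulrDl opprD addrACA.
    exact: is_subspD.
  + by exists (c * d) => //; rewrite rmorphM -mulrA -mulrBr; exact: is_subspZ.
- by move=> y Wy; exists 0 => //; rewrite rmorph0 mul0r subr0.
- move=> y; rewrite inE => /eqP ->; exists 1 => //.
  by rewrite rmorph1 mul1r subrr; case: sW.
Qed.

Lemma proper_adds1 U V h : is_subsp U -> is_subsp V -> U `<=` V -> ~ V `<=` U ->
  adds V [:: h] `<=` adds U [:: h] -> ~ U h /\ V h.
Proof.
move=> sU sV UV /existsNP[v /not_implyP[Vv Uv]] VU.
have [c Uvh _] := adds1P sU (VU v (@subset_adds _ _ _ Vv)).
have Uh : ~ U h.
  by move=> Uh; apply: Uv; rewrite -(subrK (iota c * h) v); apply: is_subspD => //;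
     exact: is_subspZ.
split=> //.
have c0 : c != 0.
  by apply/eqP => c0; apply: Uv; move: Uvh; rewrite c0 rmorph0 mul0r subr0.
have : V (iota c^-1 * (v - (v - iota c * h))).
  by apply: is_subspZ => //; apply: is_subspB => //; exact: UV.
by rewrite opprB addrC subrK mulrA -rmorphM mulVf // rmorph1 mul1r.
Qed.

(** Adding h to every member of the chain collapses at most one step, the one at which h enters the
    chain. Without that step, a chain of length at least l - 1 lies between W + K h and its sum with
    the span of the remaining vectors. *)
Lemma chain_le W s (U : nat -> set A) l :
  (forall i, (i <= l)%N -> is_subsp (U i)) -> W `<=` U 0 ->
  (forall i, (i < l)%N -> U i `<` U i.+1) -> U l `<=` adds W s ->
  (l <= size s)%N.
Proof.
elim: s W U l => [|h s IH] W U l sU WU Ult Ul /=.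
  case: l sU Ult Ul => [//|l] sU Ult Ul.
  have [sub nsub] := Ult l (ltnSn l); exfalso; apply: nsub => x /Ul.
  suff : W `<=` U l by move=> WUl; apply: adds_min => //; exact: sU.
  move=> {}x /WU; elim: l Ult {sU Ul sub} => // l IHl Ult Ux.
  by apply: (Ult l (leqnSn _)).1; apply: IHl => // i il; apply: Ult; apply: ltnW.
have Ule i j : (i <= j)%N -> (j <= l)%N -> U i `<=` U j.
  move=> /subnK <-; elim: (j - i)%N => [|k IHk]; rewrite ?add0n ?addSn // => kl x Ux; first exact: Ux.
  by apply: (Ult _ kl).1; apply: IHk => //; exact: ltnW.
pose U' i := adds (U i) [:: h].
have sU' i : is_subsp (U' i) by exact: adds_subsp.
have U'le i j : (i <= j)%N -> (j <= l)%N -> U' i `<=` U' j.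
  by move=> ij jl; apply: addsS => //; exact: Ule.
have WU' : adds W [:: h] `<=` U' 0 by exact: addsS.
have U'l : U' l `<=` adds (adds W [:: h]) s.
  rewrite adds_cat /=; apply: adds_min => //; first exact: adds_subsp.
  by move=> x; rewrite inE => /eqP ->; apply: mem_adds; rewrite mem_head.
have [[i0 [i0l eq0]]|neq] := pselect (exists i0, (i0 < l)%N /\ U' i0.+1 `<=` U' i0).
  have step i : (i < l)%N -> U' i.+1 `<=` U' i -> ~ U i h /\ U i.+1 h.
    move=> il eqi; apply: proper_adds1 eqi; do ?exact: sU.
    - by apply: sU; exact: ltnW.
    - exact: (Ult i il).1.
    - exact: (Ult i il).2.
  have str i : (i < l)%N -> i != i0 -> U' i `<` U' i.+1.
    move=> il; rewrite neq_ltn => ii0; split; first exact: U'le.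
    move=> /step -/(_ il)[nUi Ui]; have [nUi0 Ui0] := step _ i0l eq0.
    case/orP: ii0 => ii0; first by apply: nUi0; apply: Ule Ui => //; exact: ltnW.
    by apply: nUi; apply: Ule Ui0 => //; exact: ltnW.
  case: l => [|l] // in sU Ult Ul Ule U'le U'l i0l step str *; rewrite ltnS.
  apply: (IH (adds W [:: h]) (fun j => if (j <= i0)%N then U' j else U' j.+1)) => //.
  - by move=> i _; case: ifP.
  - move=> i il; case: ltnP => ii0; rewrite ?(ltnW ii0).
      by apply: str; rewrite ?ltn_eqF // leqW.
    case: leqP => [ii0'|i0i]; last by apply: str => //; rewrite gtn_eqF // ltnW.
    have -> : i = i0 by apply/eqP; rewrite eqn_leq ii0 ii0'.
    have e : U' i0 = U' i0.+1 by apply/seteqP; split => //; exact: U'le.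
    rewrite e; apply: str; last by rewrite gtn_eqF.
    by apply: leq_ltn_trans il.
  - move: i0l; rewrite ltnS leq_eqVlt => /orP[/eqP e|i0l].
      by rewrite e leqnn; apply: subset_trans U'l; exact: U'le.
    by rewrite leqNgt i0l.
rewrite ltnW // ltnS; apply: (IH (adds W [:: h]) U') => // i il.
by split; [exact: U'le|move=> h'; apply: neq; exists i].
Qed.

Fixpoint indep W s : Prop :=
  if s is h :: s' then ~ W h /\ indep (adds W [:: h]) s' else True.

(* dim V / W = d *)
Definition flag W V (d : nat) : Prop :=
  is_subsp W /\ exists s, [/\ size s = d, indep W s & V = adds W s].

Lemma indep_cat W s t : is_subsp W ->
  indep W (s ++ t) <-> indep W s /\ indep (adds W s) t.
Proof.
elim: s W => [|h s IH] W sW /=; first by rewrite adds_nil //; split=> // -[].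
rewrite IH ?adds_cat; last exact: adds_subsp.
by split=> [[? [? ?]]|[[? ?] ?]].
Qed.

Lemma flag_sub W V d : flag W V d -> W `<=` V.
Proof. by move=> [_ [s [_ _ ->]]]; exact: subset_adds. Qed.

Lemma flag_refl W : is_subsp W -> flag W W 0.
Proof. by move=> sW; split=> //; exists [::]; split=> //; rewrite adds_nil. Qed.

Lemma flag0 W V : flag W V 0 -> W = V.
Proof. by move=> [sW [s [/size0nil -> _ ->]]]; rewrite adds_nil. Qed.

Lemma flag1 W h : is_subsp W -> ~ W h -> flag W (adds W [:: h]) 1.
Proof. by move=> sW Wh; split=> //; exists [:: h]. Qed.

Lemma flag_trans W V U d e : flag W V d -> flag V U e -> flag W U (d + e).
Proof.
move=> [sW [s [sd Is ->]]] [_ [t [te It ->]]]; split=> //.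
exists (s ++ t); split; first by rewrite size_cat sd te.
  by apply/indep_cat.
by rewrite adds_cat.
Qed.

Lemma flag_chain W V d : flag W V d -> exists U : nat -> set A,
  [/\ forall i, is_subsp (U i), U 0 = W, U d = V &
      forall i, (i < d)%N -> U i `<` U i.+1].
Proof.
move=> [sW [s [<- Is ->]]]; exists (fun i => adds W (take i s)); split.
- by move=> i; exact: adds_subsp.
- by rewrite take0 adds_nil.
- by rewrite take_size.
move=> i il; split.
  by apply: addsS => // x; rewrite (take_nth 0) // mem_rcons inE orbC => ->.
move=> sub; move: Is; rewrite -(cat_take_drop i s) (drop_nth 0) // indep_cat //.
case=> _ [+ _]; apply; apply: sub; apply: mem_adds.
by rewrite (take_nth 0) // mem_rcons mem_head.
Qed.

Lemma flag_le W V W' V' d d' : flag W V d -> flag W' V' d' ->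
  W `<=` W' -> V' `<=` V -> (d' <= d)%N.
Proof.
move=> [sW [s [<- _ Vs]]] /flag_chain[U [sU U0 Ud Ult]] WW VV.
by apply: (chain_le (W := W) (U := U)) => //; rewrite ?U0 // Ud -Vs.
Qed.

Lemma flag_uniq W V d d' : flag W V d -> flag W V d' -> d = d'.
Proof.
move=> f f'; apply/eqP; rewrite eqn_leq.
by rewrite (flag_le f f') // (flag_le f' f).
Qed.

Lemma flag_exists W V W' V' d : flag W V d -> is_subsp W' -> is_subsp V' ->
  W `<=` W' -> W' `<=` V' -> V' `<=` V -> exists d', flag W' V' d'.
Proof.
move=> f sW sV WW WV VV.
suff H k s : indep W' s -> adds W' s `<=` V' -> (d < size s + k)%N ->
    exists d', flag W' V' d'.
  by apply: (H d.+1 [::]); rewrite //= adds_nil.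
elim: k s => [|k IH] s Is sub.
  rewrite addn0 ltnNge => /negP[]; apply: (flag_le f (W' := W') (V' := adds W' s)) => //.
    by split=> //; exists s.
  exact: subset_trans sub VV.
move=> dk; have [e|/existsNP[h /not_implyP[Vh nh]]] := pselect (V' `<=` adds W' s).
  by exists (size s); split=> //; exists s; split=> //; apply/seteqP.
apply: (IH (rcons s h)); rewrite -?cats1 ?size_cat /= ?addn1 ?addSnnS //.
  by apply/indep_cat.
rewrite -adds_cat; apply: adds_min => // x; rewrite inE => /eqP -> //.
Qed.

(** When the vectors are added in increasing order, the dimension grows exactly at those not spanned
    by W and their predecessors. This is the linear algebra behind counting standard monomials. *)
Lemma flag_count (T : eqType) (lt : rel T) (f : T -> A) (l : seq T) W :
  is_subsp W -> (forall x y : T, lt x y -> ~~ lt y x) -> pairwise lt l ->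
  flag W (adds W (map f l))
    (count (fun x : T => `[< ~ adds W [seq f y | y : T <- l & lt y x] (f x) >]) l).
Proof.
move=> sW asym; elim/last_ind: l => [|l x IH].
  by rewrite /= adds_nil // => _; exact: flag_refl.
rewrite pairwise_rcons => /andP[/allP lx pl]; have {}IH := IH pl.
have ltxx y : lt y y = false by apply/negP => h; have := asym _ _ h; rewrite h.
rewrite -cats1 count_cat map_cat /= addn0 filter_cat /= ltxx cats0.
have -> : [seq y <- l | lt y x] = l by apply/all_filterP/allP.
rewrite -adds_cat; apply: (flag_trans (V := adds W [seq f i | i <- l])).
  rewrite (_ : count _ l = count (fun z => `[< ~ adds W [seq f y | y <- l & lt y z] (f z) >]) l) //.
   apply: eq_in_count => z zl; rewrite filter_cat /=.
  by rewrite (negbTE (asym _ _ (lx _ zl))) cats0.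
case: asboolP => nx; first by apply: flag1 => //; exact: adds_subsp.
rewrite (_ : adds (adds _ _) _ = adds W (map f l)); first exact: flag_refl (adds_subsp _ _).
apply/seteqP; split; last exact: subset_adds.
apply: adds_min => // [|y]; first exact: adds_subsp.
by rewrite inE => /eqP ->; exact: contrapT.
Qed.

End Flags.

Identity Coercion fun_of_set : set >-> Funclass.

(** * Ideals and their Hilbert functions *)

Section IdealMonoid.
Variable A : comNzRingType.

(** Bundled so that [imul] can be a commutative monoid law and products of powers can be big
    operators. *)
Record ideal := Ideal { iset :> set A; isetP : is_ideal iset }.

Lemma ideal_inj (I J : ideal) : iset I = J -> I = J.
Proof. by case: I J => [I hI] [J hJ] /= e; subst; congr Ideal; exact: Prop_irrelevance. Qed.

Lemma ideal_eq (I J : ideal) : I `<=` J -> J `<=` I -> I = J.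
Proof. by move=> IJ JI; apply: ideal_inj; apply/seteqP. Qed.

Implicit Types I J L : ideal.

Lemma ideal0 I : I 0. Proof. by case: (isetP I). Qed.
Lemma idealD I x y : I x -> I y -> I (x + y). Proof. by case: (isetP I) => _ + _; apply. Qed.
Lemma idealM I a x : I x -> I (a * x). Proof. by case: (isetP I) => _ _; apply. Qed.

Lemma is_ideal_igen (S : set A) : is_ideal (smallest (@is_ideal A) S).
Proof.
split=> [V [[]]//|x y Vx Vy V [iV SV]|c x Vx V [iV SV]].
  by case: (iV) => _ + _; apply; [exact: Vx|exact: Vy].
by case: (iV) => _ _; apply; exact: Vx.
Qed.

Definition igen S := Ideal (is_ideal_igen S).
Arguments igen : simpl never.

Lemma sub_igen (S : set A) : S `<=` igen S.
Proof. by move=> x Sx V [_]; apply. Qed.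

Lemma igen_min S I : S `<=` I -> igen S `<=` I.
Proof. by move=> SI x; apply; split => //; exact: isetP. Qed.

Definition imul I J := Ideal (is_ideal_igen [set x * y | x in I & y in J]).
Arguments imul : simpl never.

Lemma is_idealT : is_ideal [set: A]. Proof. by []. Qed.
Definition ione := Ideal is_idealT.

Lemma mem_imul I J x y : I x -> J y -> imul I J (x * y).
Proof. by move=> Ix Jy; apply: sub_igen; exists x => //; exists y. Qed.

Lemma imul_min I J L : (forall x y, I x -> J y -> L (x * y)) -> imul I J `<=` L.
Proof. by move=> h; apply: igen_min => _ [x Ix [y Jy <-]]; exact: h. Qed.

Lemma is_ideal_transp I (y : A) : is_ideal [set x | I (x * y)].
Proof.
split=> [|x z|c x] /=; rewrite ?mul0r ?mulrDl -?mulrA; first exact: ideal0.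
  exact: idealD.
exact: idealM.
Qed.

(** The colon ideal (I : y). Inclusions into it reduce statements about products to generators. *)
Definition itransp I y := Ideal (is_ideal_transp I y).

Lemma imulS I I' J J' : I `<=` I' -> J `<=` J' -> imul I J `<=` imul I' J'.
Proof. by move=> II JJ; apply: imul_min => x y /II Ix /JJ Jy; exact: mem_imul. Qed.

Lemma imulC : commutative imul.
Proof.
by move=> I J; apply: ideal_eq; apply: imul_min => x y Ix Jy; rewrite mulrC; exact: mem_imul.
Qed.

Lemma imul1 : left_id ione imul.
Proof.
move=> I; apply: ideal_eq; first by apply: imul_min => x y _ Iy; exact: idealM.
by move=> x Ix; rewrite -[x]mul1r; exact: mem_imul.
Qed.

Lemma imulA_sub I J L : imul (imul I J) L `<=` imul I (imul J L).
Proof.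
apply: imul_min => x y + Ly; suff : imul I J `<=` itransp (imul I (imul J L)) y by apply.
apply: imul_min => {}x z Ix Jz; change (imul I (imul J L) (x * z * y)).
by rewrite -mulrA; do 2!apply: mem_imul => //.
Qed.

Lemma imulA : associative imul.
Proof.
move=> I J L; apply: ideal_eq; last exact: imulA_sub.
by rewrite imulC [imul J L]imulC [imul I J]imulC [imul _ L]imulC; exact: imulA_sub.
Qed.

HB.instance Definition _ := Monoid.isComLaw.Build ideal ione imul imulA imulC imul1.

Lemma imul_sub I J : imul I J `<=` J.
Proof. by apply: imul_min => x y _; exact: idealM. Qed.

Lemma is_ideal_add I J : is_ideal (ideal_add I J).
Proof.
split=> [|_ _ [x Ix [y Jy <-]] [z Iz [t Jt <-]]|c _ [x Ix [y Jy <-]]].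
- by exists 0; [exact: ideal0|exists 0; [exact: ideal0|rewrite addr0]].
- exists (x + z); [exact: idealD|exists (y + t); [exact: idealD|]].
  by rewrite addrACA.
- exists (c * x); [exact: idealM|exists (c * y); [exact: idealM|]].
  by rewrite mulrDr.
Qed.

Definition iadd I J := Ideal (is_ideal_add I J).
Arguments iadd : simpl never.

Lemma iadd_subl I J : I `<=` iadd I J.
Proof. by move=> x Ix; exists x => //; exists 0; rewrite ?addr0//; exact: ideal0. Qed.
Lemma iadd_subr I J : J `<=` iadd I J.
Proof. by move=> x Jx; exists 0; [exact: ideal0|exists x; rewrite ?add0r]. Qed.
Lemma iadd_min I J L : I `<=` L -> J `<=` L -> iadd I J `<=` L.
Proof. by move=> IL JL _ [x /IL Lx [y /JL Ly <-]]; exact: idealD. Qed.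

Definition iexp I k := iter k (imul I) ione.

Lemma iexpS I k : iexp I k.+1 = imul I (iexp I k). Proof. by []. Qed.

Lemma iexpD I k l : iexp I (k + l) = imul (iexp I k) (iexp I l).
Proof. by elim: k => [|k IH]; rewrite ?imul1 // addSn !iexpS IH imulA. Qed.

Lemma iexp1 k : iexp ione k = ione.
Proof. by elim: k => // k IH; rewrite iexpS IH imul1. Qed.

Lemma iexpSs I J k : I `<=` J -> iexp I k `<=` iexp J k.
Proof. by move=> IJ; elim: k => // k IH; exact: imulS. Qed.

Lemma iexp_le I k l : (k <= l)%N -> iexp I l `<=` iexp I k.
Proof. by move=> /subnK <-; rewrite iexpD; exact: imul_sub. Qed.

Lemma iexpX I k l : iexp I (k * l) = iexp (iexp I k) l.
Proof.
by elim: l => [|l IH]; rewrite ?muln0 // mulnS iexpD IH.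
Qed.

Definition iprod (Q : finType) (L : Q -> ideal) (a : Q -> nat) :=
  \big[imul/ione]_b iexp (L b) (a b).

Lemma iprodS (Q : finType) (L L' : Q -> ideal) a :
  (forall b, L b `<=` L' b) -> iprod L a `<=` iprod L' a.
Proof.
move=> LL; rewrite /iprod; elim/big_ind2: _ => // [I I' J J'|b _].
  exact: imulS.
exact: iexpSs.
Qed.

Lemma iprod_upd (Q : finType) (L : Q -> ideal) a b x :
  iprod L (upd a b x) = imul (iexp (L b) x) (iprod L (upd a b 0)).
Proof.
rewrite /iprod (bigD1 b) //= [in RHS](bigD1 b) //= /upd eqxx /= imul1.
by congr imul; apply: eq_bigr => c /negbTE ->.
Qed.

Lemma upd_id (Q : eqType) T (a : Q -> T) b : upd a b (a b) = a.
Proof. by apply/funext => c; rewrite /upd; case: eqP => [->|]. Qed.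

Lemma iprod_updS (Q : finType) (L : Q -> ideal) a b :
  iprod L (upd a b (a b).+1) = imul (L b) (iprod L a).
Proof. by rewrite iprod_upd iexpS -imulA -iprod_upd upd_id. Qed.

Lemma iprod0 (Q : finType) (L : Q -> ideal) a : a =1 (fun=> 0%N) -> iprod L a = ione.
Proof. by move=> a0; apply: big1 => b _; rewrite a0. Qed.

Lemma mdeg_ind (Q : finType) (P : (Q -> nat) -> Prop) :
  P (fun=> 0%N) -> (forall a b, P a -> P (upd a b (a b).+1)) -> forall a, P a.
Proof.
move=> P0 PS a; move: {2}(\sum_b a b)%N (erefl (\sum_b a b)%N) => k.
elim: k a => [|k IH] a.
  move=> /eqP; rewrite sum_nat_eq0 => /forallP h.
  by rewrite (_ : a = fun=> 0%N) //; apply/funext => b; exact/eqP/h.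
move=> e; have [b b0] : exists b, (0 < a b)%N.
  apply/existsP; rewrite -[X in is_true X]negbK negb_exists; apply/negP => /forallP h.
  by move: e; rewrite big1 // => b _; apply/eqP; rewrite -leqn0 leqNgt; exact: h.
have -> : a = upd (upd a b (a b).-1) b (upd a b (a b).-1 b).+1.
  by apply/funext => c; rewrite /upd eqxx; case: eqP => // ->; rewrite prednK.
apply: PS; apply: IH; move: e; rewrite (bigD1 b) //= [X in _ -> X = _](bigD1 b) //=.
rewrite /upd eqxx -[in X in X -> _](prednK b0) addSn => -[<-]; congr (_ + _)%N.
by apply: eq_bigr => c /negbTE ->.
Qed.

Lemma iprodD (Q : finType) (L : Q -> ideal) a a' :
  iprod L (fun b => a b + a' b)%N = imul (iprod L a) (iprod L a').
Proof. by rewrite /iprod -big_split; apply: eq_bigr => b _; exact: iexpD. Qed.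

Lemma iprod_single (Q : finType) (L : Q -> ideal) b k :
  iprod L (fun c => (b == c) * k)%N = iexp (L b) k.
Proof.
rewrite /iprod (bigD1 b) //= eqxx mul1n big1 ?Monoid.mulm1 // => c.
by rewrite eq_sym => /negbTE ->.
Qed.

Lemma iexp_mem I x k : I x -> iexp I k (x ^+ k).
Proof. by move=> Ix; elim: k => // k IH; rewrite exprS; exact: mem_imul. Qed.

Definition fg I := exists s : seq A, I = igen [set` s].

Lemma fg_one : fg ione.
Proof.
exists [:: 1]; apply: ideal_eq => // x _; rewrite -[x]mulr1; apply: idealM.
by apply: sub_igen; rewrite /= mem_head.
Qed.

Lemma fg_mul I J : fg I -> fg J -> fg (imul I J).
Proof.
move=> [s eI] [t eJ]; exists [seq x * y | x <- s, y <- t].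
apply: ideal_eq; last first.
  apply: igen_min => _ /allpairsP[[x y] /= [xs yt ->]].
  by apply: mem_imul; rewrite (eI, eJ); exact: sub_igen.
set L := igen _; apply: imul_min => x y; rewrite eI eJ => sx ty.
have {}ty z : z \in s -> L (z * y).
  move=> zs; have incl : igen [set` t] `<=` itransp L z.
    apply: igen_min => w wt; change (L (w * z)).
    by rewrite mulrC; apply: sub_igen; apply: allpairs_f.
  by rewrite mulrC; exact: incl ty.
have incl : igen [set` s] `<=` itransp L y by apply: igen_min => z zs; exact: ty.
exact: incl sx.
Qed.

Lemma fg_exp I k : fg I -> fg (iexp I k).
Proof. by move=> fI; elim: k => [|k IH]; [exact: fg_one|exact: fg_mul]. Qed.

End IdealMonoid.

Arguments ione {A}.

(** * Standard monomials of multigraded Rees modules *)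

Section Groebner.
Variables (K : fieldType) (A : comNzRingType) (iota : {rmorphism K -> A}).
Local Notation ideal := (ideal A).
Local Notation adds := (adds iota).
Local Notation flag := (flag iota).

Lemma ideal_subsp (I : ideal) : is_subsp iota I.
Proof. by split=> [|x y|c x]; [exact: ideal0|exact: idealD|exact: idealM]. Qed.

Variable Q : finType.
Implicit Types (gs : seq (Q * A)) (mu nu : seq nat) (a : Q -> nat).

Fixpoint gpow gs mu : A :=
  if gs is p :: gs' then if mu is t :: mu' then p.2 ^+ t * gpow gs' mu' else 1 else 1.

Lemma gpow_incr gs mu i (p : Q * A) : size mu = size gs -> (i < size gs)%N ->
  gpow gs (incr_nth mu i) = (nth p gs i).2 * gpow gs mu.
Proof.
elim: gs mu i => [|q gs IH] [|t mu] [|i] //= [sz].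
  by rewrite exprS mulrA.
by rewrite ltnS => ig; rewrite IH // mulrCA.
Qed.

Variables (gs : seq (Q * A)) (L : Q -> ideal).
Hypothesis Lgen : forall b, L b = igen [set x | (b, x) \in gs].
Variables (W0 V0 : ideal) (h : A).
Hypothesis V0E : iset V0 = adds W0 [:: h].

Let bs := [seq p.1 | p <- gs].
Let W a := imul (iprod L a) W0.
Let V a := imul (iprod L a) V0.
Let sbs : size bs = size gs. Proof. exact: size_map. Qed.

Lemma gpow_mem mu : size mu = size gs -> iprod L (bdeg bs mu) (gpow gs mu).
Proof.
rewrite /bs; have : forall p, p \in gs -> L p.1 p.2.
  by move=> [b x] xgs; rewrite Lgen; exact: sub_igen.
elim: gs mu => [|p gs' IH] [|t mu] // Lp smu; first by rewrite iprod0.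
case: smu => smu /=; rewrite iprodD iprod_single; apply: mem_imul.
  by apply: iexp_mem; apply: Lp; rewrite mem_head.
by apply: IH => // q qgs; apply: Lp; rewrite inE qgs orbT.
Qed.

(** A description of L^a V0 by K-linear generators modulo L^a W0. Scalars from K suffice because
    every multiple of h lies in K h + W0. *)
Let X a := adds (W a) [seq gpow gs mu * h | mu <- mons bs a].

Let mons_size mu a : mu \in mons bs a -> size mu = size gs.
Proof. by rewrite mem_mons sbs => /andP[/eqP]. Qed.

Let mons_deg mu a : mu \in mons bs a -> bdeg bs mu = a.
Proof. by rewrite mem_mons => /andP[_ /forallP e]; apply/funext => c; exact/eqP. Qed.

Let V0h : V0 h.
Proof. by rewrite V0E; apply: mem_adds; rewrite mem_head. Qed.

Let W0V0 : W0 `<=` V0.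
Proof. by rewrite V0E; exact: subset_adds. Qed.

Let sub_XV a : X a `<=` V a.
Proof.
apply: adds_min; first exact: ideal_subsp.
  exact: imulS.
move=> _ /mapP[mu mua ->]; apply: mem_imul => //.
by rewrite -(mons_deg mua); apply: gpow_mem; exact: mons_size mua.
Qed.

Let X_ideal a : is_ideal (X a).
Proof.
have [X0 XD XZ] := adds_subsp iota (W a) [seq gpow gs mu * h | mu <- mons bs a].
split=> // c x Xx; apply: (adds_min (V := [set x | X a (c * x)])) Xx.
- split=> [|y z Xy Xz|d y Xy] /=; rewrite ?mulr0 ?mulrDr //; first exact: XD.
  by rewrite mulrCA; exact: XZ.
- by move=> y Wy; apply: subset_adds; exact: idealM.
move=> _ /mapP[mu mua ->] /=; rewrite mulrCA.
have : V0 (c * h) by exact: idealM.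
rewrite V0E => /adds1P[|d W0d _]; first exact: ideal_subsp.
rewrite -[c * h](subrK (iota d * h)) mulrDr; apply: XD.
  apply: subset_adds; apply: mem_imul => //.
  by rewrite -(mons_deg mua); apply: gpow_mem; exact: mons_size mua.
by rewrite mulrCA; apply: XZ; apply: mem_adds; exact: (map_f (fun mu => gpow gs mu * h)).
Qed.

Let bdeg_incr_upd mu i p : size mu = size gs -> (i < size gs)%N ->
  bdeg bs (incr_nth mu i) =
  upd (bdeg bs mu) (nth p gs i).1 (bdeg bs mu (nth p gs i).1).+1.
Proof.
move=> smu igs; apply/funext => c; rewrite (@bdeg_incr _ _ _ _ p.1) ?sbs //.
by rewrite (nth_map p) // /upd eq_sym; case: eqP => [->|].
Qed.

Let WS a b x w : L b x -> W a w -> W (upd a b (a b).+1) (x * w).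
Proof. by move=> Lx Ww; rewrite /W iprod_updS -imulA; exact: mem_imul. Qed.

(** Multiplication by the i-th generator carries a linear relation modulo [W a] into the next
    multidegree and shifts all exponent vectors alike. Both the spanning by monomials and the
    closure of standard monomials under division rest on this. *)
Let adds_incr i p a s x : (i < size gs)%N -> all (fun mu => size mu == size gs) s ->
  adds (W a) [seq gpow gs mu * h | mu <- s] x ->
  adds (W (upd a (nth p gs i).1 (a (nth p gs i).1).+1))
    [seq gpow gs (incr_nth mu i) * h | mu <- s] ((nth p gs i).2 * x).
Proof.
set W' := W (upd _ _ _) => igs /allP smu Xx.
have [X0 XD XZ] := adds_subsp iota W' [seq gpow gs (incr_nth mu i) * h | mu <- s].
apply: (adds_min (V := [set x | adds W' [seq gpow gs (incr_nth mu i) * h | mu <- s]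
  ((nth p gs i).2 * x)])) Xx.
- split=> [|y z Xy Xz|d y Xy] /=; rewrite ?mulr0 ?mulrDr //; first exact: XD.
  by rewrite mulrCA; exact: XZ.
- move=> w Ww; apply: subset_adds; apply: WS => //.
  by rewrite Lgen; apply: sub_igen; rewrite /= -surjective_pairing mem_nth.
move=> _ /mapP[mu mus ->] /=; apply: mem_adds; apply/mapP; exists mu => //.
by rewrite mulrA (gpow_incr p) //; exact/eqP/smu.
Qed.

Let sub_VX a : V a `<=` X a.
Proof.
elim/mdeg_ind: a => [|a b IH].
  rewrite /V /X /W !iprod0 // !imul1 V0E; apply: addsS => // x.
  rewrite inE => /eqP ->; apply/mapP; exists (nseq (size gs) 0%N).
    rewrite mem_mons size_nseq sbs eqxx; apply/forallP => c; rewrite -sbs.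
    by apply/eqP; elim: bs => //= d bs' ->; rewrite muln0.
  by elim: gs => [|p gs' IH] /=; rewrite ?mul1r // expr0 mul1r.
rewrite /V iprod_updS -imulA; set a' := upd _ _ _; pose X' := Ideal (X_ideal a').
suff : imul (L b) (V a) `<=` X' by [].
apply: imul_min => x v + /IH Xv; rewrite Lgen.
suff : igen [set x | (b, x) \in gs] `<=` itransp X' v by apply.
apply: igen_min => {}x xgs; have [i igs pE] := nthP (b, x) xgs.
have := @adds_incr i (b, x) a (mons bs a) v igs.
rewrite pE => H; have {}H := H _ Xv; apply: addsS (H _) => // [y /mapP[mu mua ->]|].
  apply/mapP; exists (incr_nth mu i) => //; rewrite mem_mons size_incr_nth.
  rewrite (mons_size mua) igs sbs eqxx; apply/forallP => c.
  by rewrite (bdeg_incr_upd (b, x)) ?(mons_size mua) // pE (mons_deg mua).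
by apply/allP => mu mua; rewrite (mons_size mua).
Qed.

(** The quotients L^a V0 / L^a W0 form a graded module over the polynomial ring on the generators
    [gs], generated by the class of h. Its standard monomials, those not reducible to
    lexicographically smaller ones of the same multidegree, are closed under division and give a
    basis in each multidegree. *)
Lemma flag_groebner : exists2 F : (Q -> nat) -> nat, stanley F &
  forall a, flag (imul (iprod L a) W0) (imul (iprod L a) V0) (F a).
Proof.
pose std mu := `[< ~ adds (W (bdeg bs mu)) [seq gpow gs nu * h |
  nu <- mons bs (bdeg bs mu) & lexlt nu mu] (gpow gs mu * h) >].
exists (fun a => count std (mons bs a)).
  apply: count_mons_stanley => mu i smu ibs /asboolP nstd.
  (* Contrapositive: a reduction of mu, multiplied by the i-th generator, reduces [incr_nth mu i],
     since incrementing preserves the lexicographic order. *)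
  apply/asboolP => stdm; apply: nstd; rewrite sbs in smu ibs.
  case gsE: gs => [|p gs0]; first by move: ibs; rewrite gsE.
  rewrite -gsE (bdeg_incr_upd p) // (gpow_incr p) // -mulrA.
  apply: addsS (@adds_incr i p _ _ _ ibs _ stdm) => // [x /mapP[nu]|].
    rewrite mem_filter => /andP[lnu nua] ->; apply: (map_f (fun nu => gpow gs nu * h)).
    rewrite mem_filter lexlt_incr ?(mons_size nua) //= mem_mons size_incr_nth.
    rewrite (mons_size nua) ibs sbs eqxx; apply/forallP => c.
    by rewrite (bdeg_incr_upd p) ?(mons_size nua) // (mons_deg nua).
  by apply/allP => nu; rewrite mem_filter => /andP[_ nua]; rewrite (mons_size nua).
move=> a; have -> : iset (imul (iprod L a) V0) = X a.
  by apply/seteqP; split; [exact: sub_VX|exact: sub_XV].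
have := @flag_count _ _ iota _ lexlt (fun mu => gpow gs mu * h) (mons bs a) (W a)
  (@ideal_subsp _) lexlt_asym (mons_lex bs a).
rewrite (eq_in_count (a2 := std)) // => mu mua.
by rewrite /std (mons_deg mua).
Qed.

End Groebner.

Lemma big_option (R : Type) (idx : R) (op : Monoid.com_law idx) (T : finType) (F : option T -> R) :
  \big[op/idx]_o F o = op (F None) (\big[op/idx]_j F (Some j)).
Proof.
rewrite (bigD1 None) //= (reindex_omap Some id) /= => [|[j|]] //.
by congr (op _ _); apply: eq_bigl => j; rewrite eqxx.
Qed.

Section Split.
Variables (T : finType) (i : T).

Definition split_deg (a : T -> nat) (t : nat) (o : option T) : nat :=
  if o is Some j then upd a i t j else (a i - t.+1)%N.

(** Summation over t convolves the coordinates [Some i] and [None], whose degrees add up to a_i - 1;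
    hence the shift at i is raised by one. *)
Lemma stanley_split (F : (option T -> nat) -> nat) : stanley F ->
  stanley (fun a => \sum_(t < a i) F (split_deg a t))%N.
Proof.
move=> [l Fl].
exists [seq (upd (fun j => p.1 (Some j)) i (p.1 (Some i) + p.1 None)%N,
             upd (fun j => p.2 (Some j)) i (p.2 (Some i) + p.2 None).+1) | p <- l] => a /=.
under eq_bigr do rewrite Fl.
rewrite exchange_big big_map /=; apply: eq_bigr => p _.
rewrite (bigD1 i) //= /upd eqxx.
under eq_bigr => t _ do
  rewrite big_option /= [X in (_ * X)%N](bigD1 i) //= /upd eqxx mulnA.
rewrite -[X in (_ = X * _)%N](_ : \sum_(t < a i)
  nmons (p.1 None) (p.2 None) (a i - t.+1) * nmons (p.1 (Some i)) (p.2 (Some i)) t = _)%N.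
  rewrite big_distrl /=; apply: eq_bigr => t _; congr (_ * _)%N.
  by apply: eq_bigr => j /negbTE ->.
case: (a i) => [|x]; first by rewrite big_ord0.
rewrite [RHS]/nmons ltnS subSS -/(nmons _ _ x) -nmons_conv.
by apply: eq_bigr => t _; rewrite subSS mulnC.
Qed.

End Split.

(** * Lengths and Hilbert functions in a local ring *)

Section LocalRing.
Variables (K : fieldType) (A : comNzRingType) (iota : {rmorphism K -> A}).
Local Notation ideal := (ideal A).
Local Notation adds := (adds iota).
Local Notation flag := (flag iota).
Variable m : ideal.
Hypothesis residue : forall x, exists c, m (x - iota c).
Hypothesis m_fg : fg m.
Hypothesis m_cofinite : forall k, exists d, flag (iexp m k) setT d.

Implicit Types I V Z : ideal.

(** With k = 0 this includes the unit ideal, from which the Hilbert function of a family is built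
    up. *)
Definition primary I := exists k, iexp m k `<=` I.

Lemma primaryS I V : I `<=` V -> primary I -> primary V.
Proof. by move=> IV [k mI]; exists k; exact: subset_trans mI IV. Qed.

Lemma primary_flag I V : I `<=` V -> primary I -> exists d, flag I V d.
Proof.
move=> IV [k kI]; have [d f] := m_cofinite k.
by apply: flag_exists f _ _ kI IV _ => //; exact: ideal_subsp.
Qed.

(** The ring is finite-dimensional modulo m^k, so finitely many elements of I together with
    generators of m^k generate I. *)
Lemma primary_fg I : primary I -> fg I.
Proof.
move=> [k kI]; have [d f] := m_cofinite k.
have [d' [_ [s [_ _ Is]]]] : exists d', flag (iexp m k) I d'.
  by apply: flag_exists f _ _ _ kI _ => //; exact: ideal_subsp.
have [t et] := fg_exp k m_fg; exists (s ++ t); apply: ideal_eq.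
  rewrite Is; apply: adds_min; first exact: ideal_subsp.
    rewrite et; apply: igen_min => x xt; apply: sub_igen.
    by rewrite /= mem_cat orbC; apply/orP; left.
  by move=> x xs; apply: sub_igen; rewrite /= mem_cat xs.
apply: igen_min => x; rewrite /= mem_cat => /orP[xs|xt].
  by rewrite Is; exact: mem_adds.
by apply: kI; rewrite et; exact: sub_igen.
Qed.

(** Multiply an element of V outside I by elements of m as long as the product stays outside I; the
    power of m contained in I bounds the number of steps. *)
Lemma socle_elt I V : primary I -> ~ V `<=` I ->
  exists h, [/\ V h, ~ I h & forall x, m x -> I (x * h)].
Proof.
move=> [k kI] /existsNP[h0 /not_implyP[Vh0 Ih0]].
have : forall x, iexp m k x -> I (x * h0).
  by move=> x /kI Ix; rewrite mulrC; exact: idealM.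
elim: k h0 Vh0 Ih0 {kI} => [|k IH] h Vh Ih mh.
  by exfalso; apply: Ih; rewrite -[h]mul1r; exact: mh.
have [all|/existsNP[x /not_implyP[mx nI]]] := pselect (forall x, m x -> I (x * h)).
  by exists h.
apply: (IH (x * h)) => // [|y my]; first exact: idealM.
by rewrite mulrA [y * x]mulrC; apply: mh; exact: mem_imul.
Qed.

(** Every ring element is a constant modulo m, and m h lies in I. *)
Lemma adds1_ideal I h : (forall x, m x -> I (x * h)) -> is_ideal (adds I [:: h]).
Proof.
move=> mh; have [X0 XD XZ] := adds_subsp iota I [:: h].
split=> // a x Xx; apply: (adds_min (V := [set x | adds I [:: h] (a * x)])) Xx.
- split=> [|y z Xy Xz|d y Xy] /=; rewrite ?mulr0 ?mulrDr //; first exact: XD.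
  by rewrite mulrCA; exact: XZ.
- by move=> y Wy; apply: subset_adds; exact: idealM.
move=> y; rewrite inE => /eqP -> /=; have [c mc] := residue a.
rewrite -(subrK (iota c) a) mulrDl; apply: XD.
  by apply: subset_adds; exact: mh.
by apply: XZ; apply: mem_adds; rewrite mem_head.
Qed.

Lemma flag_step I V d : primary I -> flag I V d.+1 ->
  exists Z h, [/\ iset Z = adds I [:: h], ~ I h, primary Z & flag Z V d].
Proof.
move=> pI f; have nVI : ~ V `<=` I.
  move=> VI; have := flag_refl (ideal_subsp iota I).
  have -> : flag I I = flag I V by congr flag; apply/seteqP; split => //; exact: flag_sub f.
  by move=> /flag_uniq /(_ f).
have [h [Vh Ih mh]] := socle_elt pI nVI.
exists (Ideal (adds1_ideal mh)), h.
have IZ : I `<=` Ideal (adds1_ideal mh) by exact: subset_adds.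
have pZ := primaryS IZ pI.
have ZV : Ideal (adds1_ideal mh) `<=` V.
  apply: adds_min; [exact: ideal_subsp|exact: flag_sub f|].
  by move=> x; rewrite inE => /eqP ->.
split=> //; have [e fe] := primary_flag ZV pZ.
have := flag_trans (flag1 (ideal_subsp iota I) Ih) fe.
by move=> /flag_uniq /(_ f) [<-].
Qed.

(** Socle elements refine I to the whole ring by ideals of relative dimension one, which gives d
    strict steps. Conversely a chain of ideals is a chain of subspaces, so [chain_le] bounds it. *)
Lemma flag_has_colength I d : primary I -> flag I setT d -> has_colength I d.
Proof.
move=> pI f; split.
  elim: d I pI f => [|d IH] I pI f.
    by exists (fun=> I); split=> // j _; split=> //; exact: isetP.
  have [Z [h [Zh Ih pZ fZ]]] := flag_step pI (V := ione) f.
  have [U [Uid Ult]] := IH Z pZ fZ.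
  have IZ : I `<=` Z by rewrite Zh; exact: subset_adds.
  exists (fun j => if j is j'.+1 then U j' else iset I); split=> [[|j]|[|j]] jd.
  - by split=> //; exact: isetP.
  - by have [? ZU] := Uid j jd; split=> //; exact: subset_trans ZU.
  - have [_ ZU] := Uid 0%N (leq0n _); split; first exact: subset_trans ZU.
    by move=> /(_ h) UI; apply/Ih/UI/ZU; rewrite Zh; apply: mem_adds; rewrite mem_head.
  - exact: Ult.
move=> [U [Uid Ult]]; case: f => _ [s [sd _ sT]].
suff : (d.+1 <= d)%N by rewrite ltnn.
rewrite -{2}sd; apply: (@chain_le _ _ iota I s U) => //.
- by move=> i id; apply: (ideal_subsp iota (Ideal (Uid i id).1)).
- by have [] := Uid 0%N (leq0n _).
- by rewrite -sT.
Qed.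

Section Product.
Variables (Q : finType) (L : Q -> ideal).
Hypothesis Lfg : forall b, fg (L b).

(** Climb from I to V through ideals of relative dimension one; each step contributes the Stanley
    function of [flag_groebner]. *)
Lemma flag_iprod I V : primary I -> I `<=` V ->
  exists2 F : (Q -> nat) -> nat, stanley F &
  forall a, flag (imul (iprod L a) I) (imul (iprod L a) V) (F a).
Proof.
move=> pI IV; have [d f] := primary_flag IV pI.
have [s Ls] := choice Lfg.
pose gs := [seq (b, x) | b <- enum Q, x <- s b].
have Lgen b : L b = igen [set x | (b, x) \in gs].
  rewrite {1}Ls; congr igen; apply/funext => x /=; apply/propext; split=> [xs|].
    by apply/allpairsPdep; exists b, x; rewrite mem_enum.
  by move=> /allpairsPdep[b' [x' [_ xs [-> ->]]]].
elim: d I pI f {IV} => [|d IH] I pI f.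
  have -> : V = I by apply: ideal_inj; rewrite (flag0 f).
  by exists (fun=> 0%N); [exact: stanley0|move=> a; exact/flag_refl/ideal_subsp].
have [Z [h [Zh Ih pZ fZ]]] := flag_step pI f.
have [F sF fF] := IH Z pZ fZ.
have [F' sF' fF'] := flag_groebner Lgen Zh.
exists (fun a => (F' a + F a)%N); first exact: stanleyD.
by move=> a; exact: flag_trans (fF' a) (fF a).
Qed.

End Product.

Section Hilbert.
Variable T : finType.
Implicit Types (L : T -> ideal) (a : T -> nat).

(* Replacing one ideal L i by a larger I' changes the Hilbert function by a
   Stanley function: interpolate through L_i^t I'^(a_i - t). *)
Lemma flag_iprod_upd L i I' : (forall j, primary (L j)) -> L i `<=` I' ->
  exists2 G : (T -> nat) -> nat, stanley G &
  forall a, flag (iprod L a) (iprod (upd L i I') a) (G a).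
Proof.
move=> pL LI.
have Lfg o : fg (oapp L I' o).
  by apply: primary_fg; case: o => [j|] //=; exact: primaryS (pL i).
have [F sF fF] := flag_iprod Lfg (pL i) LI.
exists (fun a => \sum_(t < a i) F (split_deg i a t))%N; first exact: stanley_split.
move=> a; pose U t := imul (iexp I' (a i - t)) (iprod L (upd a i t)).
have UE t : (t < a i)%N -> flag (U t.+1) (U t) (F (split_deg i a t)).
  move=> ta; have := fF (split_deg i a t).
  have -> : iprod (oapp L I') (split_deg i a t) =
      imul (iexp I' (a i - t.+1)) (iprod L (upd a i t)).
    by rewrite /iprod big_option.
  congr flag; congr iset; rewrite /U.
    rewrite [imul _ (L i)]imulC imulA [imul (L i) _]imulC -imulA; congr imul.
    by rewrite [RHS]iprod_upd iexpS -imulA -iprod_upd.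
  by rewrite [imul _ I']imulC imulA -iexpS subnSK.
have -> : iprod L a = U (a i) by rewrite /U subnn imul1 upd_id.
have -> : iprod (upd L i I') a = U 0%N.
  rewrite /U subn0 /iprod (bigD1 i) //= [in RHS](bigD1 i) //= /upd eqxx imul1.
  by congr imul; apply: eq_bigr => j /negbTE ->.
suff H t : (t <= a i)%N -> flag (U t) (U 0%N) (\sum_(s < t) F (split_deg i a s))%N.
  exact: H.
elim: t => [|t IH] ta.
  by rewrite big_ord0; exact/flag_refl/ideal_subsp.
by rewrite big_ord_recr /= addnC; apply: flag_trans (UE _ ta) (IH _); exact: ltnW.
Qed.

(** Start from unit ideals, where the codimension is 0, and shrink them to the L j one at a time by
    [flag_iprod_upd]. *)
Lemma flag_iprodT L : (forall j, primary (L j)) ->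
  exists2 H : (T -> nat) -> nat, stanley H & forall a, flag (iprod L a) setT (H a).
Proof.
move=> pL; pose Ls (s : seq T) j := if j \in s then L j else ione.
have pLs s j : primary (Ls s j).
  by rewrite /Ls; case: ifP => // _; exists 0%N.
suff [H sH fH] : exists2 H, stanley H & forall a, flag (iprod (Ls (enum T)) a) setT (H a).
  exists H => // a; rewrite (_ : L = Ls (enum T)) //.
  by apply/funext => j; rewrite /Ls mem_enum.
elim: (enum T) => [|i s [H sH fH]].
  exists (fun=> 0%N); first exact: stanley0.
  move=> a; have -> : iprod (Ls [::]) a = ione by apply: big1 => j _; exact: iexp1.
  exact/flag_refl.
have LsS : Ls (i :: s) i `<=` Ls s i by rewrite /Ls mem_head; case: ifP => _ x.
have [G sG fG] := flag_iprod_upd (pLs _) LsS.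
have e : upd (Ls (i :: s)) i (Ls s i) = Ls s.
  apply/funext => j; rewrite /upd; case: eqP => [->//|/eqP ji].
  by rewrite /Ls inE (negbTE ji).
rewrite e in fG; exists (fun a => (G a + H a)%N); first exact: stanleyD.
by move=> a; exact: flag_trans (fG a) (fH a).
Qed.

End Hilbert.
End LocalRing.

(** * Germs *)

Section GermTheory.
Variables (R : realType) (n : nat).
Local Notation C := R[i].
Local Notation O := (holo_germ R n).
Local Notation mnm := (multinom n).
Implicit Types (f g h : O) (k m u : mnm) (E : set mnm).

Lemma hcoefD f g k : hcoef (f + g) k = hcoef f k + hcoef g k. Proof. by []. Qed.
Lemma hcoefN f k : hcoef (- f) k = - hcoef f k. Proof. by []. Qed.
Lemma hcoef0 k : hcoef (0 : O) k = 0. Proof. by rewrite /=; case: ifP. Qed.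

Lemma hcoef_sum (I : Type) (r : seq I) (F : I -> O) k :
  hcoef (\sum_(i <- r) F i) k = \sum_(i <- r) hcoef (F i) k.
Proof.
by elim: r => [|i r IH]; rewrite ?big_nil ?hcoef0 // !big_cons hcoefD IH.
Qed.

Lemma hcoefM_neq0 f g m : hcoef (f * g) m != 0 ->
  exists k1 k2, [/\ m = mnm_add k1 k2, hcoef f k1 != 0 & hcoef g k2 != 0].
Proof.
move=> fg0; apply: contrapT => nex; move/eqP: fg0; apply; apply: big1 => -[k1 k2] /= /eqP mE.
apply/eqP; apply/negPn/negP; rewrite mulf_eq0 negb_or => /andP[f0 g0].
by apply: nex; exists (bmnm k1), (bmnm k2).
Qed.

Lemma germ_const_zmod : zmod_morphism (@germ_const R n).
Proof.
by move=> x y; apply: holo_germP => k; rewrite hcoefD hcoefN /=; case: ifP; rewrite ?subrr.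
Qed.
HB.instance Definition _ := GRing.isZmodMorphism.Build C O (@germ_const R n) germ_const_zmod.

Lemma hcoef_constM c h k : hcoef (germ_const n c * h) k = c * hcoef h k.
Proof.
rewrite -[LHS]/(cauchy_prod _ _ _).
have H := @mcoeff_truncation R n (mdeg k).+1.
rewrite (@cauchy_prodE _ _ _ _ _ _ (mpolyC n c) _ (ltnSn _) _ (H h)) ?mcoeffCM ?H //.
by move=> l _; rewrite mcoeffC /=; case: eqP => _; rewrite ?mulr1 ?mulr0.
Qed.

Lemma germ_const_monoid : monoid_morphism (@germ_const R n).
Proof.
split=> // x y; apply: holo_germP => k; rewrite hcoef_constM /=.
by case: ifP; rewrite ?mulr0.
Qed.
HB.instance Definition _ := GRing.isMonoidMorphism.Build C O (@germ_const R n) germ_const_monoid.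

Definition germC : {rmorphism C -> O} := @germ_const R n.

Lemma convergent_mono u : @convergent_series R n (fun k => (k == u)%:R).
Proof.
exists 1, 1; split => // d; under eq_bigr do rewrite expr1n mulr1.
have [ud|du] := ltnP (mdeg u) d.
  rewrite (bigD1 (BMultinom ud)) //= eqxx normr1 big1 ?addr0 // => k ku.
  by move: ku; rewrite -val_eqE /= => /negbTE ->; rewrite normr0.
rewrite big1 ?ler01 // => -[k kd] _ /=; case: eqP => [ku|]; last by rewrite normr0.
by move: kd; rewrite ku ltnNge du.
Qed.
Definition gmono u : O := HoloGerm (convergent_mono u).

Lemma hcoef_monoM u h m :
  hcoef (gmono u * h) m = if lem u m then hcoef h (mnm_sub m u) else 0.
Proof.
case: ifP => um; last first.
  apply/eqP; apply/negPn/negP => /hcoefM_neq0[k1 [k2 [mE + _]]] /=.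
  rewrite /=; have [k1u _|_] := eqVneq k1 u; last by rewrite eqxx.
  by rewrite -k1u mE lem_addr in um.
rewrite -[LHS]/(cauchy_prod _ _ _).
have H := @mcoeff_truncation R n (mdeg m).+1.
rewrite (@cauchy_prodE _ _ _ _ _ _ (mpolyX C u) _ (ltnSn _) _ (H h)); last first.
  by move=> l _; rewrite mcoeffX eq_sym.
rewrite mulrC -{1}(submK um) [mnm_add _ _]addmC mcoeffMX H // ltnS.
exact: mdegB.
Qed.

Definition supp_in E : set O := [set h | forall k, hcoef h k != 0 -> E k].

Lemma supp_in_subsp E : is_subsp germC (supp_in E).
Proof.
split=> [k|f g Ef Eg k|c f Ef k].
- by rewrite hcoef0 eqxx.
- rewrite hcoefD => fg0; have [f0|/Ef//] := eqVneq (hcoef f k) 0.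
  by apply: Eg; move: fg0; rewrite f0 add0r.
- by rewrite hcoef_constM mulf_eq0 negb_or => /andP[_ /Ef].
Qed.

Definition up_closed E := forall k l, E k -> E (mnm_add k l).

Lemma supp_in_ideal E : up_closed E -> is_ideal (supp_in E).
Proof.
move=> uE; have [? ? _] := supp_in_subsp E; split=> // a f Ef k.
by move=> /hcoefM_neq0[k1 [k2 [-> _ /Ef]]]; rewrite addmC; exact: uE.
Qed.

Lemma supp_inS E E' : E `<=` E' -> supp_in E `<=` supp_in E'.
Proof. by move=> EE f Ef k /Ef /EE. Qed.

Lemma supp_in_flag E (s : seq mnm) : uniq s -> (forall k, k \in s -> ~ E k) ->
  flag germC (supp_in E) (supp_in (E `|` [set` s])) (size s).
Proof.
elim: s E => [|u s IH] E /=.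
  move=> _ _; have -> : E `|` [set` [::]] = E.
    by apply/seteqP; split=> [k []//|k]; left.
  exact/flag_refl/supp_in_subsp.
move=> /andP[us us'] nE; rewrite -add1n.
have Eu : supp_in (E `|` [set u]) = adds germC (supp_in E) [:: gmono u].
  apply/seteqP; split; last first.
    apply: adds_min; first exact: supp_in_subsp.
      by apply: supp_inS => k Ek; left.
    move=> f; rewrite inE => /eqP -> k /=; have [->|] := eqVneq k u; first by right.
    by rewrite eqxx.
  move=> f Ef; have [_ XD XZ] := adds_subsp germC (supp_in E) [:: gmono u].
  rewrite -(subrK (germC (hcoef f u) * gmono u) f); apply: XD; last first.
    by apply: XZ; apply: mem_adds; rewrite mem_head.
  apply: subset_adds => k; rewrite hcoefD hcoefN hcoef_constM /=.
  have [->|ku] := eqVneq k u; first by rewrite mulr1 subrr eqxx.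
  by rewrite mulr0 subr0 => /Ef[//|/= ku']; move: ku; rewrite ku' eqxx.
apply: (flag_trans (V := supp_in (E `|` [set u]))).
  rewrite Eu; apply: flag1; first exact: supp_in_subsp.
  move=> /(_ u) /=; rewrite eqxx oner_eq0 => /(_ isT); apply: nE.
  by rewrite mem_head.
have -> : E `|` [set` u :: s] = (E `|` [set u]) `|` [set` s].
  apply/seteqP; split=> k /=; rewrite ?inE.
    by move=> [Ek|/orP[/eqP->|ks]]; [left; left|left; right|right].
  by move=> [[Ek|->]|ks]; [left|right; rewrite eqxx|right; rewrite ks orbT].
apply: IH => // k ks [Ek|/= ku]; last by rewrite -ku ks in us.
by apply: (nE k) => //; rewrite inE ks orbT.
Qed.

Lemma supp_inT E : (forall k, E k) -> supp_in E = setT.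
Proof. by move=> ET; apply/seteqP; split=> // f _ k _. Qed.

(** Division by x_i moves terms of degree d + 1 to degree d, so the bound gets divided by the
    radius. The filter P serves to keep only the monomials charged to x_i. *)
Lemma convergent_shift (P : pred mnm) h (i : 'I_n) :
  convergent_series (fun k => if P k then hcoef h (mnm_add k (mnm1 i)) else 0).
Proof.
have [r [K [r0 hK]]] := hcoef_conv h; exists r, (K / r); split=> // d.
rewrite ler_pdivlMr //.
apply: le_trans (hK d.+1); rewrite mulr_suml.
have kd (k : bmultinom n d) : (mdeg (mnm_add k (mnm1 i)) < d.+1)%N.
  by rewrite mdegD mdeg1 addn1 ltnS bmdeg.
pose F (k : bmultinom n d) := BMultinom (kd k).
have Finj : injective F.
  by move=> k l /(congr1 (@bmnm _ _)) /= /addIm e; exact: val_inj.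
pose G (k : bmultinom n d.+1) := `|hcoef h k| * r ^+ mdeg k.
have G0 (k : bmultinom n d.+1) : 0 <= G k by rewrite mulr_ge0 // exprn_ge0 // ltW.
apply: (@le_trans _ _ (\sum_(k : bmultinom n d) G (F k))).
  apply: ler_sum => k _; rewrite /G /= mdegD mdeg1 exprD expr1 mulrA.
  case: ifP => // _; rewrite normr0 !mul0r mulr_ge0 ?(ltW r0) // mulr_ge0 //.
  by rewrite exprn_ge0 // ltW.
have -> : \sum_k G (F k) = \sum_(k in [set F l | l in predT]%SET) G k.
  by rewrite big_imset //; exact: in2W.
rewrite [leRHS](bigID [in [set F l | l in predT]%SET]) /= lerDl.
by apply: sumr_ge0 => k _; exact: G0.
Qed.

Definition gshift P h i : O := HoloGerm (convergent_shift P h i).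

(* Each monomial is charged to its first variable. *)
Let first_var (i : 'I_n) (k : mnm) := [forall j : 'I_n, (j < i)%N ==> (k j == 0%N)].

Lemma germ_split h : hcoef h mnm0 = 0 ->
  h = \sum_i gmono (mnm1 i) * gshift (first_var i) h i.
Proof.
move=> h0; apply: holo_germP => m; rewrite hcoef_sum.
have [->|m0] := eqVneq m mnm0.
  rewrite h0 big1 // => i _; rewrite hcoef_monoM ifN //.
  by apply/mnm_lepP => /(_ i); rewrite mnm0E mnmE eqxx.
have [i mi mmin] : exists2 i : 'I_n, (0 < m i)%N & forall j : 'I_n, (j < i)%N -> m j = 0%N.
  have [i0 mi0] : exists i : 'I_n, (0 < m i)%N.
    apply: contrapT => nex; move/eqP: m0; apply; apply/mnmP => i; rewrite mnm0E.
    by apply/eqP; rewrite -leqn0 leqNgt; apply/negP => mi; apply: nex; exists i.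
  have [i mi imin] := @arg_minnP _ i0 (fun i : 'I_n => (0 < m i)%N) val mi0.
  exists i => // j ji; apply/eqP; rewrite -leqn0 leqNgt; apply/negP => /imin.
  by rewrite leqNgt ji.
have lem1 (j : 'I_n) : lem (mnm1 j) m = (0 < m j)%N.
  apply/mnm_lepP/idP => [/(_ j)|mj l]; first by rewrite mnmE eqxx.
  by rewrite mnmE; case: eqP => // <-.
rewrite (bigD1 i) // big1 ?addr0 => [|j ji].
   rewrite hcoef_monoM lem1 mi /= ifT ?submK ?lem1 ?addr0 //.
   by apply/forallP => j; apply/implyP => ji; rewrite mnmBE mmin.
rewrite hcoef_monoM lem1; case: ifP => // mj; rewrite /= ifF //.
apply/negP => /forallP /(_ i); rewrite mnmBE mnmE -[(j == i)]/((j : nat) == i).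
have [ij|ji'|e] := ltngtP i j; last first.
  by move=> _; move/eqP: ji; apply; exact/val_inj/esym.
  by move=> _; rewrite mmin in mj.
by rewrite subn0 /= => /eqP mi0; rewrite mi0 in mi.
Qed.

Definition order_ge (d : nat) : set mnm := [set k | (d <= mdeg k)%N].
Arguments order_ge d k /.

Lemma order_ge_up d : up_closed (order_ge d).
Proof. by move=> k l /=; rewrite mdegD => /leq_trans; apply; exact: leq_addr. Qed.

Lemma is_ideal_max : is_ideal (@max_ideal R n).
Proof.
rewrite (_ : @max_ideal R n = supp_in (order_ge 1)).
  exact/supp_in_ideal/order_ge_up.
apply/seteqP; split=> f /= f0.
  by move=> k fk; rewrite /= lt0n mdeg_eq0; apply: contraNneq fk => ->; rewrite f0.
by apply/eqP; apply/negPn/negP => /f0 /=; rewrite mdeg0.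
Qed.

Definition maxI : ideal O := Ideal is_ideal_max.

Lemma gshift_supp P h i d : supp_in (order_ge d.+1) h ->
  supp_in (order_ge d) (gshift P h i).
Proof.
move=> hd k /=; case: ifP => [_ /hd /=|]; last by rewrite eqxx.
by rewrite mdegD mdeg1 addn1.
Qed.

Lemma gmono_max i : maxI (gmono (mnm1 i)).
Proof. 
apply/eqP; rewrite /= pnatr_eq0 eqb0; apply/eqP => /mnmP /(_ i).
by rewrite mnmE mnmE eqxx.
Qed.

Lemma max_exp d : iset (iexp maxI d) = supp_in (order_ge d).
Proof.
elim: d => [|d IH]; first by rewrite supp_inT.
apply/seteqP; split.
  apply: (@imul_min _ maxI (iexp maxI d) (Ideal (supp_in_ideal (@order_ge_up d.+1)))).
  move=> x y /= x0; rewrite IH => yd k /hcoefM_neq0[k1 [k2 [-> xk1 /yd]]] /=.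
  rewrite mdegD -add1n; apply: leq_add.
  by rewrite lt0n mdeg_eq0; apply: contraNneq xk1 => ->; rewrite x0.
move=> h hd; have h0 : hcoef h mnm0 = 0.
  by apply/eqP; apply/negPn/negP => /hd /=; rewrite mdeg0.
rewrite (germ_split h0).
have : forall i, iexp maxI d.+1 (gmono (mnm1 i) * gshift (first_var i) h i).
  move=> i; rewrite iexpS; apply: mem_imul; first exact: gmono_max.
  by rewrite IH; exact: gshift_supp.
move=> H; elim/big_ind: _ => [|x y|i _]; [exact: ideal0|exact: idealD|exact: H].
Qed.

Lemma max_fg : fg maxI.
Proof.
exists [seq gmono (mnm1 i) | i <- enum 'I_n]; apply: ideal_eq.
  move=> h h0; rewrite (germ_split h0).
  elim/big_ind: _ => [|x y|i _]; [exact: ideal0|exact: idealD|].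
  rewrite mulrC; apply: idealM; apply: sub_igen; apply: map_f.
  by rewrite mem_enum.
by apply: igen_min => _ /mapP[i _ ->]; exact: gmono_max.
Qed.

Lemma max_residue (x : O) : exists c, maxI (x - germC c).
Proof.
exists (hcoef x mnm0); change (hcoef (x - germC (hcoef x mnm0)) mnm0 = 0).
by rewrite hcoefD hcoefN [hcoef (germC _) _]/= ?eqxx subrr.
Qed.

Lemma order_ge_flag d : flag germC (supp_in (order_ge d)) setT #|{: bmultinom n d}|.
Proof.
pose s := [seq bmnm k | k : bmultinom n d <- enum {: bmultinom n d}].
have sE k : k \in s = (mdeg k < d)%N.
  apply/mapP/idP => [[l _ ->]|kd]; first exact: bmdeg.
  by exists (BMultinom kd); rewrite ?mem_enum.
have us : uniq s by rewrite map_inj_uniq ?enum_uniq //; exact: val_inj.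
have := supp_in_flag (E := order_ge d) us; rewrite size_map -cardE.
have -> : supp_in (order_ge d `|` [set` s]) = setT.
  by apply: supp_inT => k; have [kd|dk] := ltnP (mdeg k) d; [right; rewrite /= sE|left].
by apply=> k; rewrite sE ltnNge => /negP.
Qed.

Lemma max_cofinite d : exists e, flag germC (iexp maxI d) setT e.
Proof. by rewrite max_exp; eexists; exact: order_ge_flag. Qed.

(** Only the order d^n matters: it is what bounds the degree of Hilbert polynomials by n. *)
Lemma card_bmultinom_le d : (#|{: bmultinom n d}| <= d ^ n)%N.
Proof.
have [->|d0] := posnP d.
  rewrite (_ : #|_| = 0%N) //; apply: eq_card0 => -[k kd]; exfalso.
  by move: kd; rewrite ltn0.
have kd (k : bmultinom n d) i : (bmnm k i < d)%N.
  by apply: leq_ltn_trans (bmdeg k); rewrite mdegE (bigD1 i) //= leq_addr.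
pose F (k : bmultinom n d) := [ffun i => Ordinal (kd k i)].
have Finj : injective F.
  move=> k l /ffunP e; apply: val_inj; apply/mnmP => i.
  by have := e i; rewrite !ffunE => /(congr1 val).
by have := leq_card F Finj; rewrite card_ffun !card_ord.
Qed.

End GermTheory.

(** * Mixed multiplicities *)

Section MixedDifference.
Variable n : nat.
Implicit Types (a s : 'I_n -> nat) (f g : ('I_n -> nat) -> rat).

Definition set_sign (S : {set 'I_n}) : rat := \prod_i (if i \in S then 1 else -1).

Definition shift_on s (S : {set 'I_n}) a : 'I_n -> nat :=
  fun i => (a i + (i \in S) * s i)%N.

(** The composite over all i of the difference operators of step s_i in the i-th variable, expanded
    over the set S of shifted variables. *)
Definition mdiff s f a : rat := \sum_(S : {set 'I_n}) set_sign S * f (shift_on s S a).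

Lemma mdiff_prod s (F : 'I_n -> nat -> rat) a :
  mdiff s (fun a => \prod_i F i (a i)) a = \prod_i (F i (a i + s i)%N - F i (a i)).
Proof.
rewrite bigA_distr; apply: eq_bigr => S _; rewrite -big_split /=.
apply: eq_bigr => i _; rewrite /shift_on; case: ifP => _.
  by rewrite mul1r mul1n.
by rewrite mulN1r mul0n addn0.
Qed.

Lemma mdiff_sum (I : Type) (r : seq I) (F : I -> ('I_n -> nat) -> rat) s a :
  mdiff s (fun a => \sum_(i <- r) F i a) a = \sum_(i <- r) mdiff s (F i) a.
Proof.
by rewrite /mdiff exchange_big; apply: eq_bigr => S _; rewrite mulr_sumr.
Qed.

Lemma mdiffD s f g a : mdiff s (fun a => f a + g a) a = mdiff s f a + mdiff s g a.
Proof. by rewrite /mdiff -big_split; apply: eq_bigr => S _; rewrite mulrDr. Qed.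

Lemma mdiffZ s c f a : mdiff s (fun a => c * f a) a = c * mdiff s f a.
Proof. by rewrite /mdiff mulr_sumr; apply: eq_bigr => S _; rewrite mulrCA. Qed.

Lemma eq_mdiff s f g a N : (forall i, (N <= a i)%N) ->
  (forall b, (forall i, (N <= b i)%N) -> f b = g b) -> mdiff s f a = mdiff s g a.
Proof.
move=> aN fg; apply: eq_bigr => S _; rewrite fg // => i.
by rewrite (leq_trans (aN i)) // leq_addr.
Qed.

Definition mnm_ones : multinom n := Multinom [tuple 1%N | i < n].

(** A monomial that misses a variable is killed by the difference in that variable, and the only
    monomial of degree at most n containing all variables is their product. So the mixed difference
    extracts exactly the coefficient that defines e. *)
Lemma mdiff_meval s (P : mpoly n rat) a : (msize P <= n.+1)%N ->
  mdiff s (fun a => meval (fun i => (a i)%:R) P) a =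
  (\prod_i (s i)%:R) * mcoeff mnm_ones P.
Proof.
move=> sP.
pose F (m : multinom n) (i : 'I_n) (x : nat) : rat := x%:R ^+ m i.
transitivity (\sum_(m <- msupp P) mcoeff m P * mdiff s (fun a => \prod_i F m i (a i)) a).
  under [RHS]eq_bigr do rewrite -mdiffZ.
  rewrite -mdiff_sum; exact: (@eq_mdiff _ _ _ _ 0).
under [LHS]eq_bigr => m _ do rewrite (mdiff_prod s (F m)).
have F0 (m : multinom n) : m \in msupp P -> m != mnm_ones ->
    \prod_i (F m i (a i + s i)%N - F m i (a i)) = 0.
  move=> mP m1; have [i mi0] : exists i, m i = 0%N.
    apply: contrapT => nex; move/eqP: m1; apply.
    have m_gt0 i : (0 < m i)%N by rewrite lt0n; apply/eqP => mi0; apply: nex; exists i.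
    have := msize_mdeg_lt mP => /leq_trans /(_ sP); rewrite ltnS mdegE => sm.
    apply/mnmP => i; rewrite mnmE; apply/eqP; rewrite eqn_leq m_gt0 andbT.
    move: sm; rewrite (bigD1 i) //=.
    have : (\sum_(j < n | j != i) 1 <= \sum_(j < n | j != i) m j)%N by exact: leq_sum.
    rewrite sum1_card cardC1 card_ord; move: (\sum_(j < n | _) _)%N (ltn_ord i) => X; lia.
  by rewrite (bigD1 i) //= /F mi0 !expr0 subrr mul0r.
have [m1P|m1P] := boolP (mnm_ones \in msupp P); last first.
  rewrite (_ : mcoeff _ P = 0); last by apply/eqP; rewrite mcoeff_eq0.
  rewrite mulr0 big_seq big1 // => m mP; rewrite F0 ?mulr0 //.
  by apply: contraNneq m1P => <-.
rewrite (bigD1_seq mnm_ones) ?msupp_uniq //= [X in _ + X](_ : _ = 0) ?addr0; last first.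
  by rewrite big_seq_cond big1 // => m /andP[mP m1]; rewrite F0 ?mulr0.
rewrite mulrC; congr (_ * _); apply: eq_bigr => i _.
by rewrite /F mnmE !expr1 natrD addrC addKr.
Qed.

(** The mixed difference of a product is a product of differences, and N exceeds all shifts, so that
    each factor is a natural number by [nmons_leS]. *)
Lemma stanley_mdiff (G : ('I_n -> nat) -> nat) : stanley G ->
  exists N, forall a, (forall i, (N <= a i)%N) ->
  exists e : nat, mdiff (fun=> 1%N) (fun a => (G a)%:R) a = e%:R.
Proof.
move=> [l Gl]; pose N := (\sum_(t <- l) \sum_i (t.2 i).+1)%N.
exists N => a aN.
have ut t i : t \in l -> (t.2 i < a i)%N.
  move=> tl; apply: leq_trans (aN i); rewrite /N (big_rem t) //= (bigD1 i) //=.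
  by rewrite -addnA leq_addr.
exists (\sum_(t <- l) \prod_i (nmons (t.1 i) (t.2 i) (a i).+1 - nmons (t.1 i) (t.2 i) (a i)))%N.
rewrite natr_sum.
transitivity (mdiff (fun=> 1%N) (fun a =>
    \sum_(t <- l) \prod_i (nmons (t.1 i) (t.2 i) (a i))%:R) a).
  apply: (@eq_mdiff _ _ _ _ 0) => // b _; rewrite Gl natr_sum.
  by apply: eq_bigr => t _; rewrite natr_prod.
rewrite mdiff_sum big_seq [RHS]big_seq; apply: eq_bigr => t tl.
rewrite (mdiff_prod _ (fun i x => (nmons (t.1 i) (t.2 i) x)%:R)) natr_prod.
by apply: eq_bigr => i _; rewrite addn1 natrB // nmons_leS // ut.
Qed.

End MixedDifference.

Section StanleyPoly.
Variable n : nat.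

Definition deg_le (d : nat) (p : mpoly n rat) := (msize p <= d.+1)%N.

Lemma deg_leM d e p q : deg_le d p -> deg_le e q -> deg_le (d + e) (p * q).
Proof.
rewrite /deg_le => pd qe.
have [->|p0] := eqVneq p 0; first by rewrite mul0r msize0.
have [->|q0] := eqVneq q 0; first by rewrite mulr0 msize0.
by rewrite msizeM //; move: pd qe; set x := msize p; set y := msize q; lia.
Qed.

Lemma deg_le_prod (I : Type) (r : seq I) (d : I -> nat) (F : I -> mpoly n rat) :
  (forall i, deg_le (d i) (F i)) -> deg_le (\sum_(i <- r) d i) (\prod_(i <- r) F i).
Proof.
move=> dF; elim: r => [|i r IH]; first by rewrite !big_nil /deg_le msize1.
by rewrite !big_cons; exact: deg_leM.
Qed.

Lemma deg_le_sum (I : eqType) (r : seq I) d (F : I -> mpoly n rat) :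
  (forall i, i \in r -> deg_le d (F i)) -> deg_le d (\sum_(i <- r) F i).
Proof.
move=> dF; rewrite /deg_le; elim: r dF => [|i r IH] dF.
  by rewrite big_nil msize0.
rewrite big_cons (leq_trans (msizeD_le _ _)) // geq_max; apply/andP; split.
  by apply: dF; rewrite mem_head.
by apply: IH => j jr; apply: dF; rewrite inE jr orbT.
Qed.

Lemma nmonsE s u x : (u <= x)%N ->
  (nmons s.+1 u x)%:R * (s`!)%:R = \prod_(j < s) (x%:R + (j.+1%:R - u%:R)) :> rat.
Proof.
move=> ux; rewrite /nmons ux nmonE -natrM bin_ffact.
transitivity (\prod_(j < s) ((x - u)%N%:R + j.+1%:R) : rat); last first.
  by apply: eq_bigr => j _; rewrite natrB //; ring.
elim: s => [|s IH]; first by rewrite big_ord0 ffactn0.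
by rewrite big_ord_recr /= -IH addnS ffactSS natrM mulrC -natrD addnS.
Qed.

Lemma nmons_ge s u x : (u <= x)%N -> ((x - u) ^ s <= nmons s.+1 u x * s`!)%N.
Proof.
move=> ux; rewrite /nmons ux nmonE bin_ffact.
elim: s => // s IH; rewrite addnS ffactSS expnS leq_mul //; lia.
Qed.

(** A term with some s_i = 0 vanishes for large arguments; any other one is eventually a polynomial
    of degree the sum of the s_i - 1. Since all terms are nonnegative, a single term of degree above
    n would already violate the bound on the diagonal. *)
Lemma stanley_poly (H : ('I_n -> nat) -> nat) c : stanley H ->
  (forall t, H (fun=> t) <= c * t ^ n)%N ->
  exists P : mpoly n rat, (msize P <= n.+1)%N /\
  exists N, forall a, (forall i, (N <= a i)%N) ->
    meval (fun i => (a i)%:R) P = (H a)%:R.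
Proof.
move=> [l Hl] Hc; pose N := (\sum_(t <- l) \sum_i (t.2 i).+1)%N.
have uN t i : t \in l -> (t.2 i < N)%N.
  move=> tl; rewrite /N (big_rem t) //= (bigD1 i) //=.
  by rewrite -addnA leq_addr.
pose full (t : ('I_n -> nat) * ('I_n -> nat)) := [forall i, (0 < t.1 i)%N].
pose Pt (t : ('I_n -> nat) * ('I_n -> nat)) : mpoly n rat :=
  mpolyC n (\prod_i (((t.1 i).-1)`!)%:R^-1) *
  \prod_i \prod_(j < (t.1 i).-1) (mpolyX rat (mnm1 i) + mpolyC n (j.+1%:R - (t.2 i)%:R)).
pose P := \sum_(t <- [seq t <- l | full t]) Pt t.
have PtE t a : t \in l -> (forall i, (N <= a i)%N) -> full t ->
    meval (fun i => (a i)%:R) (Pt t) = (\prod_i nmons (t.1 i) (t.2 i) (a i))%:R.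
  move=> tl aN /forallP ft; rewrite mevalM mevalC rmorph_prod /= natr_prod -big_split /=.
  apply: eq_bigr => i _; rewrite rmorph_prod /=.
  under eq_bigr do rewrite mevalD mevalXU mevalC.
  rewrite -nmonsE; last by rewrite ltnW // (leq_trans (uN t i tl)).
  rewrite (prednK (ft i)) mulrC mulfK // pnatr_eq0 -lt0n; exact: fact_gt0.
exists P; split; last first.
  exists N => a aN; rewrite /P raddf_sum /= big_filter Hl natr_sum [LHS]big_mkcond /=.
  rewrite big_seq [RHS]big_seq; apply: eq_bigr => t tl.
  case: ifP => [ft|/negP nf]; first exact: PtE.
  have [i ti] : exists i, t.1 i = 0%N.
    apply: contrapT => nex; apply: nf; apply/forallP => i.
    by rewrite lt0n; apply/eqP => ti; apply: nex; exists i.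
  rewrite (bigD1 i) //= ti nmons0 gtn_eqF ?mul0n //.
  by rewrite (leq_trans (uN t i tl)).
apply: deg_le_sum => t; rewrite mem_filter => /andP[/forallP ft tl].
suff dn : (\sum_i (t.1 i).-1 <= n)%N.
  have : deg_le (0 + \sum_i \sum_(j < (t.1 i).-1) 1) (Pt t).
    apply: deg_leM; first by rewrite /deg_le msizeC; case: (_ != 0).
    apply: deg_le_prod => i; apply: deg_le_prod => j; rewrite /deg_le.
    rewrite (leq_trans (msizeD_le _ _)) // geq_max msizeX mdeg1 leqnn /=.
    by rewrite msizeC; case: (_ != 0).
  rewrite /deg_le add0n => /leq_trans; apply; rewrite ltnS.
  by under eq_bigr do rewrite sum1_card card_ord.
rewrite leqNgt; apply/negP => nD; set d := (\sum_i _)%N in nD.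
(* At the diagonal point 2 T, the term t times the product of the (s_i - 1)! is at least T^d,
   because 2 T - u_i >= T, while the growth bound gives at most c' T^n. With T > c' and d > n this
   is absurd. *)
pose c' := ((\prod_i ((t.1 i).-1)`!) * c * 2 ^ n)%N.
pose T := (N + c').+1.
have NT : (N <= T)%N by rewrite leqW // leq_addr.
have cT : (c' < T)%N by rewrite ltnS leq_addl.
have T_gt1 : (0 < T)%N by [].
clearbody T N.
have : (T ^ d <= c' * T ^ n)%N.
  have -> : (c' * T ^ n = (\prod_i ((t.1 i).-1)`!) * (c * (T + T) ^ n))%N.
    by rewrite /c' -!mulnA -expnMn mul2n addnn.
  apply: leq_trans (leq_mul (leqnn _) (Hc _)); rewrite Hl (big_rem t) //=.
  apply: leq_trans (leq_mul (leqnn _) (leq_addr _ _)).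
  rewrite mulnC -big_split /= /d expn_sum; apply: leq_prod => i _.
  have ti := uN t i tl.
  rewrite -{2}(prednK (ft i)); apply: leq_trans (nmons_ge _ _); last first.
    by rewrite (leq_trans (ltnW ti)) // (leq_trans NT) // leq_addr.
  have [->|i0] := posnP (t.1 i).-1; first by rewrite !expn0.
  by rewrite leq_exp2r // -addnBA ?leq_addr // (leq_trans (ltnW ti)).
rewrite leqNgt => /negP; apply.
apply: (@leq_trans (T * T ^ n)); first by rewrite ltn_pmul2r ?expn_gt0 ?T_gt1.
by rewrite -expnS leq_pexp2l.
Qed.

End StanleyPoly.

Lemma colength_ge_le (A : comNzRingType) (I : set A) d e :
  (d <= e)%N -> colength_ge I e -> colength_ge I d.
Proof.
move=> de [K [Kid Klt]]; exists K; split=> j jd.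
  by apply: Kid; exact: leq_trans de.
by apply: Klt; exact: leq_trans de.
Qed.

Lemma has_colength_uniq (A : comNzRingType) (I : set A) d e :
  has_colength I d -> has_colength I e -> d = e.
Proof.
suff H d' e' : has_colength I d' -> has_colength I e' -> (e' <= d')%N.
  by move=> hd he; apply/eqP; rewrite eqn_leq (H d e) // (H e d).
move=> [_ nd] [he _]; rewrite leqNgt; apply/negP => de.
by apply: nd; exact: colength_ge_le he.
Qed.

Lemma ffact_le_expn t k : (t ^_ k <= t ^ k)%N.
Proof.
elim: k t => // k IH t; rewrite ffactnS expnS leq_mul // (leq_trans (IH _)) //.
by case: k {IH} => // k; rewrite leq_exp2r // leq_pred.
Qed.

(** * Iterated differences in one variable *)

Section FiniteDifference.

Fixpoint fdiff k (f : nat -> rat) : nat -> rat :=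
  if k is k'.+1 then fdiff k' (fun t => f t.+1 - f t) else f.

Lemma fdiffE k f t :
  fdiff k f t = \sum_(j < k.+1) (('X - 1) ^+ k)`_j * f (t + j)%N.
Proof.
elim: k f => [|k IH] f /=; first by rewrite big_ord1 expr0 coef1 mul1r addn0.
rewrite IH; set q := ('X - 1) ^+ k; rewrite exprS -/q.
have qk : q`_k.+1 = 0.
  by rewrite nth_default // size_exp_XsubC.
under [RHS]eq_bigr do rewrite mulrBl mul1r coefB mulrBl.
rewrite sumrB [X in _ = X - _]big_ord_recl [X in _ = _ - X]big_ord_recr /= qk mul0r addr0.
rewrite coefXM mul0r add0r -sumrB; apply: eq_bigr => j _.
by rewrite coefXM /= mulrBr addnS.
Qed.

(** Both sides expand (X - 1)^n, the left one over subsets and the right one by powers of X. *)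
Lemma mdiff_fdiff n (f : nat -> rat) a :
  mdiff (fun=> 1%N) (fun a : 'I_n -> nat => f (\sum_i a i)%N) a = fdiff n f (\sum_i a i)%N.
Proof.
have qE : ('X - 1 : {poly rat}) ^+ n = \sum_(S : {set 'I_n}) (set_sign S)%:P * 'X^#|S|.
  transitivity (\prod_(i < n) ('X + (- 1 : {poly rat}))).
    by rewrite prodr_const card_ord.
  rewrite bigA_distr; apply: eq_bigr => S _.
  rewrite /set_sign rmorph_prod /=.
  rewrite (_ : 'X^#|S| = \prod_i (if i \in S then 'X else 1 : {poly rat})).
    rewrite -big_split /=; apply: eq_bigr => i _.
    by case: ifP => _; rewrite ?polyCN polyC1 ?mul1r ?mulr1.
  by rewrite -big_mkcond prodr_const.
rewrite fdiffE qE.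
under [RHS]eq_bigr => j _ do rewrite coef_sum mulr_suml.
rewrite exchange_big; apply: eq_bigr => S _.
have Sn : (#|S| < n.+1)%N by rewrite ltnS -[n in (_ <= n)%N]card_ord max_card.
rewrite (bigD1 (Ordinal Sn)) //= coefCM coefXn eqxx mulr1 [X in _ + X]big1 ?addr0 => [|j jS].
  congr (_ * f _); rewrite /shift_on big_split /= -sum1_card; congr addn.
  by rewrite [RHS]big_mkcond; apply: eq_bigr => i _; rewrite muln1; case: (i \in S).
rewrite coefCM coefXn (_ : (j == _ :> nat) = false) ?mulr0 ?mul0r //.
by apply/negbTE; move: jS; rewrite -val_eqE.
Qed.

(** Newton's forward interpolation formula as an inequality: the bound is summed k times, and
    absolute values make the summation constants nonnegative. *)
Lemma fdiff_bound k (f : nat -> rat) N e : (forall t, (N <= t)%N -> fdiff k f t <= e) ->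
  exists c : nat -> rat, (forall i, 0 <= c i) /\
  forall t, f (N + t)%N <= e * ('C(t, k))%:R + \sum_(i < k) c i * ('C(t, i))%:R.
Proof.
elim: k f => [|k IH] f /= he.
  exists (fun=> 0); split=> // t; rewrite big_ord0 bin0 mulr1 addr0.
  by apply: he; exact: leq_addr.
have [c [c0 hc]] := IH _ he.
exists (fun i => if i is i'.+1 then c i' else `|f N|); split=> [[|i]//|].
elim=> [|t IHt].
  rewrite addn0 bin0n mulr0 add0r big_ord_recl bin0 mulr1.
  rewrite (le_trans (ler_norm _)) // lerDl sumr_ge0 // => i _.
  by rewrite mulr_ge0.
rewrite addnS -(subrK (f (N + t)%N) (f _.+1)).
apply: le_trans (lerD (hc t) IHt) _.
rewrite [leLHS]addrACA -mulrDr -natrD [('C(t, k) + _)%N]addnC -binS lerD2l.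
rewrite !big_ord_recl /= !bin0 addrCA lerD2l.
rewrite -big_split /=; apply: ler_sum => i _.
by rewrite /bump /= !add1n -mulrDr -natrD addnC -binS.
Qed.

End FiniteDifference.

Section MixedMult.
Variables (R : realType) (n : nat).
Local Notation O := (holo_germ R n).
Local Notation ideal := (ideal O).
Local Notation mI := (maxI R n).
Local Notation flag := (flag (germC R n)).
Local Notation primary := (primary mI).
Implicit Types (I : ideal) (L : 'I_n -> ideal) (a s : 'I_n -> nat).

Let flag_iprodT := flag_iprodT (@max_residue R n) (@max_fg R n) (@max_cofinite R n).
Let flag_iprod_upd := flag_iprod_upd (@max_residue R n) (@max_fg R n) (@max_cofinite R n).
Let primary_flag := primary_flag (@max_cofinite R n).

Definition mmult L := mixed_mult (fun i => iset (L i)).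

Lemma big_ideal_mulE L a :
  \big[@ideal_mul O/setT]_(i < n) ideal_exp (L i) (a i) = iprod L a.
Proof.
rewrite /iprod (big_morph (@iset O) (id1 := setT) (op1 := @ideal_mul O)) //.
apply: eq_bigr => i _; elim: (a i) => // k IH.
by rewrite iexpS -[iset (imul _ _)]/(ideal_mul _ _) -IH.
Qed.

Lemma iprod_const I a : iprod (fun=> I) a = iexp I (\sum_i a i)%N.
Proof.
rewrite (big_morph (iexp I) (iexpD I) (erefl : iexp I 0 = ione)).
by [].
Qed.

Lemma primary_iexp I k : primary I -> primary (iexp I k).
Proof. by move=> [d dI]; exists (d * k)%N; rewrite iexpX; exact: iexpSs. Qed.

Lemma iprod_primary L a : (forall i, primary (L i)) -> primary (iprod L a).
Proof.
move=> pL; rewrite /iprod; elim/big_ind: _ => [|I I' [d dI] [e eI]|i _].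
- by exists 0%N.
- by exists (d + e)%N; rewrite iexpD; exact: imulS.
- exact: primary_iexp.
Qed.

(** All L_i contain m^d, so the product of their t-th powers contains m^(d n t), of colength at most
    (d n t)^n. *)
Lemma hilbert_growth L (H : ('I_n -> nat) -> nat) : (forall i, primary (L i)) ->
  (forall a, flag (iprod L a) setT (H a)) ->
  exists c, forall t, (H (fun=> t) <= c * t ^ n)%N.
Proof.
move=> pL fH; have [k kL] := choice pL; pose d := (\sum_i k i)%N.
have dL i : iexp mI d `<=` L i.
  by apply: subset_trans (kL i); apply: iexp_le; rewrite /d (bigD1 i) //= leq_addr.
exists ((d * n) ^ n)%N => t; rewrite -expnMn.
have f := @order_ge_flag R n (d * n * t).
rewrite -max_exp in f; apply: leq_trans (card_bmultinom_le _ _).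
apply: (flag_le f (fH _)) => //.
have -> : iexp mI (d * n * t) = iprod (fun _ : 'I_n => iexp mI d) (fun=> t).
  by rewrite iprod_const sum_nat_const card_ord -iexpX mulnA.
exact: iprodS.
Qed.

(* The steps s are arbitrary, so that passing to powers of the ideals amounts to
   a change of steps. *)
Lemma mixed_multP L : (forall i, primary (L i)) ->
  exists H : ('I_n -> nat) -> nat,
  [/\ stanley H, forall a, flag (iprod L a) setT (H a) &
      exists N, forall s a, (forall i, (N <= a i)%N) ->
      mdiff s (fun b => (H b)%:R) a = (\prod_i (s i)%:R) * (mmult L)%:R].
Proof.
move=> pL; have [H sH fH] := flag_iprodT pL; exists H; split=> //.
have colH a : has_colength (\big[@ideal_mul O/setT]_(i < n) ideal_exp (L i) (a i)) (H a).
  rewrite big_ideal_mulE.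
  by apply: (flag_has_colength (@max_residue R n) (@max_cofinite R n)) => //; exact: iprod_primary.
have [c Hc] := hilbert_growth pL fH.
have [P [sP [N PH]]] := stanley_poly sH Hc.
have [N1 hN1] := stanley_mdiff sH.
(* The definition asks for a natural number as coefficient; it is one because it equals the mixed
   difference with unit steps at a far point. *)
have [e eE] : exists e : nat, mcoeff (mnm_ones n) P = e%:R.
  have [e he] := hN1 (fun=> maxn N N1) (fun=> leq_maxr _ _).
  exists e; rewrite -he.
  rewrite -(@eq_mdiff _ _ (fun a => meval (fun i => (a i)%:R) P) _ _ N (fun=> leq_maxl _ _)) //.
  by rewrite mdiff_meval // big1 ?mul1r.
have [Q [sQ Q1 [M QM]]] : is_mixed_mult (fun i => iset (L i)) (mmult L).
  apply: (xgetPex 0%N); exists e; exists P; split=> //; exists N => r rN.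
  by exists (H r); [exact: colH|exact: PH].
exists M => s a aM.
rewrite -(@eq_mdiff _ _ (fun a => meval (fun i => (a i)%:R) Q) _ _ M aM).
  by rewrite mdiff_meval // Q1.
by move=> b /QM[l /(has_colength_uniq (colH b)) <-].
Qed.

Lemma mmult_upd_le L i I : (forall j, primary (L j)) -> L i `<=` I ->
  (mmult (upd L i I) <= mmult L)%N.
Proof.
move=> pL LI; have pL' j : primary (upd L i I j).
  by rewrite /upd; case: eqP => [_|//]; exact: primaryS (pL i).
have [H [sH fH [N hN]]] := mixed_multP pL.
have [H' [sH' fH' [N' hN']]] := mixed_multP pL'.
have [G sG fG] := flag_iprod_upd pL LI.
have [M hM] := stanley_mdiff sG.
pose a (_ : 'I_n) := maxn N (maxn N' M).
have [e he] := hM a (fun=> leq_trans (leq_maxr _ _) (leq_maxr _ _)).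
have := hN (fun=> 1%N) a (fun=> leq_maxl _ _).
have := hN' (fun=> 1%N) a (fun=> leq_trans (leq_maxl _ _) (leq_maxr _ _)).
rewrite big1 // !mul1r => e1 e2.
rewrite -(ler_nat rat) -e1 -e2.
rewrite (_ : (fun b => (H b)%:R) = (fun b => (G b)%:R + (H' b)%:R : rat)).
  by rewrite mdiffD he lerDr ler0n.
by apply/funext => b; rewrite -natrD (flag_uniq (fH b) (flag_trans (fG b) (fH' b))).
Qed.

Lemma mmult_le L L' : (forall i, primary (L i)) -> (forall i, L i `<=` L' i) ->
  (mmult L' <= mmult L)%N.
Proof.
move=> pL LL'.
pose Ls (s : seq 'I_n) j := if j \in s then L' j else L j.
have -> : L' = Ls (enum 'I_n) by apply/funext => j; rewrite /Ls mem_enum.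
have pLs (r : seq 'I_n) j : primary (Ls r j).
  by rewrite /Ls; case: ifP => // _; exact: primaryS (pL j).
elim: (enum 'I_n) => [|i r IH]; first exact: leqnn.
apply: leq_trans IH.
have -> : Ls (i :: r) = upd (Ls r) i (L' i).
  by apply/funext => j; rewrite /Ls /upd inE; case: eqP => [->|].
apply: mmult_upd_le => //; rewrite /Ls; case: ifP => // _ x //.
Qed.

(** The Hilbert function of the powers is H(s_1 a_1, ..., s_n a_n). Its mixed difference with unit
    steps is that of H with steps s_i, hence the factor s_1 ... s_n. *)
Lemma mmult_iexp L s : (forall i, primary (L i)) -> (forall i, (0 < s i)%N) ->
  mmult (fun i => iexp (L i) (s i)) = (\prod_i s i * mmult L)%N.
Proof.
move=> pL s0.
have [H [sH fH [N hN]]] := mixed_multP pL.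
have [H' [sH' fH' [N' hN']]] := mixed_multP (fun i => primary_iexp (s i) (pL i)).
apply/eqP; rewrite -(eqr_nat rat) natrM natr_prod.
pose a (_ : 'I_n) := maxn N N'.
have := hN' (fun=> 1%N) a (fun=> leq_maxr _ _); rewrite big1 // mul1r => <-.
have <- := hN s (fun i => s i * a i)%N; last first.
  by move=> i; rewrite (leq_trans (leq_maxl N N')) // leq_pmull.
apply/eqP; apply: eq_bigr => S _; congr (_ * _%:R).
have -> : shift_on s S (fun i => s i * a i)%N = fun i => (s i * shift_on (fun=> 1%N) S a i)%N.
  by apply/funext => i; rewrite /shift_on mulnDr muln1 [((i \in S) * _)%N]mulnC.
apply: flag_uniq (fH' _) _; set b := shift_on _ _ _.
have -> : iprod (fun i => iexp (L i) (s i)) b = iprod L (fun i => s i * b i)%N.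
  by apply: eq_bigr => i _; rewrite iexpX.
exact: fH.
Qed.

Lemma mmult_const_ge I (c : R) : (0 < n)%N -> primary I ->
  (forall t d, flag (iexp I t.+1) setT d -> c * t%:R ^+ n <= d%:R) ->
  c * (n`!)%:R <= (mmult (fun=> I))%:R.
Proof.
move=> n0 pI hc; have [H [sH fH [N hN]]] := mixed_multP (fun=> pI).
have dimI t : exists d, flag (iexp I t) setT d.
  by apply: (primary_flag (V := ione)) => //; exact: primary_iexp.
have [h fh] := choice dimI.
have Hh a : H a = h (\sum_i a i)%N.
  by apply: flag_uniq (fH a) _; rewrite iprod_const; exact: fh.
set e := mmult _ in hN *; pose M := (N.+1 * n)%N.
have he t : (M <= t)%N -> fdiff n (fun t => (h t)%:R) t <= e%:R.
  (* A vector with coordinate sum t inside the region where [hN] applies: the first coordinate takes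
     the surplus. *)
  move=> Mt; pose a (i : 'I_n) := if val i == 0%N then (t - n.-1 * N)%N else N.
  have -> : t = (\sum_i a i)%N.
    rewrite (bigD1 (Ordinal n0)) //= /a /= (eq_bigr (fun=> N)).
      rewrite sum_nat_const cardC1 card_ord subnK //.
      by apply: leq_trans Mt; rewrite /M mulnC leq_mul ?leq_pred.
    by move=> i; rewrite -val_eqE /= => /negbTE ->.
  rewrite -mdiff_fdiff (_ : (fun a => _) = (fun b => (H b)%:R)).
    rewrite hN ?big1 ?mul1r // => i; rewrite /a; case: ifP => // _.
    by rewrite leq_subRL; move: Mt; rewrite /M; nia.
  by apply/funext => b; rewrite Hh.
have [k [k0 hk]] := fdiff_bound he.
pose C : R := \sum_(i < n) ratr (k i).
have C0 : 0 <= C by apply: sumr_ge0 => i _; rewrite ler0q.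
have main t : (0 < t)%N -> c * t%:R ^+ n <= e%:R * t%:R ^+ n / (n`!)%:R + C * t%:R ^+ n.-1.
  move=> t0; have M0 : (0 < M)%N by rewrite /M muln_gt0 n0.
  have Mt0 : (0 < M + t)%N by rewrite (leq_trans M0) // leq_addr.
  have := hk t; rewrite -(ler_rat R) rmorphD rmorphM rmorph_sum /= !ratr_nat => hkt.
  apply: (@le_trans _ _ (h (M + t)%N)%:R).
    have [c0|c0] := leP 0 c; last first.
      by apply: le_trans (ler0n _ _); rewrite nmulr_rle0 // exprn_ge0.
    have hcM : c * (M + t).-1%:R ^+ n <= (h (M + t)%N)%:R.
      by apply: hc; rewrite prednK //; exact: fh.
    apply: le_trans hcM; apply: ler_wpM2l => //.
    by rewrite lerXn2r ?nnegrE // ler_nat -ltnS prednK // -add1n leq_add2r.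
  apply: le_trans hkt _; apply: lerD.
    rewrite -mulrA; apply: ler_wpM2l; first exact: ler0n.
    rewrite ler_pdivlMr ?ltr0n ?fact_gt0 // -natrM bin_ffact -natrX ler_nat.
    by rewrite ffact_le_expn.
  rewrite /C mulr_suml; apply: ler_sum => i _; rewrite rmorphM /= ratr_nat.
  apply: ler_wpM2l; first by rewrite ler0q.
  rewrite -natrX ler_nat (@leq_trans (t ^ i)) //; last first.
    by rewrite leq_pexp2l //; have := ltn_ord i; lia.
  apply: leq_trans (ffact_le_expn t i).
  by rewrite -bin_ffact leq_pmulr // fact_gt0.
rewrite leNgt; apply/negP => ec.
(* The supposed gap between the leading coefficients; any t > C / dl contradicts [main]. *)
pose dl := c - e%:R / (n`!)%:R.
have dl0 : 0 < dl.
  by rewrite subr_gt0 ltr_pdivrMr ?ltr0n ?fact_gt0.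
have [t tC] : exists t : nat, C / dl < t%:R.
  by exists (Num.truncn (C / dl)).+1; exact: truncnS_gt.
have t0 : (0 < t)%N by rewrite -(ltr0n R) (le_lt_trans _ tC) // divr_ge0 // ltW.
have := main t t0; rewrite -lerBlDl.
have -> : c * t%:R ^+ n - e%:R * t%:R ^+ n / n`!%:R = dl * t%:R * t%:R ^+ n.-1.
  have -> : t%:R ^+ n = t%:R * t%:R ^+ n.-1 :> R by rewrite -exprS prednK.
  by rewrite /dl; ring.
rewrite ler_pM2r ?exprn_gt0 ?ltr0n //.
by move: tC; rewrite ltr_pdivrMr // mulrC => /lt_geF ->.
Qed.

End MixedMult.

(** * Rees mixed multiplicities *)

Section Rees.
Variables (R : realType) (n : nat).
Local Notation O := (holo_germ R n).
Local Notation ideal := (ideal O).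
Local Notation mI := (maxI R n).
Local Notation primary := (primary mI).
Implicit Types (I M : ideal) (L : 'I_n -> ideal) (s : 'I_n -> nat).

Definition rees L : \bar R := rees_mixed_mult (fun i => iset (L i)).

Lemma iexpE I k : ideal_exp I k = iexp I k.
Proof. by elim: k => // k IH; rewrite iexpS -[iset (imul _ _)]/(ideal_mul _ _) -IH. Qed.

Definition thicken L r i := iadd (L i) (iexp mI r).

Lemma thicken_primary L r i : primary (thicken L r i).
Proof. by exists r; exact: iadd_subr. Qed.

Lemma reesE L : rees L = ereal_sup [set (mmult (thicken L r))%:R%:E | r in [set: nat]].
Proof.
rewrite /rees /rees_mixed_mult; congr ereal_sup; apply: eq_imagel => r _.
by congr (_%:R%:E); congr mixed_mult; apply/funext => i; rewrite -[RHS]/(ideal_add (L i) (iexp mI r)) -iexpE.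
Qed.

Lemma rees_ge L r : ((mmult (thicken L r))%:R%:E <= rees L)%E.
Proof. by rewrite reesE; apply: ereal_sup_ubound; exists r. Qed.

Lemma rees_leP L (x : \bar R) :
  (forall r, ((mmult (thicken L r))%:R%:E <= x)%E) -> (rees L <= x)%E.
Proof. by move=> h; rewrite reesE; apply: ge_ereal_sup => _ [r _ <-]; exact: h. Qed.

Lemma rees_ge0 L : (0 <= rees L)%E.
Proof. by apply: le_trans (rees_ge L 0); rewrite lee_fin. Qed.

Lemma iaddS I I' (J J' : ideal) : I `<=` I' -> J `<=` J' -> iadd I J `<=` iadd I' J'.
Proof.
move=> II JJ; apply: iadd_min; first exact: subset_trans II (@iadd_subl _ _ _).
exact: subset_trans JJ (@iadd_subr _ _ _).
Qed.

Lemma rees_le L L' : (forall i, L i `<=` L' i) -> (rees L' <= rees L)%E.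
Proof.
move=> LL; apply: rees_leP => r; apply: le_trans (rees_ge L r).
rewrite lee_fin ler_nat; apply: mmult_le => i; first exact: thicken_primary.
exact: iaddS.
Qed.

Lemma iexp_iadd_sub I M k : iexp (iadd I M) k `<=` iadd (iexp I k) M.
Proof.
elim: k => [|k IH]; first by move=> x _; exact: iadd_subl.
rewrite iexpS; apply: (subset_trans (imulS _ IH)); first exact: (@subset_refl _ (iadd I M)).
apply: imul_min => _ _ [x Ix [y My <-]] [z Iz [w Mw <-]].
exists (x * z); first exact: mem_imul.
exists (x * w + y * z + y * w); last by ring.
by apply: idealD; [apply: idealD; [|rewrite mulrC]|]; exact: idealM.
Qed.

(** Thickenings of powers and powers of thickenings are cofinal: (L_i + m^r)^(s_i) lies in L_i^(s_i)
    + m^r, and L_i^(s_i) + m^(r S) lies in (L_i + m^r)^(s_i), as S >= s_i. *)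
Lemma rees_iexp L s : (forall i, (0 < s i)%N) ->
  rees (fun i => iexp (L i) (s i)) = ((\prod_i s i)%N%:R%:E * rees L)%E.
Proof.
move=> s0; set p := (\prod_i s i)%N.
have p0 : (0 < p)%N by rewrite prodn_gt0.
apply/eqP; rewrite eq_le; apply/andP; split.
  apply: rees_leP => r.
  apply: (@le_trans _ _ (p%:R%:E * (mmult (thicken L r))%:R%:E)%E); last first.
    by apply: lee_pmul => //; rewrite ?lee_fin //; exact: rees_ge.
  rewrite -EFinM -natrM lee_fin ler_nat -mmult_iexp //; last exact: thicken_primary.
  apply: mmult_le => i; first exact/primary_iexp/thicken_primary.
  exact: iexp_iadd_sub.
rewrite muleC -lee_pdivlMr ?ltr0n //; apply: rees_leP => r.
rewrite lee_pdivlMr ?ltr0n // muleC.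
pose S := (\sum_i s i)%N; apply: le_trans (rees_ge _ (r * S)).
rewrite -EFinM -natrM lee_fin ler_nat -mmult_iexp //; last exact: thicken_primary.
apply: mmult_le => i; first exact: thicken_primary.
apply: iadd_min; first exact/iexpSs/iadd_subl.
apply: (@subset_trans _ (iexp (iexp mI r) (s i))).
  by rewrite -iexpX; apply: iexp_le; rewrite leq_mul // /S (bigD1 i) //= leq_addr.
exact/iexpSs/iadd_subr.
Qed.

(** Serves to exclude the exponent 0 of I in the definition of the order, where I^0 is the unit
    ideal. *)
Lemma rees_one L : (0 < n)%N -> (forall i, L i = ione) -> rees L = 0%E.
Proof.
move=> n0 L1; apply/eqP; rewrite eq_le rees_ge0 andbT; apply: rees_leP => r.
have -> : thicken L r = fun=> ione.
  by apply/funext => i; apply: ideal_eq => // x _; rewrite /thicken L1; exact: iadd_subl.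
have p1 (i : 'I_n) : primary ione by exists 0%N.
have [H [sH fH [N hN]]] := mixed_multP p1.
suff : (mmult (fun _ : 'I_n => @ione O))%:R = 0 :> rat.
  by move=> /eqP; rewrite pnatr_eq0 => /eqP ->.
have := hN (fun=> 1%N) (fun=> N) (fun=> leqnn _); rewrite big1 // mul1r => <-.
have -> : (fun b => (H b)%:R) = (fun=> 0 : rat).
  apply/funext => b; have := fH b; rewrite iprod_const iexp1 => /flag_uniq.
  by move=> /(_ _ (flag_refl (ideal_subsp _ _))) ->.
by rewrite /mdiff big1 // => S _; rewrite mulr0.
Qed.

End Rees.

(** * Newton polyhedra *)

Section Dot.
Variables (R : realType) (n : nat).
Implicit Types (x y z w : 'rV[R]_n) (c : R).

Lemma dotvDl x y z : dotv (x + y) z = dotv x z + dotv y z.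
Proof. by rewrite /dotv -big_split; apply: eq_bigr => i _; rewrite mxE mulrDl. Qed.
Lemma dotvDr x y z : dotv z (x + y) = dotv z x + dotv z y.
Proof. by rewrite /dotv -big_split; apply: eq_bigr => i _; rewrite mxE mulrDr. Qed.
Lemma dotvZl c x z : dotv (c *: x) z = c * dotv x z.
Proof. by rewrite /dotv mulr_sumr; apply: eq_bigr => i _; rewrite mxE mulrA. Qed.
Lemma dotvZr c x z : dotv z (c *: x) = c * dotv z x.
Proof. by rewrite /dotv mulr_sumr; apply: eq_bigr => i _; rewrite mxE mulrCA. Qed.
Lemma dotvC x y : dotv x y = dotv y x.
Proof. by apply: eq_bigr => i _; rewrite mulrC. Qed.
Lemma dotvNl x z : dotv (- x) z = - dotv x z.
Proof. by rewrite -scaleN1r dotvZl mulN1r. Qed.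
Lemma dotv0r x : dotv x 0 = 0.
Proof. by rewrite -(scale0r x) dotvZr mul0r. Qed.
Lemma dotv_ge0 x y : orthant x -> orthant y -> 0 <= dotv x y.
Proof. by move=> x0 y0; apply: sumr_ge0 => i _; rewrite mulr_ge0. Qed.
Lemma dotv_delta x i : dotv x (delta_mx 0 i) = x 0 i.
Proof.
rewrite /dotv (bigD1 i) //= mxE !eqxx mulr1 big1 ?addr0 // => j /negbTE ji.
by rewrite mxE ji andbF mulr0.
Qed.
Lemma dotv_self x : dotv x x = 0 -> x = 0.
Proof.
move=> /eqP; rewrite psumr_eq0 => [/allP x0|i _]; last by rewrite -expr2 sqr_ge0.
by apply/rowP => i; rewrite mxE; have := x0 i (mem_index_enum i); rewrite mulf_eq0 orbb => /eqP.
Qed.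
Lemma dotvE x y : dotv x y = (x *m y^T) 0 0.
Proof. by rewrite mxE; apply: eq_bigr => i _; rewrite mxE. Qed.

Lemma orthantD x y : orthant x -> orthant y -> orthant (x + y).
Proof. by move=> x0 y0 i; rewrite mxE addr_ge0. Qed.
Lemma orthantZ c x : 0 <= c -> orthant x -> orthant (c *: x).
Proof. by move=> c0 x0 i; rewrite mxE mulr_ge0. Qed.
Lemma orthant_row (k : multinom n) : orthant (mnm_row R k).
Proof. by move=> i; rewrite mxE. Qed.

End Dot.

(** * Separation from finitely generated cones *)

Section Farkas.
Variables (R : realType) (n : nat).
Implicit Types (a y w : 'rV[R]_n) (s : seq 'rV[R]_n).

Fixpoint cone s y : Prop :=
  if s is a :: s' then exists2 c, 0 <= c & cone s' (y - c *: a) else y = 0.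

Lemma cone_shear a (k : 'rV[R]_n -> R) s y : (forall b, b \in s -> 0 <= k b) ->
  cone [seq b + k b *: a | b <- s] y -> exists2 c, 0 <= c & cone s (y - c *: a).
Proof.
elim: s y => [|b s IH] y k0 /=.
  by move=> ->; exists 0; rewrite ?scale0r ?subr0.
have kb : 0 <= k b by apply: k0; rewrite mem_head.
move=> [c0 c0_ge0] /IH[|c c_ge0 hc]; first by move=> d ds; apply: k0; rewrite inE ds orbT.
exists (c + c0 * k b); first by rewrite addr_ge0 // mulr_ge0.
exists c0 => //; rewrite (_ : _ - _ = y - c0 *: (b + k b *: a) - c *: a) //.
by rewrite scalerDr scalerA scalerDl !opprD !addrA; apply/rowP => i; rewrite !mxE; ring.
Qed.

(** A functional w that separates y from the cone on s works unless it is negative on a. In that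
    case b + k(b) a is the projection of b along a onto the kernel of w; the projected data are
    separated by some w', which is corrected by a multiple of w so as to vanish on a. *)
Lemma farkas s y : ~ cone s y ->
  exists w, (forall a, a \in s -> 0 <= dotv w a) /\ dotv w y < 0.
Proof.
have [m sm] := ubnP (size s); elim: m s y sm => // m IH [|a s] y /= sm ny.
  exists (- y); split=> //; rewrite dotvNl oppr_lt0 lt_neqAle eq_sym.
  rewrite sumr_ge0 ?andbT => [|i _]; last by rewrite -expr2 sqr_ge0.
  by apply/eqP => /dotv_self /ny.
have [w [ws wy]] : exists w, (forall b, b \in s -> 0 <= dotv w b) /\ dotv w y < 0.
  by apply: IH => // cy; apply: ny; exists 0; rewrite // scale0r subr0.
have [wa|wa] := leP 0 (dotv w a).
  by exists w; split=> // b; rewrite inE => /orP[/eqP->|/ws].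
pose k b := - dotv w b / dotv w a.
have kE b : b \in s -> 0 <= k b.
  by move=> /ws wb; rewrite /k mulNr oppr_ge0 mulr_ge0_le0 // invr_le0 ltW.
have [w' [ws' wy']] : exists w', (forall b, b \in [seq b + k b *: a | b <- s] -> 0 <= dotv w' b)
    /\ dotv w' (y + k y *: a) < 0.
  apply: IH; rewrite ?size_map // => /(cone_shear kE)[c c0 hc]; apply: ny.
  exists (c - k y); last first.
    by rewrite (_ : _ - _ = y + k y *: a - c *: a) // scalerBl opprB addrA addrAC.
  by rewrite subr_ge0 (le_trans _ c0) // /k mulNr oppr_le0 mulr_le0 ?invr_le0 ?ltW.
exists (w' - (dotv w' a / dotv w a) *: w).
have a0 : dotv w a != 0 by rewrite lt_eqF.
have E b : dotv (w' - (dotv w' a / dotv w a) *: w) b = dotv w' (b + k b *: a).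
  by rewrite dotvDl dotvNl dotvZl dotvDr dotvZr /k; field.
split=> [b|]; last by rewrite E.
rewrite E inE => /orP[/eqP->|bs]; last by apply: ws'; apply: (map_f (fun b => b + k b *: a)).
by rewrite /k mulNr divff // scaleN1r subrr dotv0r.
Qed.

End Farkas.

Section Hull.
Variables (R : realType) (n : nat) (A : set (multinom n)).
Implicit Types (x y z w : 'rV[R]_n).

Let G : set 'rV[R]_n := smallest (@convex_set R 'rV[R]_n)
  [set mnm_row R k + x | k in A & x in @orthant R n].

Lemma hull_gen k x : A k -> orthant x -> G (mnm_row R k + x).
Proof. by move=> Ak x0 S [_]; apply; exists k => //; exists x. Qed.

Lemma hull_min (S : set 'rV[R]_n) :
  (forall x y l, S x -> S y -> 0 <= l <= 1 -> S (l *: x + (1 - l) *: y)) ->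
  (forall k x, A k -> orthant x -> S (mnm_row R k + x)) -> G `<=` S.
Proof.
move=> cS gS x; apply; split=> [y z l|_ [k Ak [z z0 <-]]]; last exact: gS.
rewrite !inE => Sy Sz; apply: cS => //.
by apply/andP; split; [exact: ge0|exact: le1].
Qed.

Lemma hull_convex x y l : G x -> G y -> 0 <= l <= 1 -> G (l *: x + (1 - l) *: y).
Proof.
move=> Gx Gy /andP[l0 l1] S [cS gS].
have Sx : S x by apply: Gx.
have Sy : S y by apply: Gy.
have l01 : Itv.spec (Itv.num_sem (R := R)) (Itv.Real `[0%Z, 1%Z]) l.
  by rewrite /= /Itv.num_sem /= in_itv /= num_real l0 l1.
have := cS x y (Itv.mk l01); rewrite !inE => /(_ Sx Sy).
by [].
Qed.

Lemma hull_up x z : G x -> orthant z -> G (x + z).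
Proof.
move=> + z0; apply: (@hull_min [set x | G (x + z)]) => [u v l Gu Gv l01|k u Ak u0] /=.
  rewrite (_ : _ + z = l *: (u + z) + (1 - l) *: (v + z)); first exact: hull_convex.
  by apply/rowP => i; rewrite !mxE; ring.
by rewrite -addrA; apply: hull_gen => //; exact: orthantD.
Qed.

Lemma hull_orthant x : G x -> orthant x.
Proof.
apply: hull_min => [u v l u0 v0 /andP[l0 l1]|k u _ u0].
  by apply: orthantD; apply: orthantZ => //; rewrite subr_ge0.
by apply: orthantD => //; exact: orthant_row.
Qed.

Lemma hull_ge w c x : orthant w -> (forall k, A k -> c <= dotv w (mnm_row R k)) ->
  G x -> c <= dotv w x.
Proof.
move=> w0 wA; apply: (@hull_min [set x | c <= dotv w x]) => [u v l /= cu cv /andP[l0 l1]|k u Ak u0] /=.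
  rewrite dotvDr !dotvZr; nra.
by rewrite dotvDr (le_trans (wA _ Ak)) // lerDl dotv_ge0.
Qed.

Variable ks : seq (multinom n).
Hypothesis ksA : forall k, k \in ks -> A k.
Hypothesis Aks : forall k, A k -> exists2 k', k' \in ks & lem k' k.

Lemma ks_ge w c : orthant w -> (forall k, k \in ks -> c <= dotv w (mnm_row R k)) ->
  forall k, A k -> c <= dotv w (mnm_row R k).
Proof.
move=> w0 wk k /Aks[k' /wk ck' /mnm_lepP kk]; apply: le_trans ck' _.
by apply: ler_sum => i _; rewrite !mxE ler_wpM2l // ler_nat.
Qed.

(** Homogenization: x placed at height t. At height 1 the cone on the (k, 1) and the (e_i, 0) stays
    inside G, which reduces affine separation to Farkas' lemma. *)
Let ext (x : 'rV[R]_n) (t : R) : 'rV[R]_n.+1 :=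
  \row_j (if unlift ord0 j is Some i then x 0 i else t).

Let dotv_ext x t y u : dotv (ext x t) (ext y u) = t * u + dotv x y.
Proof.
rewrite /dotv big_ord_recl !mxE !unlift_none; congr (_ + _).
by apply: eq_bigr => i _; rewrite !mxE !liftK.
Qed.

Let ext_surj (w : 'rV[R]_n.+1) : w = ext (\row_(i < n) w 0 (fintype.lift ord0 i)) (w 0 ord0).
Proof. by apply/rowP => j; rewrite mxE; case: unliftP => [i ->|->//]; rewrite mxE. Qed.

Let ext_inj x t y u : ext x t = ext y u -> x = y /\ t = u.
Proof.
move=> /rowP e; split; last by have := e ord0; rewrite !mxE unlift_none.
by apply/rowP => i; have := e (fintype.lift ord0 i); rewrite !mxE liftK.
Qed.

Let cone_orthant (r : seq 'I_n) x t :
  cone [seq ext (delta_mx 0 i) 0 | i <- r] (ext x t) -> orthant x /\ t = 0.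
Proof.
elim: r x t => [|i r IH] x t /=.
  rewrite (_ : 0 = ext 0 0); first by move=> /ext_inj[-> ->]; split=> // i; rewrite mxE.
  by apply/rowP => j; rewrite !mxE; case: unlift => // i; rewrite mxE.
move=> [c c0]; rewrite (_ : _ - _ = ext (x - c *: delta_mx 0 i) t).
  move=> /IH[x0 ->]; split=> //; rewrite -(subrK (c *: delta_mx 0 i) x).
  by apply: orthantD => //; apply: orthantZ => // j; rewrite mxE ler0n.
by apply/rowP => j; rewrite !mxE; case: unlift => [l|]; rewrite ?mxE ?mulr0 ?subr0.
Qed.

Let cone_hull r x t : (forall k, k \in r -> A k) ->
  cone ([seq ext (mnm_row R k) 1 | k <- r] ++ [seq ext (delta_mx 0 i) 0 | i <- enum 'I_n])
    (ext x t) ->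
  [/\ 0 <= t, t = 0 -> orthant x & 0 < t -> G (t^-1 *: x)].
Proof.
elim: r x t => [|k r IH] x t rA /=.
  by move=> /cone_orthant[x0 ->]; split=> //; rewrite ltxx.
move=> [c c0]; rewrite (_ : _ - _ = ext (x - c *: mnm_row R k) (t - c)); last first.
  by apply/rowP => j; rewrite !mxE; case: unlift => [l|]; rewrite ?mxE ?mulr1.
move=> /IH[|tc0 x0 xG]; first by move=> l lr; apply: rA; rewrite inE lr orbT.
have Ak : A k by apply: rA; rewrite mem_head.
have ct : c <= t by rewrite -subr_ge0.
have t0 : 0 <= t by exact: le_trans ct.
split=> // [te|tp].
  have c00 : c = 0 by apply/eqP; rewrite eq_le c0 -te ct.
  by have := x0; rewrite te c00 subr0 scale0r subr0; apply.
have [tc|tc] := eqVneq (t - c) 0.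
  have /eqP -> : t == c by rewrite -subr_eq0 tc.
  have cp : 0 < c by rewrite -(_ : t = c) //; apply/eqP; rewrite -subr_eq0 tc.
  rewrite -(subrK (c *: mnm_row R k) x) scalerDr scalerA mulVf ?gt_eqF // scale1r addrC.
  apply: hull_gen => //; apply: orthantZ; first by rewrite invr_ge0.
  exact: x0.
have tcp : 0 < t - c by rewrite lt_neqAle eq_sym tc.
have := @hull_convex (mnm_row R k) ((t - c)^-1 *: (x - c *: mnm_row R k)) (c / t).
rewrite (_ : _ *: mnm_row R k + _ = t^-1 *: x); first apply.
- by have := @hull_gen k 0 Ak; rewrite addr0; apply=> i; rewrite mxE.
- exact: xG.
- by rewrite divr_ge0 //= ler_pdivrMr // mul1r.
apply/rowP => i; rewrite !mxE; have := gt_eqF tp; move=> /negbT tn.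
by field; rewrite tn.
Qed.

(** Farkas' lemma applied to (y, 1) gives a functional (w, c) with w >= 0 and c + w.y < 0. Since w.y
    >= 0, c is negative, and division by -c normalizes the level to 1. *)
Lemma hull_separation y : orthant y -> ~ G y -> exists w,
  [/\ orthant w, forall k, k \in ks -> 1 <= dotv w (mnm_row R k) & dotv w y < 1].
Proof.
move=> y0 nGy.
have [w' [ws wy]] : exists w : 'rV[R]_n.+1, (forall a, a \in [seq ext (mnm_row R k) 1 | k <- ks] ++
    [seq ext (delta_mx 0 i) 0 | i <- enum 'I_n] -> 0 <= dotv w a) /\ dotv w (ext y 1) < 0.
  apply: farkas => /cone_hull -/(_ ksA)[_ _ /(_ ltr01)].
  by rewrite invr1 scale1r.
move: ws wy; rewrite (ext_surj w'); set w := (\row_(i < n) _); set c := w' 0 ord0 => ws wy.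
have w0 : orthant w.
  move=> i; rewrite -dotv_delta.
  have := ws (ext (delta_mx 0 i) 0); rewrite dotv_ext mulr0 add0r; apply.
  by rewrite mem_cat orbC; apply/orP; left; apply: map_f; rewrite mem_enum.
have wk k : k \in ks -> 0 <= c + dotv w (mnm_row R k).
  move=> kks; have := ws (ext (mnm_row R k) 1); rewrite dotv_ext mulr1; apply.
  by rewrite mem_cat; apply/orP; left; apply: map_f.
rewrite dotv_ext mulr1 in wy.
have wy0 := dotv_ge0 w0 y0.
have c0 : 0 < - c by lra.
exists ((- c)^-1 *: w); split.
- by apply: orthantZ => //; rewrite invr_ge0 ltW.
- move=> k kks; rewrite dotvZl mulrC ler_pdivlMr // mul1r.
  by have := wk k kks; lra.
- by rewrite dotvZl mulrC ltr_pdivrMr // mul1r; lra.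
Qed.

End Hull.

(** Otherwise one could choose forever elements of A above none of the earlier ones. The exponents
    above none of the first t choices would be a decreasing sequence of down-closed sets that never
    settles. *)
Lemma dickson n (A : set (multinom n)) : exists ks : seq (multinom n),
  (forall k, k \in ks -> A k) /\ forall k, A k -> exists2 k', k' \in ks & lem k' k.
Proof.
apply: contrapT => nks.
have ex (r : seq (multinom n)) : exists k, (forall l, l \in r -> A l) ->
    A k /\ forall k', k' \in r -> ~~ lem k' k.
  have [rA|nrA] := pselect (forall l, l \in r -> A l); last by exists mnm0 => /nrA.
  apply: contrapT => nk; apply: nks; exists r; split=> // k Ak.
  apply: contrapT => nk'; apply: nk; exists k => _; split=> // k' kr.
  by apply/negP => kk; apply: nk'; exists k'.
have [f hf] := choice ex.
pose r t := iter t (fun r => f r :: r) [::].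
have rA t l : l \in r t -> A l.
  elim: t l => // t IH l; rewrite inE => /orP[/eqP ->|/IH//].
  by have [] := hf (r t) IH.
pose D t (mu : seq nat) := ~~ has (fun k : multinom n => [forall i, k i <= nth 0 mu i]%N) (r t).
have Dd t : down_closed n (D t).
  move=> mu i smu im; apply: contra => /hasP[k kr /forallP kmu].
  apply/hasP; exists k => //; apply/forallP => j.
  by rewrite nth_incr_nth (leq_trans (kmu j)) // leq_addl.
have Dle t t' mu : size mu = n -> (t <= t')%N -> D t' mu -> D t mu.
  move=> _ /subnK <-; elim: (t' - t)%N => // k IH; rewrite addSn => Dk; apply: IH.
  by move: Dk; rewrite /D /= negb_or => /andP[].
have [T hT] := down_closed_dcc Dd Dle.
have := hT T.+1 (leqnSn T) [seq f (r T) i | i <- enum 'I_n].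
rewrite size_map size_enum_ord => /(_ erefl).
have nthE (i : 'I_n) : nth 0%N [seq f (r T) i | i <- enum 'I_n] i = f (r T) i.
  by rewrite (nth_map i) ?size_enum_ord // nth_ord_enum.
have [_ nlem] := hf (r T) (rA T).
have -> : D T [seq f (r T) i | i <- enum 'I_n].
  apply/hasPn => k kr; apply: contra (nlem k kr) => /forallP h.
  by apply/mnm_lepP => i; rewrite -nthE.
by rewrite /D /= negb_or => /andP[/negP[]]; apply/forallP => i; rewrite nthE.
Qed.

(** * Vertices of the dual polyhedron *)

Section Vertex.
Variables (R : realType) (n m : nat) (ka : 'I_m -> multinom n).
Implicit Types (w d y : 'rV[R]_n) (j : 'I_m).
Let a j := mnm_row R (ka j).
Hypothesis axis : forall i, exists j, exists2 t : R, 0 < t & a j = t *: delta_mx 0 i.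

Definition dual_poly w := forall j, 1 <= dotv w (a j).

(** Slack constraints become zero rows, so the rank counts the independent tight ones; full rank
    characterizes vertices. *)
Definition active w : 'M[R]_(m, n) :=
  \matrix_j (if dotv w (a j) == 1 then a j else 0).

Lemma row_active w j : row j (active w) = if dotv w (a j) == 1 then a j else 0.
Proof. by rewrite rowK. Qed.

Lemma dual_poly_gt0 w i : dual_poly w -> 0 < w 0 i.
Proof.
move=> Ww; have [j [t t0 aj]] := axis i; have := Ww j.
rewrite aj dotvZr dotv_delta => h; rewrite -(pmulr_rgt0 _ t0).
exact: lt_le_trans h.
Qed.

(** Take a vector d orthogonal to the active rows, with the sign that makes d.y <= 0. If d decreases
    no constraint, the axis points show d >= 0, and then -d will do, because y >= 0. *)
Lemma vertex_direction w y : orthant y -> (\rank (active w) < n)%N ->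
  exists d, [/\ d *m (active w)^T = 0, dotv d y <= 0 & exists j, dotv d (a j) < 0].
Proof.
move=> y0 rk.
have : kermx (active w)^T != 0.
  by rewrite -mxrank_eq0 mxrank_ker mxrank_tr -lt0n subn_gt0.
case/rowV0Pn => d0 /sub_kermxP d0k d0n.
have [d [dk dn dy]] : exists d, [/\ d *m (active w)^T = 0, d != 0 & dotv d y <= 0].
  have [y_le|y_gt] := leP (dotv d0 y) 0; first by exists d0.
  by exists (- d0); rewrite mulNmx d0k oppr0 oppr_eq0 dotvNl oppr_le0 ltW.
have [dj|ndj] := pselect (exists j, dotv d (a j) < 0); first by exists d.
have d_ge0 : orthant d.
  move=> i; have [j [t t0 aj]] := axis i.
  rewrite leNgt; apply/negP => di; apply: ndj; exists j.
  by rewrite aj dotvZr dotv_delta pmulr_rlt0.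
exists (- d); split.
- by rewrite mulNmx dk oppr0.
- by rewrite dotvNl oppr_le0 dotv_ge0.
have [i di] : exists i, 0 < d 0 i.
  apply: contrapT => nd; move/eqP: dn; apply; apply/rowP => i; rewrite mxE.
  apply/eqP; rewrite eq_le d_ge0 andbT leNgt; apply/negP => di.
  by apply: nd; exists i.
have [j [t t0 aj]] := axis i; exists j.
by rewrite aj dotvZr dotvNl dotv_delta pmulr_rlt0 // oppr_lt0.
Qed.

(** Moving along such a direction until the first new constraint becomes tight keeps the old ones
    tight, does not increase the value at y, and raises the rank. *)
Lemma vertex w y : dual_poly w -> orthant y ->
  exists w', [/\ dual_poly w', dotv w' y <= dotv w y & row_full (active w')].
Proof.
move=> Ww y0; have [k] := ubnP (n - \rank (active w)).
elim: k w Ww => // k IH w Ww; rewrite ltnS => rk.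
have [full|nfull] := boolP (row_full (active w)); first by exists w.
have rkn : (\rank (active w) < n)%N by rewrite ltn_neqAle rank_leq_col andbT.
have [d [dk dy [j1 dj1]]] := vertex_direction y0 rkn.
pose F j := (dotv w (a j) - 1) / - dotv d (a j).
have [j0 dj0 jmin] := @Order.TotalTheory.arg_minP _ _ _ j1 (fun j => dotv d (a j) < 0) F dj1.
pose s := F j0.
have s0 : 0 <= s by rewrite divr_ge0 ?subr_ge0 ?oppr_ge0 ?Ww // ltW.
have dact j : dotv w (a j) = 1 -> dotv d (a j) = 0.
  move=> wj; have /rowP/(_ j) := dk; rewrite !mxE => <-.
  by apply: eq_bigr => i _; rewrite !mxE wj eqxx mxE.
have w'E j : dotv (w + s *: d) (a j) = dotv w (a j) + s * dotv d (a j).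
  by rewrite dotvDl dotvZl.
have Ww' : dual_poly (w + s *: d).
  move=> j; rewrite w'E; have := Ww j.
  have [dj wj|dj _] := leP 0 (dotv d (a j)); first by rewrite ler_wpDr // mulr_ge0.
  have := jmin j dj; rewrite -/s /F ler_pdivlMr ?oppr_gt0 //; lra.
have lt_rk : (\rank (active w) < \rank (active (w + s *: d)))%N.
  apply: rank_ltmx; rewrite /ltmx; apply/andP; split.
    apply/row_subP => j; rewrite row_active; case: eqP => [wj|_]; last exact: sub0mx.
    have -> : a j = row j (active (w + s *: d)).
      by rewrite row_active w'E dact // mulr0 addr0 wj eqxx.
    exact: row_sub.
  apply/negP => sub; have /submxP[u uE] : (a j0 <= active w)%MS.
    apply: submx_trans sub; have -> : a j0 = row j0 (active (w + s *: d)).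
      rewrite row_active w'E (_ : _ + _ = 1) ?eqxx //.
      have : dotv d (a j0) != 0 by rewrite lt_eqF.
      by rewrite /s /F => h; field.
    exact: row_sub.
  by move: dj0; rewrite dotvE uE trmx_mul mulmxA dk mul0mx mxE ltxx.
have [|w'' [W'' le'' full'']] := IH (w + s *: d) Ww'.
  by apply: leq_trans rk; apply: ltn_sub2l.
exists w''; split=> //; apply: le_trans le'' _.
by rewrite dotvDl dotvZl gerDl mulr_ge0_le0.
Qed.

Lemma big_gcdn_divn (v : 'I_n -> nat) : (0 < n)%N -> (forall i, (0 < v i)%N) ->
  let g := \big[gcdn/0%N]_i v i in
  (0 < g)%N /\ \big[gcdn/0%N]_i (v i %/ g)%N = 1%N.
Proof.
move=> n0 v0 g; have gv i : (g %| v i)%N by rewrite /g (bigD1 i) //= dvdn_gcdl.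
have g0 : (0 < g)%N by rewrite /g (bigD1 (Ordinal n0)) //= gcdn_gt0 v0.
split=> //; apply/eqP; rewrite -(eqn_pmul2l g0) muln1.
rewrite (big_morph (muln g) (muln_gcdr g) (muln0 g)).
by apply/eqP; apply: eq_bigr => i _; rewrite mulnC divnK.
Qed.

(** A vertex solves B w = (1, ..., 1) for an invertible integral matrix B of active rows, so det(B)
    w is integral by Cramer's rule; dividing by the gcd of the entries makes it primitive. *)
Lemma vertex_normal w : (0 < n)%N -> dual_poly w -> row_full (active w) ->
  exists v : multinom n, exists l : R, [/\ 0 < l, mnm_row R v = l *: w &
    \big[gcdn/0%N]_i v i = 1%N].
Proof.
move=> n0 Ww full; pose f := fullrankfun full; pose B := rowsub f (active w).
have Bu : B \in unitmx by exact: fullrowsub_unit.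
have wf i : dotv w (a (f i)) = 1.
  apply/eqP; apply: contraT => nf.
  have rB : row i B = 0 by rewrite /B row_rowsub row_active (negbTE nf).
  have /(congr1 (fun M : 'rV[R]_n => M 0 i)) : delta_mx 0 i = 0 :> 'rV[R]_n.
    by apply: (row_free_inj (A := B)); rewrite ?row_free_unit // -rowE rB mul0mx.
  by rewrite !mxE !eqxx => /eqP; rewrite oner_eq0.
pose N : 'M[int]_n := \matrix_(i, j) (ka (f i) j)%:Z.
have BN : B = map_mx intr N.
  by apply/matrixP => i j; rewrite !mxE wf eqxx mxE.
pose z := \adj N *m (const_mx 1 : 'cV[int]_n).
have Bw : B *m w^T = const_mx 1.
  apply/matrixP => i j; rewrite !mxE -(wf i) dotvC; apply: eq_bigr => l _.
  by rewrite !mxE wf eqxx !mxE ?ord1.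
have dw : (\det N)%:~R *: w^T = map_mx intr z :> 'cV[R]_n.
  rewrite map_mxM map_mx_adj -BN map_const_mx rmorph1 -Bw mulmxA mul_adj_mx.
  by rewrite BN det_map_mx mul_scalar_mx.
have d0 : (\det N)%:~R != 0 :> R.
  by rewrite -det_map_mx -BN -unitfE -unitmxE.
clearbody z; pose v0 (i : 'I_n) : nat := absz (z i 0).
have dv i : `|(\det N)%:~R| * w 0 i = (v0 i)%:R.
  have /matrixP/(_ i 0) := dw; rewrite !mxE => e.
  rewrite -[w 0 i]ger0_norm ?(ltW (dual_poly_gt0 i Ww)) // -normrM e.
  by rewrite /v0 natr_absz intr_norm.
have v0_gt0 i : (0 < v0 i)%N.
  by rewrite -(ltr0n R) -dv mulr_gt0 ?normr_gt0 // dual_poly_gt0.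
have [g0 g1] := big_gcdn_divn n0 v0_gt0; set g := \big[gcdn/0%N]_i v0 i in g0 g1.
exists (Multinom [tuple (v0 i %/ g)%N | i < n]), (`|(\det N)%:~R| / g%:R); split.
- by rewrite divr_gt0 ?normr_gt0 ?ltr0n.
- apply/rowP => i; rewrite !mxE mnmE mulrAC dv.
  have gv : (g %| v0 i)%N by rewrite /g (bigD1 i) //= dvdn_gcdl.
  by rewrite -{2}(divnK gv) natrM mulfK // pnatr_eq0 -lt0n.
- by rewrite -[RHS]g1; apply: eq_bigr => i _; rewrite mnmE.
Qed.

End Vertex.

(** The differences between one of n + 1 linearly independent active points and the others are
    independent directions of the face. *)
Lemma vertex_affine (R : realType) n m (ka : 'I_m -> multinom n.+1) (w : 'rV[R]_n.+1) :
  row_full (active ka w) -> exists p (B : 'M[R]_(n, n.+1)),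
  [/\ exists j, p = mnm_row R (ka j) /\ dotv w p = 1,
      forall i, exists j, p + row i B = mnm_row R (ka j) /\ dotv w (p + row i B) = 1
    & row_free B].
Proof.
move=> full; pose f := fullrankfun full; pose B := rowsub f (active ka w).
have Bu : B \in unitmx by exact: fullrowsub_unit.
have rB i : row i B = mnm_row R (ka (f i)) /\ dotv w (row i B) = 1.
  have [wf|nf] := eqVneq (dotv w (mnm_row R (ka (f i)))) 1.
    by rewrite /B row_rowsub row_active wf eqxx.
  have rB : row i B = 0 by rewrite /B row_rowsub row_active (negbTE nf).
  have /(congr1 (fun M : 'rV[R]_n.+1 => M 0 i)) : delta_mx 0 i = 0 :> 'rV[R]_n.+1.
    by apply: (row_free_inj (A := B)); rewrite ?row_free_unit // -rowE rB mul0mx.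
  by rewrite !mxE !eqxx => /eqP; rewrite oner_eq0.
pose T : 'M[R]_(n, n.+1) :=
  \matrix_i (delta_mx 0 (fintype.lift ord0 i) - delta_mx 0 ord0).
have TB i : row i (T *m B) = row (fintype.lift ord0 i) B - row ord0 B.
  by rewrite row_mul rowK mulmxBl -!rowE.
exists (row ord0 B), (T *m B); split.
- by exists (f ord0); have [? ?] := rB ord0.
- move=> i; exists (f (fintype.lift ord0 i)); rewrite TB addrC subrK.
  exact: rB.
rewrite /row_free mxrankMfree ?row_free_unit //.
apply/row_freeP; exists (\matrix_(j, k) (j == fintype.lift ord0 k)%:R).
apply/matrixP => i k; rewrite mxE (bigD1 (fintype.lift ord0 k)) //= big1 => [|l lk].
  rewrite !mxE !eqxx !mulr1 addr0 /= (inj_eq (@lift_inj _ _)) [k == i]eq_sym.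
  by rewrite subr0.
by rewrite !mxE (negbTE lk) mulr0.
Qed.

Section Continuity.
Variables (R : realType) (n : nat).

Lemma continuous_dotv (w : 'rV[R]_n) : continuous (dotv w).
Proof.
apply: continuous_big => [|i _]; first exact: (@add_continuous R^o).
by move=> x; apply: (@cvgMl_tmp _ _ (nbhs x)); exact: coord_continuous.
Qed.

Lemma closed_dotv_ge (w : 'rV[R]_n) (c : R) : closed [set x | c <= dotv w x].
Proof.
rewrite (_ : [set x | _] = dotv w @^-1` [set t | c <= t]) //.
by have /continuous_closedP := @continuous_dotv w; apply; exact: closed_ge.
Qed.

Lemma closed_dotv_eq (w : 'rV[R]_n) (c : R) : closed [set x | dotv w x = c].
Proof.
rewrite (_ : [set x | _] = dotv w @^-1` [set t | t = c]) //.
by have /continuous_closedP := @continuous_dotv w; apply; exact: closed_eq.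
Qed.

Lemma closed_orthant : closed (@orthant R n).
Proof.
rewrite (_ : @orthant R n = \bigcap_(i in setT) [set x | 0 <= dotv (delta_mx 0 i) x]).
  by apply: closed_bigI => i _; exact: closed_dotv_ge.
apply/seteqP; split=> x x0 i; first by move=> _; rewrite /= dotvC dotv_delta.
by have := x0 i I; rewrite /= dotvC dotv_delta.
Qed.

End Continuity.

(** * Compact facets and the integrality of the Newton weight *)

Section Normals.
Variables (R : realType) (n' : nat).
Local Notation n := n'.+1.
Variable A : set (multinom n).
Let G : set 'rV[R]_n := smallest (@convex_set R 'rV[R]_n)
  [set mnm_row R k + x | k in A & x in @orthant R n].
Hypothesis convG : convenient G.
Hypothesis nG0 : ~ G 0.
Variable ks : seq (multinom n).
Hypothesis ksA : forall k, k \in ks -> A k.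
Hypothesis Aks : forall k, A k -> exists2 k', k' \in ks & lem k' k.

Implicit Types (x y z w d : 'rV[R]_n) (v k : multinom n).

Let m := size ks.
Let ka (j : 'I_m) := tnth (in_tuple ks) j.
Let a j := mnm_row R (ka j).

Let kaA j : A (ka j). Proof. by apply: ksA; exact: mem_tnth. Qed.

Let ka_surj k : k \in ks -> exists j, k = ka j.
Proof. by move=> kk; have /tnthP[j ->] : k \in in_tuple ks by []; exists j. Qed.

Let aG j : G (a j).
Proof.
rewrite -(addr0 (a j)); apply: hull_gen; first exact: (kaA j).
by move=> i; rewrite mxE.
Qed.

Let A_neq0 k : A k -> k <> mnm0.
Proof.
move=> Ak k0; apply: nG0; have -> : 0 = mnm_row R k + 0 :> 'rV[R]_n.
  by apply/rowP => i; rewrite !mxE k0 mnm0E addr0.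
by apply: hull_gen => // i; rewrite mxE.
Qed.

(** If A had no exponent on the i-th axis, the sum of the other coordinates would be at least 1 on A
    and hence on G, yet it vanishes on that axis. A minimal exponent below one on the axis is again
    on the axis. *)
Let axis i : exists j, exists2 t : R, 0 < t & a j = t *: delta_mx 0 i.
Proof.
have [k Ak ki] : exists2 k, A k & forall l, l != i -> k l = 0%N.
  apply: contrapT => nk; have [t t0 Gt] := convG i.
  pose w : 'rV[R]_n := \row_l (l != i)%:R.
  have w0 : orthant w by move=> l; rewrite mxE.
  have : 1 <= dotv w (t *: delta_mx 0 i).
    apply: (hull_ge w0 _ Gt) => k Ak.
    have [l li kl] : exists2 l, l != i & (0 < k l)%N.
      apply: contrapT => nl; apply: nk; exists k => // l li.
      by apply/eqP; rewrite -leqn0 leqNgt; apply/negP => kl; apply: nl; exists l.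
    rewrite /dotv (bigD1 l) //= !mxE li mul1r -[leLHS]addr0 lerD ?ler1n //.
    by apply: sumr_ge0 => l' _; rewrite !mxE mulr_ge0.
  by rewrite dotvZr dotv_delta mxE eqxx mulr0 ler10.
have [k' k'ks /mnm_lepP k'k] := Aks Ak.
have [j k'E] := ka_surj k'ks; exists j; exists (ka j i)%:R.
  rewrite ltr0n lt0n; apply/eqP => ki0; apply: (A_neq0 (kaA j)).
  apply/mnmP => l; rewrite mnm0E; have [->//|li] := eqVneq l i.
  by apply/eqP; rewrite -leqn0 -(ki l li) -k'E.
apply/rowP => l; rewrite !mxE eqxx /=; have [->|li] := eqVneq l i; first by rewrite mulr1.
by rewrite mulr0; have := k'k l; rewrite ki // leqn0 k'E => /eqP ->.
Qed.

Let j0 : 'I_m. Proof. by have [j _] := cid (axis ord0). Qed.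

Let a_ge w c : orthant w -> (forall j, c <= dotv w (a j)) -> forall x, G x -> c <= dotv w x.
Proof.
move=> w0 wa x; apply: hull_ge => //; apply: (ks_ge Aks) => // k /ka_surj[j ->].
exact: wa.
Qed.

Let ell_eq w c : orthant w -> (forall j, c <= dotv w (a j)) ->
  (exists j, dotv w (a j) = c) -> newton_ell w G = c.
Proof.
move=> w0 wc [j wj]; have lb : lbound [set dotv w y | y in G] c.
  by move=> _ [y Gy <-]; exact: a_ge.
apply/eqP; rewrite eq_le; apply/andP; split; last first.
  by apply: lb_le_inf => //; exists (dotv w (a j)); exists (a j) => //; exact: aG.
rewrite -wj; apply: ge_inf; first by exists c.
by exists (a j) => //; exact: aG.
Qed.

Let G_closed : closed G.
Proof.
have -> : G = @orthant R n `&` \bigcap_(w in [set w | orthant w /\ dual_poly ka w]) [set x | 1 <= dotv w x].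
  apply/seteqP; split=> [x Gx|x [x0 Wx]].
    split; first exact: hull_orthant Gx.
    by move=> w [w0 Ww] /=; exact: a_ge.
  apply: contrapT => /(hull_separation ksA x0)[w [w0 wk]].
  rewrite ltNge => /negP; apply; apply: Wx; split=> // j.
  by apply: wk; exact: mem_tnth.
apply: closedI; first exact: closed_orthant.
by apply: closed_bigI => w _; exact: closed_dotv_ge.
Qed.

(* A vertex of the dual polyhedron minimizing y gives a compact facet whose
   supporting inequality y violates. *)
Lemma normal_of_point y : orthant y -> ~ G y -> exists2 v, newton_normals G v &
  dotv (mnm_row R v) y < newton_ell (mnm_row R v) G.
Proof.
move=> y0 nGy; have [w0 [w0_ge0 w0k w0y]] := hull_separation ksA y0 nGy.
have [w [Ww wy full]] := vertex axis (fun j => w0k _ (mem_tnth j (in_tuple ks))) y0.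
have [v [l [l0 vE gv]]] := vertex_normal axis (ltn0Sn n') Ww full.
have w_gt0 i : 0 < w 0 i by exact: (dual_poly_gt0 axis).
have w_ge0 : orthant w by move=> i; exact: ltW.
have [p [B [[j [pE pw]] BE Bfree]]] := vertex_affine full.
have ell_v : newton_ell (mnm_row R v) G = l.
  apply: ell_eq; first exact: orthant_row.
    by move=> j1; rewrite vE dotvZl ler_pMr // Ww.
  by exists j; rewrite vE dotvZl (_ : a j = p) ?pw ?mulr1.
have faceE x : newton_face (mnm_row R v) G x <-> G x /\ dotv w x = 1.
  rewrite /newton_face /= ell_v vE dotvZl; split=> -[Gx wx]; split=> //.
    by apply: (mulfI (lt0r_neq0 l0)); rewrite mulr1.
  by rewrite wx mulr1.
exists v; last by rewrite ell_v vE dotvZl gtr_pMr //; exact: le_lt_trans w0y.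
split=> //.
  have fc : closed (newton_face (mnm_row R v) G).
    rewrite (_ : newton_face _ _ = G `&` [set x | dotv w x = 1]).
      by apply: closedI => //; exact: closed_dotv_eq.
    by apply/seteqP; split=> x /faceE.
  (* On the face w.x = 1 with w > 0 and x >= 0, so x_i <= 1 / w_i. *)
  pose box i : set R := `[0, (w 0 i)^-1]%classic.
  have bc : compact [set x : 'rV[R]_n | forall i, box i (x ord0 i)].
    by apply: rV_compact => i; exact: segment_compact.
  apply: subclosed_compact fc bc _ => x /faceE[Gx wx] i.
  have x0 := hull_orthant Gx.
  rewrite /box /= in_itv /= x0 /= -div1r ler_pdivlMr // -wx /dotv (bigD1 i) //= mulrC.
  by rewrite lerDl; apply: sumr_ge0 => l' _; rewrite mulr_ge0 // ltW.
split.
  exists p, B; split=> //.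
    by apply/faceE; rewrite pE; split; [exact: aG|rewrite -pE].
  by move=> i; have [j' [e1 e2]] := BE i; apply/faceE; split=> //; rewrite e1; exact: aG.
(* A full set of independent directions within the face would consist of vectors orthogonal to w,
   forcing w = 0. *)
move=> [q [C [/faceE[_ wq] Cq Cfree]]].
have : w = 0.
  have Cw : C *m w^T = 0.
    apply/matrixP => i i0; rewrite ord1 mxE [RHS]mxE.
    have /faceE[_] := Cq i; rewrite dotvDr wq => /eqP; rewrite addrC -subr_eq0 addrK => /eqP.
    by move=> h; apply: etrans h; apply: eq_bigr => l' _; rewrite !mxE mulrC.
  have Cu : (C : 'M[R]_n) \in unitmx by rewrite -row_free_unit.
  by apply: trmx_inj; rewrite trmx0 -[w^T]mul1mx -(mulVmx Cu) -mulmxA Cw mulmx0.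
by move=> /rowP /(_ ord0); rewrite mxE => w00; have := w_gt0 ord0; rewrite w00 ltxx.
Qed.

Lemma normals_neq0 : exists v, newton_normals G v.
Proof.
by have [|v nv _] := @normal_of_point 0 _ nG0; [move=> i; rewrite mxE|exists v].
Qed.

Section OneNormal.
Variable v : multinom n.
Hypothesis nv : newton_normals G v.

Let face_point : exists p (B : 'M[R]_(n', n)), [/\ newton_face (mnm_row R v) G p,
  forall i, newton_face (mnm_row R v) G (p + row i B) & row_free B].
Proof. by have [_ _ [[p [B ?]] _]] := nv; exists p, B. Qed.

(** If v_i = 0, the face contains a ray in direction e_i and cannot be compact. *)
Lemma normal_gt0 i : (0 < v i)%N.
Proof.
rewrite lt0n; apply/eqP => vi0; have [p [B [pf _ _]]] := face_point.
have [_ /compact_bounded[M [_ bM]] _] := nv.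
have pt (t : R) : 0 <= t -> newton_face (mnm_row R v) G (p + t *: delta_mx 0 i).
  move=> t0; split.
    apply: hull_up; first exact: pf.1.
    by apply: orthantZ => // l; rewrite mxE.
  by rewrite dotvDr dotvZr dotv_delta mxE vi0 mulr0 addr0; exact: pf.2.
have p0 := hull_orthant pf.1.
pose t := `|M| + 1.
have t0 : 0 <= t by rewrite addr_ge0.
have := bM t; rewrite (le_lt_trans (ler_norm M)) ?ltrDl // => /(_ isT _ (pt (t + 1) _)).
rewrite addr_ge0 // => /(_ isT) bd.
have coordle (x : 'rV[R]_n) : x 0 i <= `|x|.
  rewrite (le_trans (ler_norm _)) // [leRHS]/Num.norm /= mx_normrE.
  by apply/bigmax_geP; right => /=; exists (ord0, i).
have := le_trans (coordle _) bd; rewrite !mxE !eqxx mulr1.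
have := p0 i; lra.
Qed.

Definition ndot (k : multinom n) := (\sum_i v i * k i)%N.

Lemma dotv_ndot k : dotv (mnm_row R v) (mnm_row R k) = (ndot k)%:R.
Proof. by rewrite natr_sum; apply: eq_bigr => i _; rewrite !mxE natrM. Qed.

Lemma normal_ell : exists l : nat, [/\ (0 < l)%N, newton_ell (mnm_row R v) G = l%:R,
  forall j, (l <= ndot (ka j))%N & exists j, ndot (ka j) = l].
Proof.
have [j _ jmin] := @arg_minnP _ j0 xpredT (fun j => ndot (ka j)) isT.
exists (ndot (ka j)); split; last by exists j.
- rewrite lt0n; apply/eqP => nd0; apply: (A_neq0 (kaA j)); apply/mnmP => i.
  move/eqP: nd0; rewrite sum_nat_eq0 => /forallP /(_ i) /=; rewrite muln_eq0 mnm0E.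
  by rewrite eqn0Ngt normal_gt0 /= => /eqP.
- apply: ell_eq; first exact: orthant_row.
    by move=> j'; rewrite dotv_ndot ler_nat jmin.
  by exists j; rewrite dotv_ndot.
- by move=> j'; exact: jmin.
Qed.

(** On G one has |d.x| <= C (v.x - l). At an inactive exponent this holds because the integer v.k -
    l is at least 1, in the directions of the orthant because v_i >= 1, and convex combinations
    preserve it. On the face the right-hand side is 0. *)
Lemma dotv_active_bound d l : newton_ell (mnm_row R v) G = l%:R ->
  (forall j, (l <= ndot (ka j))%N) -> (forall j, ndot (ka j) = l -> dotv d (a j) = 0) ->
  forall x, newton_face (mnm_row R v) G x -> dotv d x = 0.
Proof.
move=> lE lmin dact.
pose C := \sum_j `|dotv d (a j)| + \sum_i `|d 0 i|.
have C0 : 0 <= C by rewrite addr_ge0 // sumr_ge0.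
suff bd : G `<=` [set x | `|dotv d x| <= C * (dotv (mnm_row R v) x - l%:R)].
  move=> x [/bd /= + vx]; rewrite vx lE subrr mulr0 normr_le0 => /eqP //.
apply: hull_min => [x y t /= bx by' /andP[t0 t1]|k z Ak z0 /=].
  rewrite !dotvDr !dotvZr (le_trans (ler_normD _ _)) // !normrM (ger0_norm t0).
  rewrite (@ger0_norm _ (1 - t)) ?subr_ge0 //.
  have := ler_wpM2l t0 bx; have : 0 <= 1 - t by rewrite subr_ge0.
  move=> t1' h1; have h2 := ler_wpM2l t1' by'.
  by apply: le_trans (lerD h1 h2) _; rewrite le_eqVlt; apply/orP; left; apply/eqP; ring.
have [k' k'ks /mnm_lepP kk] := Aks Ak; have [j k'E] := ka_surj k'ks.
pose z' := z + (mnm_row R k - a j).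
have z'0 : orthant z'.
  by apply: orthantD => // i; rewrite !mxE subr_ge0 ler_nat -k'E.
have -> : mnm_row R k + z = a j + z' by rewrite /z'; apply/rowP => i; rewrite !mxE; ring.
clearbody z'; rewrite !dotvDr (le_trans (ler_normD _ _)) //.
have h1 : `|dotv d (a j)| <= C * (dotv (mnm_row R v) (a j) - l%:R).
  have [jl|jl] := eqVneq (ndot (ka j)) l.
    by rewrite dact // normr0 dotv_ndot jl subrr mulr0.
  have cj : `|dotv d (a j)| <= C.
    by rewrite /C (bigD1 j) //= -addrA lerDl addr_ge0 ?sumr_ge0.
  apply: (le_trans cj); rewrite ler_peMr // dotv_ndot -natrB ?lmin // ler1n subn_gt0.
  by rewrite ltn_neqAle eq_sym jl lmin.
have h2 : `|dotv d z'| <= C * dotv (mnm_row R v) z'.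
  rewrite /dotv (le_trans (ler_norm_sum _ _ _)) // mulr_sumr; apply: ler_sum => i _.
  rewrite normrM (ger0_norm (z'0 i)) mulrA; apply: ler_wpM2r => //.
  have ci : `|d 0 i| <= C.
    by rewrite /C (bigD1 i) //= addrCA lerDl addr_ge0 ?sumr_ge0.
  by apply: (le_trans ci); rewrite mxE ler_peMr // ler1n normal_gt0.
by apply: le_trans (lerD h1 h2) _; rewrite le_eqVlt; apply/orP; left; apply/eqP; ring.
Qed.

(** The face has dimension n - 1 and lies at the positive level l, so its points span the whole
    space. *)
Lemma face_orthogonal d : (forall x, newton_face (mnm_row R v) G x -> dotv d x = 0) -> d = 0.
Proof.
move=> dF; have [p [B [pf Bf Bfree]]] := face_point.
have [l [l0 lE _ _]] := normal_ell.
have dB i : dotv d (row i B) = 0.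
  by have := dF _ (Bf i); rewrite dotvDr (dF _ pf) add0r.
have vB i : dotv (mnm_row R v) (row i B) = 0.
  have := (Bf i).2; rewrite dotvDr pf.2 => /eqP.
  by rewrite addrC -subr_eq0 addrK => /eqP.
have mulB0 (e u : 'rV[R]_n) : (forall i, dotv e (row i B) = 0) -> (u <= B)%MS -> dotv e u = 0.
  move=> eB /submxP[c ->]; rewrite dotvE trmx_mul mulmxA.
  rewrite (_ : e *m B^T = 0) ?mul0mx ?mxE //; apply/rowP => i; rewrite !mxE -[RHS](eB i).
  by apply: eq_bigr => i' _; rewrite !mxE.
have npB : ~~ (p <= B)%MS.
  apply/negP => /(mulB0 _ _ vB); rewrite pf.2 lE => /eqP.
  by rewrite pnatr_eq0 gtn_eqF.
have full : row_full (B + p)%MS.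
  rewrite /row_full eqn_leq rank_leq_col /=.
  have /rank_ltmx : (B < B + p)%MS.
    rewrite /ltmx addsmxSl /=; apply: contra npB => h.
    by apply: submx_trans h; exact: addsmxSr.
  by rewrite (eqP Bfree).
apply: dotv_self; have /sub_addsmxP[[c1 c2] {2}->] : (d <= B + p)%MS by exact: submx_full.
rewrite dotvDr (mulB0 d _ dB) ?submxMl // add0r.
by rewrite [c2]mx11_scalar mul_scalar_mx dotvZr dF ?mulr0.
Qed.

End OneNormal.

Let normal_act v (l : nat) := [set j : 'I_m | ndot v (ka j) == l]%SET.

(** The vector l' v - l v' vanishes at the common active exponents, hence on the face of v, hence is
    0; as v and v' are primitive, comparing gcds gives l = l'. So the level depends only on the
    active set, and only finitely many levels occur. *)
Lemma ell_active v v' (l l' : nat) : newton_normals G v -> newton_normals G v' ->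
  newton_ell (mnm_row R v) G = l%:R -> newton_ell (mnm_row R v') G = l'%:R ->
  normal_act v l = normal_act v' l' -> l = l'.
Proof.
move=> nv nv' lE lE' act.
have [l0 [_ l0E lmin _]] := normal_ell nv.
have ll0 : l0 = l by apply/eqP; rewrite -(eqr_nat R) -l0E lE.
rewrite ll0 in lmin.
pose d := l'%:R *: mnm_row R v - l%:R *: mnm_row R v'.
have d0 : d = 0.
  apply: (face_orthogonal nv); apply: (dotv_active_bound nv lE lmin) => j jl.
  have : j \in normal_act v' l' by rewrite -act inE jl.
  rewrite inE => /eqP jl'.
  by rewrite /d dotvDl dotvNl !dotvZl !dotv_ndot jl jl' mulrC subrr.
have vv i : (l' * v i = l * v' i)%N.
  apply/eqP; rewrite -(eqr_nat R) !natrM.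
  by have /rowP/(_ i) := d0; rewrite !mxE => /eqP; rewrite subr_eq0.
have gcdM (x : nat) (u : multinom n) :
    \big[gcdn/0%N]_i (x * u i)%N = (x * \big[gcdn/0%N]_i u i)%N.
  by rewrite (big_morph (muln x) (muln_gcdr x) (muln0 x)).
have [gv _ _] := nv; have [gv' _ _] := nv'.
have := gcdM l' v; rewrite gv muln1 => <-.
by rewrite (eq_bigr _ (fun i _ => vv i)) gcdM gv' muln1.
Qed.

Let common_multiple (M : nat) := (0 < M)%N /\ forall v, newton_normals G v ->
  exists c : nat, M%:R = c%:R * newton_ell (mnm_row R v) G.

(** The product of one level per set of active exponents, with the default 1 for sets that belong to
    no facet. *)
Let common_multiple_ex : exists M, common_multiple M.
Proof.
pose P (S : {set 'I_m}) := [set l : nat | (0 < l)%N /\ exists v,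
  [/\ newton_normals G v, newton_ell (mnm_row R v) G = l%:R & S = normal_act v l]].
pose Ls S := xget 1%N (P S).
have Ls0 S : (0 < Ls S)%N by rewrite /Ls; case: xgetP => // l _ [].
exists (\prod_S Ls S)%N; split; first by rewrite prodn_gt0.
move=> v nv; have [l [l0 lE _ _]] := normal_ell nv.
have [_ [v' [nv' lE' act]]] : P (normal_act v l) (Ls (normal_act v l)).
  by apply: xgetPex; exists l; split=> //; exists v.
have lL := ell_active nv nv' lE lE' act.
exists (\prod_(S | S != normal_act v l) Ls S)%N.
by rewrite lE {2}lL -natrM (bigD1 (normal_act v l)) //= mulnC.
Qed.

Lemma newton_lcmP : common_multiple (newton_lcm G).
Proof.
rewrite /newton_lcm -/(common_multiple _).
set P := [set M | _]; suff [] : P (xget 0%N P) by [].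
apply: xgetPex; have [M0 cM0] := common_multiple_ex.
have ex : exists M, `[< common_multiple M >] by exists M0; apply/asboolP.
case: (ex_minnP ex) => M /asboolP cM Mmin; exists M; split=> // M' cM'.
by apply: Mmin; apply/asboolP.
Qed.

(** The infimum runs over the natural numbers (M / l) v.k, so it is attained. A minimum of linear
    forms is superadditive, v_i >= 1 gives |k| <= phi(k), and a point k/t outside G would violate a
    facet inequality by [normal_of_point]. *)
Lemma newton_phiP : exists phi : multinom n -> nat,
  [/\ forall k, newton_phi G (mnm_row R k) = (phi k)%:R,
      forall k l, (phi k + phi l <= phi (mnm_add k l))%N,
      forall k, (mdeg k <= phi k)%N &
      forall k t, (0 < t)%N -> (newton_lcm G * t <= phi k)%N ->
        G (t%:R^-1 *: mnm_row R k)].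
Proof.
have [M0 cM] := newton_lcmP; set M := newton_lcm G in M0 cM *.
pose P (k : multinom n) (x : nat) := exists v (c l : nat), [/\ newton_normals G v,
  newton_ell (mnm_row R v) G = l%:R, M = (c * l)%N, (0 < c)%N & x = (c * ndot v k)%N].
have Pv v : newton_normals G v -> exists c l : nat,
    [/\ newton_ell (mnm_row R v) G = l%:R, M = (c * l)%N, (0 < c)%N & (0 < l)%N].
  move=> nv; have [l [l0 lE _ _]] := normal_ell nv; have [c] := cM v nv.
  rewrite lE -natrM => /eqP; rewrite eqr_nat => /eqP Mc; exists c, l; split=> //.
  by rewrite lt0n; apply/eqP => c0; move: M0; rewrite Mc c0.
have exP k : exists x : nat, `[< P k x >].
  have [v nv] := normals_neq0; have [c [l [lE Mc c0 l0]]] := Pv v nv.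
  by exists (c * ndot v k)%N; apply/asboolP; exists v, c, l.
pose phi k := ex_minn (exP k).
have phiP k : P k (phi k) by rewrite /phi; case: ex_minnP => x /asboolP.
have phi_min k (x : nat) : P k x -> (phi k <= x)%N.
  by move=> Px; rewrite /phi; case: ex_minnP => y _; apply; apply/asboolP.
have phiE k : newton_phi G (mnm_row R k) = (phi k)%:R.
  rewrite /newton_phi -/M; set S := [set _ | _ in _].
  have valE v c l : newton_ell (mnm_row R v) G = l%:R -> M = (c * l)%N -> (0 < l)%N ->
      M%:R / newton_ell (mnm_row R v) G * dotv (mnm_row R k) (mnm_row R v) =
      (c * ndot v k)%:R.
    move=> lE Mc l0; rewrite lE Mc natrM mulfK ?pnatr_eq0 -?lt0n //.
    by rewrite dotvC dotv_ndot natrM.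
  have lb : lbound S (phi k)%:R.
    move=> _ [v nv <-]; have [c [l [lE Mc c0 l0]]] := Pv v nv.
    by rewrite (valE v c l) // ler_nat; apply: phi_min; exists v, c, l.
  have Sphi : S (phi k)%:R.
    have [v [c [l [nv lE Mc c0 ->]]]] := phiP k; exists v => //.
    by apply: (valE v c l lE Mc); rewrite lt0n; apply/eqP => l0; move: M0; rewrite Mc l0 muln0.
  apply/eqP; rewrite eq_le; apply/andP; split.
    by apply: ge_inf => //; exists (phi k)%:R.
  by apply: lb_le_inf => //; exists (phi k)%:R.
exists phi; split=> [//|k k'|k|k t t0 Mt].
- have [v [c [l [nv lE Mc c0 ->]]]] := phiP (mnm_add k k').
  have -> : ndot v (mnm_add k k') = (ndot v k + ndot v k')%N.
    by rewrite /ndot -big_split; apply: eq_bigr => i _; rewrite mnmDE mulnDr.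
  by rewrite mulnDr leq_add //; apply: phi_min; exists v, c, l.
- have [v [c [l [nv lE Mc c0 ->]]]] := phiP k.
  rewrite mdegE (leq_trans _ (leq_pmull _ c0)) //; apply: leq_sum => i _.
  by rewrite leq_pmull // normal_gt0.
apply: contrapT => /normal_of_point[].
  by apply: orthantZ; [rewrite invr_ge0|exact: orthant_row].
move=> v nv; have [c [l [lE Mc c0 l0]]] := Pv v nv.
rewrite dotvZr lE mulrC ltr_pdivrMr ?ltr0n // dotv_ndot -natrM ltr_nat => vk.
have : (phi k <= c * ndot v k)%N by apply: phi_min; exists v, c, l.
rewrite leqNgt => /negP; apply; apply: leq_trans Mt.
by rewrite Mc -mulnA ltn_pmul2l.
Qed.

End Normals.

(** * Volumes and colengths *)

(* No measurability is assumed: the integral of a nonnegative function is a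
   supremum over simple functions below it. *)
Lemma ge0_integral_mono d (T : measurableType d) (R : realType)
    (mu : {measure set T -> \bar R}) (f g : T -> \bar R) :
  (forall x, (0 <= f x)%E) -> (forall x, (f x <= g x)%E) ->
  (\int[mu]_x f x <= \int[mu]_x g x)%E.
Proof.
move=> f0 fg; have g0 x : (0 <= g x)%E by exact: le_trans (fg x).
rewrite !ge0_integralTE //; apply: le_ereal_sup => _ [h hf <-].
by exists h => // x; exact: le_trans (fg x).
Qed.

Section Volume.
Variable R : realType.

Lemma volume_ge0 n (S : set 'rV[R]_n) : (0 <= volume S)%E.
Proof.
elim: n S => [|n IH] S /=; first by rewrite lee_fin.
by apply: integral_ge0 => t _; exact: IH.
Qed.

Lemma volume_le n (S S' : set 'rV[R]_n) : S `<=` S' -> (volume S <= volume S')%E.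
Proof.
elim: n S S' => [|n IH] S S' SS' /=.
  by rewrite lee_fin !indicE ler_nat; case: (boolP (0 \in S)) => // /set_mem /SS' /mem_set ->.
apply: ge0_integral_mono => t; first exact: volume_ge0.
by apply: IH => y; exact: SS'.
Qed.

Lemma volume0 n : volume (set0 : set 'rV[R]_n) = 0%E.
Proof.
elim: n => [|n IH] /=; first by rewrite indicE in_set0.
by apply: integral0_eq => t _; exact: IH.
Qed.

Lemma row_cons0 n (t : R) (y : 'rV[R]_n) : row_mx (t%:M : 'rV_1) y 0 ord0 = t.
Proof.
have -> : ord0 = lshift n (ord0 : 'I_1) :> 'I_(1 + n) by exact: val_inj.
by rewrite row_mxEl mxE eqxx mulr1n.
Qed.

Lemma row_consS n (t : R) (y : 'rV[R]_n) i :
  row_mx (t%:M : 'rV_1) y 0 (fintype.lift ord0 i) = y 0 i.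
Proof.
have -> : fintype.lift ord0 i = rshift 1 i by exact: val_inj.
by rewrite row_mxEr.
Qed.

Lemma integral_step (a b c : R) : a <= b -> 0 <= c ->
  (\int[lebesgue_measure]_t (c * \1_(`[a, b[%classic) t)%:E = (c * (b - a))%:E)%E.
Proof.
move=> ab c0.
under eq_integral do rewrite EFinM.
rewrite ge0_integralZl_EFin //; last by apply/measurable_EFinP; exact: measurable_indic.
rewrite integral_indic // setIT /= lebesgue_measure_itv /= lte_fin EFinM.
case: ltP => // ba; have -> : b = a by apply/eqP; rewrite eq_le ab ba.
by rewrite subrr.
Qed.

(** Indices missing from mu count as 0, so [[::]] gives the cube at the origin; lists make it easy
    to split off the first coordinate. *)
Definition grid_cell n (tau : R) (mu : seq nat) : set 'rV[R]_n :=
  [set x | forall i : 'I_n, (nth 0%N mu i)%:R / tau <= x 0 i < (nth 0%N mu i).+1%:R / tau].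

Lemma volume_cell n (tau : R) mu : 0 < tau ->
  volume (grid_cell (n := n) tau mu) = (tau^-1 ^+ n)%:E.
Proof.
move=> tau0; elim: n mu => [|n IH] mu /=.
  by rewrite expr0 indicE mem_set // => -[].
set c := nth 0%N mu 0.
have step t : volume [set y : 'rV[R]_n | grid_cell tau mu (row_mx (t%:M : 'rV_1) y)] =
    (tau^-1 ^+ n * \1_(`[c%:R / tau, c.+1%:R / tau[%classic) t)%:E.
  rewrite indicE; case: (boolP (t \in _)) => [|/negP nt].
    rewrite inE /= in_itv /= mulr1 => tc.
    rewrite -(IH (behead mu)); congr volume; apply/seteqP; split=> y hy i.
      by have := hy (fintype.lift ord0 i); rewrite row_consS /= nth_behead.
    have [i' ->|->] := unliftP ord0 i; last by rewrite row_cons0.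
    by rewrite row_consS /= -nth_behead; exact: hy.
  rewrite mulr0 -[RHS](volume0 n).
  congr volume; apply/seteqP; split=> // y hy; apply: nt.
  by rewrite inE /= in_itv /=; have := hy ord0; rewrite row_cons0.
under eq_integral do rewrite step.
rewrite integral_step ?exprn_ge0 ?invr_ge0 ?(ltW tau0) //; last first.
  by rewrite ler_pM2r ?invr_gt0 // ler_nat.
by rewrite -mulrBl -natrB // subSnn mul1r exprSr.
Qed.

(** By slicing: when the first coordinate lies in the j-th interval, only cells with first index j
    meet the slice, and [f j] is the resulting bound as a step function. *)
Lemma volume_grid_le n (tau : R) (X : seq (seq nat)) : 0 < tau ->
  (volume [set x : 'rV[R]_n | exists2 mu, mu \in X & grid_cell tau mu x]
     <= ((size X)%:R * tau^-1 ^+ n)%:E)%E.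
Proof.
move=> tau0; elim: n X => [|n IH] X /=.
  rewrite lee_fin expr0 mulr1 indicE.
  case: (boolP (0 \in _)) => [|_]; last exact: ler0n.
  rewrite inE /= => -[mu muX _]; rewrite ler_nat.
  by case: X muX.
pose Xj j := [seq behead mu | mu <- X & head 0%N mu == j].
pose N := (\max_(mu <- X) head 0%N mu).+1.
pose f (j : nat) (t : R) : \bar R :=
  (((size (Xj j))%:R * tau^-1 ^+ n) * \1_(`[j%:R / tau, j.+1%:R / tau[%classic) t)%:E.
have c0 j : 0 <= (size (Xj j))%:R * tau^-1 ^+ n.
  by rewrite mulr_ge0 // exprn_ge0 // invr_ge0 ltW.
have f0 j t : (0 <= f j t)%E by rewrite lee_fin mulr_ge0.
apply: (@le_trans _ _ (\int[lebesgue_measure]_t (\sum_(0 <= j < N) f j t))%E).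
  apply: ge0_integral_mono => t; first exact: volume_ge0.
  set S := [set y | _].
  have [[y [mu muX ymu]]|nS] := pselect (exists y, S y); last first.
    have -> : S = set0 by apply/seteqP; split=> // y Sy; apply: nS; exists y.
    apply: (@le_trans _ _ 0%E); last by apply: sume_ge0.
    have := IH [::]; rewrite mul0r; apply: le_trans; exact: volume_le.
  pose j := head 0%N mu.
  have jN : (j < N)%N by rewrite /N ltnS (big_rem mu) //= leq_maxl.
  have jt : j%:R / tau <= t < j.+1%:R / tau.
    by have := ymu ord0; rewrite row_cons0 nth0.
  apply: (@le_trans _ _ (f j t)); last first.
    rewrite (bigD1_seq j) ?mem_index_iota ?iota_uniq //= leeDl //.
    by apply: sume_ge0.
  rewrite /f indicE mem_set ?mulr1; last by rewrite /= in_itv.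
  apply: le_trans (IH (Xj j)); apply: volume_le => z [nu nuX znu].
  have njt : (head 0%N nu)%:R / tau <= t < (head 0%N nu).+1%:R / tau.
    by have := znu ord0; rewrite row_cons0 nth0.
  have nuj : head 0%N nu = j.
    have le_aux a b : a%:R / tau <= t -> t < b.+1%:R / tau -> (a <= b)%N.
      by move=> /le_lt_trans h /h; rewrite ltr_pM2r ?invr_gt0 // ltr_nat ltnS.
    move/andP: njt => [n1 n2]; move/andP: jt => [j1 j2].
    by apply/eqP; rewrite eqn_leq (le_aux _ _ n1 j2) (le_aux _ _ j1 n2).
  exists (behead nu); first by apply: map_f; rewrite mem_filter nuj eqxx.
  by move=> i; rewrite nth_behead; have := znu (fintype.lift ord0 i); rewrite row_consS.
rewrite ge0_integral_sum //; last first.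
  move=> j; apply/measurable_EFinP; apply: measurable_funM => //.
under eq_bigr => j _ do rewrite integral_step ?c0 ?ler_pM2r ?invr_gt0 ?ler_nat //.
rewrite sumEFin lee_fin.
under eq_bigr => j _ do rewrite -mulrBl -natrB // subSnn mul1r -mulrA -exprSr.
rewrite -mulr_suml ler_wpM2r ?exprn_ge0 ?invr_ge0 ?(ltW tau0) //.
rewrite -natr_sum ler_nat.
under eq_bigr do rewrite size_map size_filter -sum1_count big_mkcond.
rewrite exchange_big /= -[leqRHS]sum1_size leq_sum // => mu _.
rewrite -big_mkcond sum1_count.
rewrite (eq_count (a2 := pred1 (head 0%N mu))) => [|j]; last by rewrite /= eq_sym.
by rewrite count_uniq_mem ?iota_uniq // leq_b1.
Qed.

End Volume.

(** * Invertible germs *)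

Section Units.
Variables (R : realType) (n : nat).
Local Notation C := R[i].
Local Notation O := (holo_germ R n).
Local Notation mnm := (multinom n).
Implicit Types (f g h : O) (a b : mnm -> C).

Definition partial_norm (rho : C) d a : C :=
  \sum_(k : bmultinom n d) `|a k| * rho ^+ mdeg k.

Lemma partial_normM rho d a b : 0 <= rho ->
  partial_norm rho d (cauchy_prod a b) <= partial_norm rho d a * partial_norm rho d b.
Proof.
move=> rho0; rewrite /partial_norm mulr_suml.
under [leRHS]eq_bigr do rewrite mulr_sumr.
pose t (k l : bmultinom n d) : C := `|a k| * rho ^+ mdeg k * (`|b l| * rho ^+ mdeg l).
have t0 k l : 0 <= t k l by rewrite !mulr_ge0 // exprn_ge0.
rewrite -[leRHS]/(\sum_k \sum_l t k l) pair_bigA /=.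
apply: (@le_trans _ _ (\sum_(m : bmultinom n d)
    \sum_(p : bmultinom n d * bmultinom n d | bmnm m == mnm_add p.1 p.2) t p.1 p.2)).
  apply: ler_sum => m _; rewrite (cauchy_prod_widen _ _ (bmdeg m)).
  apply: le_trans (ler_wpM2r (exprn_ge0 _ rho0) (ler_norm_sum _ _ _)) _.
  rewrite mulr_suml; apply: ler_sum => p /eqP ->.
  by rewrite normrM mdegD exprD mulrACA.
rewrite (exchange_big_dep xpredT) //=; apply: ler_sum => p _.
have [pd|pd] := ltnP (mdeg (mnm_add p.1 p.2)) d.
  by rewrite (big_pred1 (BMultinom pd)).
rewrite big_pred0 // => m; apply/negbTE; apply: contraTneq (bmdeg m) => ->.
by rewrite -leqNgt.
Qed.

(** Without a constant term, shrinking the radius by a factor th <= 1 shrinks the norm at least by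
    th; the choice of th ensures th K <= 1/2. *)
Lemma small_radius g : hcoef g mnm0 = 0 -> exists2 rho : C, 0 < rho &
  forall d, partial_norm rho d g <= 2^-1.
Proof.
move=> g0; have [r [K [r0 hK]]] := hcoef_conv g.
have K0 : 0 <= K.
  by have := hK 0%N; rewrite big1 // => -[k kd] _; exfalso; move: kd; rewrite ltn0.
pose th := (2 * (K + 1))^-1.
have K1 : 0 < 2 * (K + 1) by rewrite mulr_gt0 // ltr_wpDl.
have th0 : 0 < th by rewrite invr_gt0.
have th1 : th <= 1.
  rewrite invf_le1 // (@le_trans _ _ (K + 1)) //; first by rewrite lerDr.
  by rewrite ler_peMl ?addr_ge0 // ler1n.
exists (th * r); first by rewrite mulr_gt0.
move=> d; apply: (@le_trans _ _ (th * K)); last first.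
  by rewrite /th invfM -mulrA ler_piMr ?invr_ge0 // mulrC ler_pdivrMr ?mul1r ?lerDl ?ltr_wpDl.
apply: le_trans (ler_wpM2l (ltW th0) (hK d)).
rewrite mulr_sumr; apply: ler_sum => k _.
have [k0|k0] := eqVneq (bmnm k) mnm0; first by rewrite k0 g0 normr0 !mul0r mulr0.
rewrite exprMn [leRHS]mulrCA; apply: ler_wpM2l => //.
apply: ler_wpM2r; first by rewrite exprn_ge0 // ltW.
rewrite -(prednK (n := mdeg k)) ?lt0n ?mdeg_eq0 // exprS ler_piMr ?(ltW th0) //.
by rewrite exprn_ile1 // ltW.
Qed.

(** The coefficients of the geometric series stabilize because g^j has order at least j. Convergence
    comes from b = 1 + g b: where g has norm at most 1/2, each partial norm N of b satisfies N <= 1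
    + N/2, so N <= 2. *)
Lemma geometric_inverse g : hcoef g mnm0 = 0 -> exists b : O, (1 - g) * b = 1.
Proof.
move=> g0; pose s d : O := \sum_(j < d) g ^+ j.
have gj j : supp_in (order_ge (n := n) j) (g ^+ j).
  have : iexp (maxI R n) j (g ^+ j) by exact: iexp_mem.
  by rewrite max_exp.
have s_stable d (k : mnm) : (mdeg k < d)%N -> hcoef (s d) k = hcoef (s (mdeg k).+1) k.
  move=> kd; rewrite /s -(subnKC kd) big_split_ord hcoefD [X in _ + X](_ : _ = 0) ?addr0 //.
  rewrite hcoef_sum big1 // => j _; apply/eqP; apply: contraT => /gj; rewrite /order_ge /=.
  by rewrite leqNgt addSn ltnS leq_addr.
pose b (k : mnm) := hcoef (s (mdeg k).+1) k.
have bE d k : (mdeg k < d)%N -> b k = hcoef (s d) k by move=> kd; rewrite s_stable.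
have gsE d : (1 - g) * s d = 1 - g ^+ d.
  elim: d => [|d IH]; first by rewrite /s big_ord0 mulr0 expr0 subrr.
  rewrite /s big_ord_recr /= mulrDr -/(s d) IH exprS mulrBl mul1r.
  by rewrite addrA subrK.
have prodE d (k : mnm) (c : O) : (mdeg k < d)%N -> cauchy_prod c b k = hcoef (c * s d) k.
  move=> kd; have H := @mcoeff_truncation R n d.
  rewrite -[RHS]/(cauchy_prod _ _ _) (@cauchy_prodE _ _ _ _ _ _ _ _ kd (H c) (H (s d))).
  by apply: cauchy_prodE kd (H c) _ => l ld; rewrite H // (bE d).
have b_rec k : b k = (k == mnm0)%:R + cauchy_prod g b k.
  rewrite (prodE (mdeg k).+1) // /b -[RHS](_ : hcoef (1 + g * s (mdeg k).+1 - g ^+ (mdeg k).+1) k = _).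
    congr (hcoef _ k); have := gsE (mdeg k).+1; rewrite mulrBl mul1r => e.
    by rewrite addrAC -e subrK.
  rewrite !hcoefD hcoefN [X in - X](_ : _ = 0) ?subr0; last first.
    by apply/eqP; apply: contraT => /gj; rewrite /order_ge /= ltnn.
  by congr (_ + _); rewrite /=; case: ifP.
have [rho rho0 hrho] := small_radius g0.
have cb : convergent_series b.
  exists rho, 2; split=> // d; rewrite -/(partial_norm rho d b).
  have B0 : 0 <= partial_norm rho d b.
    by apply: sumr_ge0 => k _; rewrite mulr_ge0 // exprn_ge0 // ltW.
  have : partial_norm rho d b <= 1 + 2^-1 * partial_norm rho d b.
    apply: (@le_trans _ _ (partial_norm rho d (fun k => (k == mnm0)%:R) +
        partial_norm rho d (cauchy_prod g b))).
      rewrite -big_split /=; apply: ler_sum => k _; rewrite -mulrDl.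
      apply: ler_wpM2r; first by rewrite exprn_ge0 // ltW.
      by rewrite {1}b_rec ler_normD.
    apply: lerD; last first.
      apply: (le_trans (partial_normM _ _ _ (ltW rho0))).
      by apply: ler_wpM2r.
    have [d0|d0] := posnP d.
      rewrite /partial_norm big1 // => -[k kd] _; exfalso.
      by move: kd; rewrite d0.
    have z0 : (mdeg (mnm0 : mnm) < d)%N by rewrite mdeg0.
    rewrite /partial_norm (bigD1 (BMultinom z0)) //= eqxx mdeg0 mulr1 normr1 big1 ?addr0 // => k.
    by rewrite -val_eqE /= => /negbTE ->; rewrite normr0 mul0r.
  rewrite -lerBlDr -[X in X - _]mul1r -mulrBl.
  rewrite (_ : 1 - 2^-1 = 2^-1 :> C); first by rewrite mulrC ler_pdivrMr ?mul1r.
  by rewrite {1}(splitr (1 : C)) mul1r addrK.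
exists (HoloGerm cb); apply: holo_germP => k.
rewrite -[LHS]/(cauchy_prod _ _ _) -[hcoef (HoloGerm cb)]/b (prodE (mdeg k).+1) //.
rewrite gsE hcoefD hcoefN [X in - X](_ : _ = 0) ?subr0 //.
by apply/eqP; apply: contraT => /gj; rewrite /order_ge /= ltnn.
Qed.

Lemma germ_unit h : hcoef h mnm0 != 0 -> exists b : O, b * h = 1.
Proof.
move=> h0; set c := hcoef h mnm0 in h0.
have [|b hb] := @geometric_inverse (1 - germC R n c^-1 * h).
  by rewrite hcoefD hcoefN hcoef_constM mulVf //= eqxx subrr.
rewrite subKr in hb; exists (b * germC R n c^-1).
by rewrite -mulrA mulrC.
Qed.

Lemma proper_sub_max (I : ideal O) : iset I <> setT -> I `<=` maxI R n.
Proof.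
move=> IT h Ih; apply/eqP; apply: contraT => /germ_unit[b bh]; exfalso; apply: IT.
apply/seteqP; split=> // x _; rewrite -[x]mulr1 -bh.
by do 2!apply: idealM.
Qed.

End Units.

(** * From volume to multiplicity *)

Section NewtonVolume.
Variables (R : realType) (n' : nat).
Local Notation n := n'.+1.
Local Notation O := (holo_germ R n).
Local Notation mI := (maxI R n).
Local Notation flag := (flag (germC R n)).
Variable G : set 'rV[R]_n.
Hypothesis hG : newton_polyhedron G.
Hypothesis nG0 : ~ G 0.
Local Notation M := (newton_lcm G).
Variable phi : multinom n -> nat.
Hypothesis M_gt0 : (0 < M)%N.
Hypothesis phiD : forall k l, (phi k + phi l <= phi (mnm_add k l))%N.
Hypothesis phi_mdeg : forall k, (mdeg k <= phi k)%N.
Hypothesis phi_G : forall k t, (0 < t)%N -> (M * t <= phi k)%N ->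
  G (t%:R^-1 *: mnm_row R k).

Let G_up x z : G x -> orthant z -> G (x + z).
Proof. by have [A ->] := hG; exact: hull_up. Qed.

Let G_convex x y l : G x -> G y -> 0 <= l <= 1 -> G (l *: x + (1 - l) *: y).
Proof. by have [A ->] := hG; exact: hull_convex. Qed.

Definition scaled_exponents t : set (multinom n) := [set k | G (t%:R^-1 *: mnm_row R k)].
Local Notation E := scaled_exponents.

Let row_add (k l : multinom n) : mnm_row R (mnm_add k l) = mnm_row R k + mnm_row R l.
Proof. by apply/rowP => i; rewrite !mxE mnmDE natrD. Qed.

Lemma scaled_exponents_up t : up_closed (E t).
Proof.
move=> k l Ek; rewrite /E /= row_add scalerDr; apply: G_up => //.
by apply: orthantZ; [rewrite invr_ge0|exact: orthant_row].
Qed.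

Lemma scaled_exponentsD s t k l : (0 < s)%N -> (0 < t)%N ->
  E s k -> E t l -> E (s + t)%N (mnm_add k l).
Proof.
move=> s0 t0 sk tl; rewrite /E /= row_add.
have := G_convex (l := s%:R / (s + t)%:R) sk tl.
rewrite (_ : _ + _ = (s + t)%:R^-1 *: (mnm_row R k + mnm_row R l)); first apply.
  by rewrite divr_ge0 //= ler_pdivrMr ?ltr0n ?addn_gt0 ?s0 // mul1r ler_nat leq_addr.
apply/rowP => i; rewrite !mxE natrD; field.
by rewrite -natrD !pnatr_eq0 -!lt0n addn_gt0 s0 t0.
Qed.

(** The region is covered by the cubes of side 1/t at the exponents outside (t + 1) G. Passing from
    t to t + 1 absorbs the closure: if y lies in the cube of an exponent of (t + 1) G, then r y is
    in G for r = t / (t + 1) < 1, so G contains a neighbourhood of y in the orthant. *)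
Lemma volume_codim t d : (0 < t)%N -> flag (supp_in (E t.+1)) setT d ->
  (volume (newton_minus G) <= (d%:R * t%:R^-1 ^+ n)%:E)%E.
Proof.
move=> t0 fd; pose D := (M * t.+1)%N.
pose X := [seq bmnm k | k : bmultinom n D <- enum {: bmultinom n D} & `[< ~ E t.+1 (bmnm k) >]].
have XE k : k \in X <-> ~ E t.+1 k.
  split=> [/mapP[l]|nE].
    by rewrite mem_filter => /andP[/asboolP nE _] ->.
  have kD : (mdeg k < D)%N.
    rewrite ltnNge; apply/negP => Dk; apply: nE; apply: phi_G => //.
    exact: leq_trans (phi_mdeg k).
  by apply/mapP; exists (BMultinom kD); rewrite // mem_filter mem_enum andbT; apply/asboolP.
have uX : uniq X.
  rewrite map_inj_uniq; first by rewrite filter_uniq // enum_uniq.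
  by move=> x y /= xy; exact: val_inj.
have dX : d = size X.
  have := @supp_in_flag R n (E t.+1) X uX (fun k => (XE k).1).
  rewrite [X in flag _ X _]supp_inT; first exact: (flag_uniq fd).
  by move=> k; have [Ek|/XE kX] := pselect (E t.+1 k); [left|right].
rewrite dX -(size_map (fun k : multinom n => k : seq nat)).
apply: le_trans (volume_grid_le _ _ _); last by rewrite ltr0n.
apply: volume_le => y Gy.
have tp : 0 < t%:R :> R by rewrite ltr0n.
have y0 : orthant y.
  rewrite [@orthant R n](closure_id _).1; last exact: closed_orthant.
  by apply: closureS Gy => z [].
pose k : multinom n := Multinom [tuple Num.truncn (t%:R * y 0 i) | i < n].
have ky i : (k i)%:R <= t%:R * y 0 i < (k i).+1%:R.
  by rewrite mnmE truncn_itv // mulr_ge0.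
exists (k : seq nat); last first.
  move=> i; rewrite -mnm_nth; have /andP[k1 k2] := ky i.
  by rewrite ler_pdivrMr // ltr_pdivlMr // mulrC k1 k2.
apply: map_f; apply/XE => Ek.
pose r : R := t%:R / t.+1%:R.
have r1 : r < 1 by rewrite ltr_pdivrMr ?ltr0n // mul1r ltr_nat.
have r0 : 0 < r by rewrite divr_gt0 ?ltr0n.
have Gry : G (r *: y).
  have -> : r *: y = t.+1%:R^-1 *: mnm_row R k + (r *: y - t.+1%:R^-1 *: mnm_row R k).
    by rewrite addrC subrK.
  apply: G_up => // i; rewrite !mxE subr_ge0 /r mulrAC [leRHS]mulrC.
  by apply: ler_wpM2l; [rewrite invr_ge0|have /andP[] := ky i].
(* Lower bounds defining this neighbourhood; where y_i = 0, the value -1 imposes nothing on points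
   of the orthant. *)
pose b i := if y 0 i == 0 then -1 else r * y 0 i.
have : nbhs y [set z : 'rV[R]_n | forall i, b i < z 0 i].
  apply: (@filter_forall _ _ (fun i (z : 'rV[R]_n) => b i < z 0 i) (nbhs y)) => i; have by' : b i < y 0 i.
    rewrite /b; case: eqVneq => [->|yi]; first by rewrite ltrN10.
    by rewrite gtr_pMl // lt_neqAle eq_sym yi y0.
  exact: (@coord_continuous R 1 n 0 i y [set z : R | b i < z] (lt_nbhsr by')).
move=> /Gy[z [[z0 nGz] bz]]; apply: nGz.
rewrite -(subrK (r *: y) z) addrC; apply: G_up => // i; rewrite !mxE subr_ge0.
have := bz i; rewrite /b; case: eqVneq => [->|_ /ltW//].
by rewrite mulr0 => _; exact: z0.
Qed.

(** Separating the origin from G gives w >= 0 that is at least 1 on G; it is below 1 on the cube of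
    side 1 / tau at the origin. *)
Lemma volume_newton_minus_gt0 : (0 < volume (newton_minus G))%E.
Proof.
have [w w0 wG] : exists2 w : 'rV[R]_n, orthant w & forall x, G x -> 1 <= dotv w x.
  have [A GE] := hG; have [ks [ksA Aks]] := dickson A.
  have o0 : orthant (0 : 'rV[R]_n) by move=> i; rewrite mxE.
  have nG : ~ smallest (@convex_set R 'rV[R]_n)
    [set mnm_row R k + x | k in A & x in @orthant R n] 0 by rewrite -GE.
  have [w [w0 wk _]] := hull_separation ksA o0 nG.
  exists w => // x; rewrite GE => Gx; apply: (hull_ge w0 _ Gx).
  exact: (ks_ge Aks w0 wk).
pose tau : R := \sum_i w 0 i + 1.
have s0 : 0 <= \sum_i w 0 i by exact: sumr_ge0.
have tau0 : 0 < tau by rewrite ltr_wpDl.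
apply: (@lt_le_trans _ _ (volume (grid_cell (n := n) tau [::]))).
  by rewrite volume_cell // lte_fin exprn_gt0 // invr_gt0.
apply: volume_le => x xc; apply: subset_closure.
have x0 : orthant x by move=> i; have := xc i; rewrite nth_nil mul0r => /andP[].
split=> // /wG; rewrite leNgt => /negP; apply.
apply: (@le_lt_trans _ _ (\sum_i w 0 i / tau)).
  apply: ler_sum => i _; apply: ler_wpM2l => //.
  by have := xc i; rewrite nth_nil => /andP[_ /ltW]; rewrite div1r.
by rewrite -mulr_suml ltr_pdivrMr // mul1r ltrDl.
Qed.

Lemma scaled_primary t : (0 < t)%N -> primary mI (Ideal (supp_in_ideal R (@scaled_exponents_up t))).
Proof.
move=> t0; exists (M * t)%N; rewrite max_exp; apply: supp_inS => k /= Mk.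
by apply: phi_G => //; exact: leq_trans (phi_mdeg k).
Qed.

Lemma volume_newton_minus_fin : exists2 c : R, volume (newton_minus G) = c%:E & 0 < c.
Proof.
have [d fd] := primary_flag (@max_cofinite R n) (V := ione)
  (fun _ _ => Logic.I) (scaled_primary (ltn0Sn 1)).
have le := volume_codim (ltn0Sn 0) fd.
move: le volume_newton_minus_gt0; case: (volume _) => [c| |] //= _ c0.
by exists c => //; rewrite -lte_fin.
Qed.

Definition weighted r : set (multinom n) := [set k | (r <= phi k)%N].

Lemma weighted_up r : up_closed (weighted r).
Proof.
move=> k l; rewrite /weighted /= => rk; apply: leq_trans (phiD k l).
by rewrite (leq_trans rk) // leq_addr.
Qed.

Definition weightedI r := Ideal (supp_in_ideal R (@weighted_up r)).

Lemma weightedI_mul r s : imul (weightedI r) (weightedI s) `<=` weightedI (r + s)%N.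
Proof.
apply: imul_min => x y xr ys k /hcoefM_neq0[k1 [k2 [-> /xr + /ys]]].
rewrite /weighted /= => r1 s2; apply: leq_trans (phiD k1 k2).
exact: leq_add.
Qed.

Lemma weightedI_exp r s : iexp (weightedI r) s `<=` weightedI (r * s)%N.
Proof.
elim: s => [|s IH]; first by move=> x _ k _; rewrite /weighted /= muln0.
rewrite iexpS mulnS; apply: subset_trans (@weightedI_mul _ _).
by apply: imulS.
Qed.

Lemma weightedI_le r s : (r <= s)%N -> weightedI s `<=` weightedI r.
Proof. by move=> rs; apply: supp_inS => k /=; exact: leq_trans. Qed.

Lemma max_weightedI r : iexp mI r `<=` weightedI r.
Proof. by rewrite max_exp; apply: supp_inS => k /= rk; exact: leq_trans (phi_mdeg k). Qed.

(* Teissier's lower bound: passing to suitable powers makes all the weights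
   equal to M k, so that every ideal lies in the single ideal of k G, whose
   powers have large colength. *)
Lemma rees_ge_volume (c : R) (L : 'I_n -> ideal O) (r : 'I_n -> nat) :
  volume (newton_minus G) = c%:E -> (forall i, (0 < r i)%N) ->
  (forall i, L i `<=` weightedI (r i)) ->
  ((c * (n`!)%:R * (\prod_i r i)%N%:R / M%:R ^+ n)%:E <= rees L)%E.
Proof.
(* As q is at least every r_i, thickening by m^q does not lower the weights. *)
move=> cE r0 Lr; pose q := (\sum_i r i)%N; pose k := (\prod_i r i)%N.
have k0 : (0 < k)%N by rewrite prodn_gt0.
pose s i := (M * \prod_(j | j != i) r j)%N.
have s0 i : (0 < s i)%N by rewrite muln_gt0 M_gt0 prodn_gt0.
have rs i : (r i * s i)%N = (M * k)%N by rewrite /s /k mulnCA [in RHS](bigD1 i).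
pose T := thicken L q.
have Tr i : T i `<=` weightedI (r i).
  apply: iadd_min; first exact: Lr.
  apply: subset_trans (@max_weightedI q) (@weightedI_le _ _ _).
  by rewrite /q (bigD1 i) //= leq_addr.
pose Kk := Ideal (supp_in_ideal R (@scaled_exponents_up k)).
have TK i : iexp (T i) (s i) `<=` Kk.
  move=> x /(iexpSs (Tr i)) /weightedI_exp; rewrite rs.
  by apply: (@supp_inS R n) => y; exact: phi_G.
have pT i : primary mI (T i) by exact: thicken_primary.
have e1 := mmult_iexp pT s0.
have e2 : (mmult (fun=> Kk) <= mmult (fun i => iexp (T i) (s i)))%N.
  by apply: mmult_le => i; [exact: primary_iexp|exact: TK].
have KE t : (0 < t)%N -> iexp Kk t `<=` supp_in (E (k * t)%N).
  case: t => // t _; elim: t => [|t IH].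
    by rewrite iexpS [imul _ _]Monoid.mulm1 muln1.
  rewrite iexpS; apply: (@imul_min _ _ _ (Ideal (supp_in_ideal R (@scaled_exponents_up (k * t.+2)%N)))).
  move=> x y xK /IH yE l /hcoefM_neq0[l1 [l2 [-> /xK + /yE]]].
  rewrite [(k * t.+2)%N]mulnS; apply: scaled_exponentsD => //.
  by rewrite muln_gt0 k0.
have e3 : c * k%:R ^+ n * (n`!)%:R <= (mmult (fun=> Kk))%:R.
  apply: mmult_const_ge => //; first exact: scaled_primary.
  move=> t d fd; have [->|t0] := posnP t; first by rewrite expr0n mulr0.
  (* [volume_codim] is applied with index k (t + 1) - 1, which is at least k t. *)
  have k1 : (0 < (k * t.+1).-1)%N by rewrite mulnS; lia.
  have [d' fd'] : exists d', flag (supp_in (E (k * t.+1).-1.+1)) setT d'.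
    rewrite prednK ?muln_gt0 ?k0 //.
    apply: (primary_flag (@max_cofinite R n) (V := ione)
      (I := Ideal (supp_in_ideal R (@scaled_exponents_up (k * t.+1)%N)))) => //.
    by apply: scaled_primary; rewrite muln_gt0 k0.
  have dd : (d' <= d)%N.
    by apply: flag_le fd fd' _ _ => //; rewrite prednK ?muln_gt0 ?k0 //; exact: KE.
  have := volume_codim k1 fd'; rewrite cE lee_fin exprVn ler_pdivlMr; last first.
    by rewrite exprn_gt0 // ltr0n.
  move=> h; apply: (@le_trans _ _ d'%:R); last by rewrite ler_nat.
  apply: le_trans h; rewrite -mulrA -exprMn -natrM.
  have c0 : 0 <= c by rewrite -lee_fin -cE volume_ge0.
  apply: ler_wpM2l => //; rewrite lerXn2r ?nnegrE // ler_nat.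
  by rewrite mulnS; lia.
apply: le_trans (rees_ge L q); rewrite lee_fin -/T.
(* Multiplying the inequality by k turns the product of the s_i into (M k)^n, and the factor k^n
   then cancels. *)
have sk : (\prod_i s i * k = (M * k) ^ n)%N.
  transitivity (\prod_(i < n) (M * k))%N; last by rewrite prod_nat_const card_ord.
  by rewrite mulnC -big_split /=; apply: eq_bigr => i _; exact: rs.
have Mn0 : 0 < M%:R ^+ n :> R by rewrite exprn_gt0 // ltr0n.
rewrite -/k ler_pdivrMr //.
have kn0 : 0 < k%:R ^+ n :> R by rewrite exprn_gt0 // ltr0n.
rewrite -(ler_pM2r kn0).
have : c * k%:R ^+ n * (n`!)%:R * k%:R <= (\prod_i s i * k)%N%:R * (mmult T)%:R.
  apply: (@le_trans _ _ ((mmult (fun=> Kk))%:R * k%:R)); first by rewrite ler_wpM2r.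
  by rewrite -!natrM ler_nat [leqRHS]mulnAC -e1 leq_mul2r e2 orbT.
rewrite sk expnMn natrM !natrX => h.
have -> : c * n`!%:R * k%:R * k%:R ^+ n = c * k%:R ^+ n * (n`!)%:R * k%:R by ring.
have -> : (mmult T)%:R * M%:R ^+ n * k%:R ^+ n = M%:R ^+ n * k%:R ^+ n * (mmult T)%:R :> R.
  by ring.
by [].
Qed.

End NewtonVolume.

(** * Lojasiewicz exponents *)

Section LojExponent.
Variables (R : realType) (n : nat).
Local Notation ideal := (ideal (holo_germ R n)).
Implicit Types (I : ideal) (L : 'I_n -> ideal).

Definition loj_set I L (s : nat) : set nat := [set r |
  rees (fun i => iexp (L i) s) = rees (fun i => iadd (iexp (L i) s) (iexp I r))].

Definition loj_value I L (s : nat) : \bar R :=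
  (ereal_inf [set r%:R%:E | r in loj_set I L s] / s%:R%:E)%E.

Lemma loj_exponentE I L : loj_exponent I (fun i => iset (L i)) =
  ereal_inf [set loj_value I L s | s in [set s | (0 < s)%N]].
Proof.
have eJ s : (fun i => ideal_exp (L i) s) = (fun i => iset (iexp (L i) s)).
  by apply/funext => i; exact: iexpE.
have eA s r : (fun i => ideal_add (iset (iexp (L i) s)) (ideal_exp I r)) =
    (fun i => iset (iadd (iexp (L i) s) (iexp I r))).
  by apply/funext => i; rewrite (iexpE I r).
have eO s : loj_order I (fun i => iset (iexp (L i) s)) =
    ereal_inf [set r%:R%:E | r in loj_set I L s].
  rewrite /loj_order; apply: (congr1 (fun A : set nat => ereal_inf [set r%:R%:E | r in A])).
  apply/funext => r; exact: (congr1 (fun J => rees_mixed_mult (fun i => iset (iexp (L i) s))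
    = rees_mixed_mult J) (eA s r)).
rewrite /loj_exponent; apply: (congr1 (fun f : nat -> \bar R => ereal_inf [set f s | s in [set s | (0 < s)%N]])).
apply/funext => s; by rewrite eJ eO.
Qed.

Lemma loj_value_le I L L' s : (0 < s)%N -> loj_set I L' s `<=` loj_set I L s ->
  (loj_value I L s <= loj_value I L' s)%E.
Proof.
move=> s0 sub; have s0' : 0 < s%:R :> R by rewrite ltr0n.
apply: lee_wpmul2r; first by rewrite inver (gt_eqF s0') lee_fin invr_ge0 ltW.
apply: le_ereal_inf; exact: image_subset.
Qed.

Lemma loj_exponent_ub I L r s : (0 < s)%N -> loj_set I L s r ->
  (loj_exponent I (fun i => iset (L i)) <= (r%:R / s%:R)%:E)%E.
Proof.
move=> s0 rs; have s0' : 0 < s%:R :> R by rewrite ltr0n.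
rewrite loj_exponentE; apply: (@le_trans _ _ (loj_value I L s)).
  by apply: ereal_inf_lbound; exists s.
rewrite /loj_value inver (gt_eqF s0') lee_pdivrMr // -EFinM mulfVK ?gt_eqF //.
by apply: ereal_inf_lbound; exists r.
Qed.

Lemma loj_exponent_lb I L (x : R) :
  (forall s r, (0 < s)%N -> loj_set I L s r -> x * s%:R <= r%:R) ->
  (x%:E <= loj_exponent I (fun i => iset (L i)))%E.
Proof.
move=> h; rewrite loj_exponentE; apply: le_ereal_inf_tmp => _ [s s0 <-].
have s0' : 0 < s%:R :> R by rewrite ltr0n.
rewrite /loj_value inver (gt_eqF s0') lee_pdivlMr // -EFinM.
by apply: le_ereal_inf_tmp => _ [r rs <-]; rewrite lee_fin; exact: h.
Qed.

(* Every r admissible for L'^s is admissible for L^s. *)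
Lemma loj_exponent_le I L L' : (forall i, L i `<=` L' i) -> rees L = rees L' ->
  (loj_exponent I (fun i => iset (L i)) <= loj_exponent I (fun i => iset (L' i)))%E.
Proof.
move=> LL' e; rewrite !loj_exponentE; apply: le_ereal_inf_tmp => _ [s s0 <-].
apply: (@le_trans _ _ (loj_value I L s)); first by apply: ereal_inf_lbound; exists s.
apply: loj_value_le => // r; rewrite /loj_set /= => rL'.
apply/eqP; rewrite eq_le; apply/andP; split; last first.
  by apply: rees_le => i; exact: iadd_subl.
(* sigma(L^s) = s^n sigma(L) = s^n sigma(L') = sigma(L'^s) = sigma(L'^s + I^r) <= sigma(L^s +
   I^r). *)
rewrite (rees_iexp L (s := fun=> s)) // e -(rees_iexp L' (s := fun=> s)) // rL'.
by apply: rees_le => i; apply: iaddS => //; exact: iexpSs.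
Qed.

End LojExponent.

(** * The bounds for non-degenerate families *)

Section Main.
Variables (R : realType) (n' : nat).
Local Notation n := n'.+1.
Local Notation O := (holo_germ R n).
Local Notation ideal := (ideal O).
Variable G : set 'rV[R]_n.
Hypothesis hG : newton_polyhedron G.
Local Notation M := (newton_lcm G).
Variable phi : multinom n -> nat.
Hypothesis M_gt0 : (0 < M)%N.
Hypothesis phiE : forall k, newton_phi G (mnm_row R k) = (phi k)%:R.
Hypothesis phiD : forall k l, (phi k + phi l <= phi (mnm_add k l))%N.
Hypothesis phi_mdeg : forall k, (mdeg k <= phi k)%N.
Hypothesis phi_G : forall k t, (0 < t)%N -> (M * t <= phi k)%N ->
  G (t%:R^-1 *: mnm_row R k).
Variable c : R.
Hypothesis volE : volume (newton_minus G) = c%:E.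
Hypothesis c_gt0 : 0 < c.

Local Notation weightedI := (weightedI R phiD).

Implicit Types (I : ideal) (L : 'I_n -> ideal) (r s : 'I_n -> nat).

Lemma newton_ideal_nat (x : nat) : newton_ideal G x%:R%:E = weightedI x.
Proof.
apply/seteqP; split=> h hx.
  move=> k hk; rewrite /weighted /= -(ler_nat R) -phiE -lee_fin.
  by apply: le_trans hx _; apply: ereal_inf_lbound; exists k.
by apply: le_ereal_inf_tmp => _ [k hk <-]; rewrite phiE lee_fin ler_nat; exact: hx.
Qed.

(** The value is the least phi(k) over the exponents k occurring in I. They exist because I is
    non-zero, and k = 0 is not among them because a proper ideal lies in m. *)
Lemma newton_nu_ideal_nat I : iset I <> setT -> iset I <> [set 0] ->
  exists2 x : nat, (0 < x)%N & newton_nu_ideal G I = x%:R%:E.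
Proof.
move=> IT I0; pose P (x : nat) := exists h k, [/\ I h, hcoef h k != 0 & x = phi k].
have ex : exists x, `[< P x >].
  apply: contrapT => nex; apply: I0; apply/seteqP; split=> [h Ih|_ ->]; last exact: ideal0.
  apply: holo_germP => k; rewrite hcoef0; apply/eqP; apply: contraT => hk; exfalso.
  by apply: nex; exists (phi k); apply/asboolP; exists h, k.
case: (ex_minnP ex) => x /asboolP[h [k [Ih hk xE]]] xmin; exists x.
  rewrite xE; apply: leq_trans (phi_mdeg k); rewrite lt0n mdeg_eq0.
  by apply: contraNneq hk => ->; apply/eqP; exact: (proper_sub_max IT Ih).
apply/eqP; rewrite eq_le; apply/andP; split.
  apply: ge_ereal_sup => y /(_ h Ih) /le_trans; apply.
  by apply: ereal_inf_lbound; exists k; rewrite // phiE xE.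
apply: ereal_sup_ubound => h' Ih'; rewrite newton_ideal_nat => l hl.
by apply: xmin; apply/asboolP; exists h', l.
Qed.

Lemma newton_nu_ideal0 : newton_nu_ideal G [set 0] = +oo%E.
Proof.
apply/eqP; rewrite -leye_eq; apply: ereal_sup_ubound => _ ->.
by apply: le_ereal_inf_tmp => y [k hk _]; move: hk; rewrite /mkset hcoef0 eqxx.
Qed.

Lemma newton_nu_ideal_sub I (x : nat) : newton_nu_ideal G I = x%:R%:E ->
  I `<=` weightedI x.
Proof.
move=> nx h Ih; rewrite -newton_ideal_nat -nx; apply: ge_ereal_sup => y.
exact.
Qed.

Let v : R := c * (n`!)%:R / M%:R ^+ n.

Let v_gt0 : 0 < v.
Proof. by rewrite divr_gt0 ?exprn_gt0 ?mulr_gt0 ?ltr0n ?fact_gt0. Qed.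

Lemma prod_nu_infty (x : 'I_n -> \bar R) : (forall i, 0 < x i)%E ->
  (exists i, x i = +oo%E) -> (\prod_(i < n) x i = +oo)%E.
Proof.
move=> x0 [i xi]; rewrite (bigD1 i) //= xi gt0_mulye //.
by elim/big_ind: _ => // y z y0 z0; exact: mule_gt0.
Qed.

(** A zero ideal among the L_i would make the right-hand side of the non-degeneracy equation
    infinite, while sigma is finite. *)
Lemma nondegenerate_nu L : (forall i, iset (L i) <> setT) ->
  newton_nondegenerate G (fun i => iset (L i)) ->
  exists2 r, (forall i, (0 < r i)%N) & forall i, newton_nu_ideal G (L i) = (r i)%:R%:E.
Proof.
move=> LT [fin eq]; have [L0|nL0] := pselect (exists i, iset (L i) = [set 0]).
  exfalso; move: fin; rewrite eq prod_nu_infty; last first.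
  - by have [i Li] := L0; exists i; rewrite Li newton_nu_ideal0.
  - move=> i; have [->|Li] := pselect (iset (L i) = [set 0]).
      by rewrite newton_nu_ideal0.
    by have [x x0 ->] := newton_nu_ideal_nat (@LT i) Li; rewrite lte_fin ltr0n.
  rewrite volE inver pnatr_eq0 expn_eq0 (gtn_eqF M_gt0) /=.
  by rewrite !gt0_mulye ?lte_fin ?invr_gt0 ?ltr0n ?expn_gt0 ?M_gt0 ?fact_gt0 // ltxx.
have ex i : exists x : nat, (0 < x)%N /\ newton_nu_ideal G (L i) = x%:R%:E.
  have [x x0 xE] := @newton_nu_ideal_nat (L i) (@LT i) (fun Li => nL0 (ex_intro _ i Li)).
  by exists x.
by have [r hr] := choice ex; exists r => i; have [] := hr i.
Qed.

Lemma nondegenerate_rees L r : (forall i, newton_nu_ideal G (L i) = (r i)%:R%:E) ->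
  newton_nondegenerate G (fun i => iset (L i)) ->
  rees L = (v * (\prod_i r i)%N%:R)%:E.
Proof.
move=> nu [_]; rewrite -/(rees L) => ->.
rewrite (eq_bigr (fun i => (r i)%:R%:E)); last by move=> i _; exact: nu.
have -> : (\prod_(i < n) (r i)%:R%:E = (\prod_i r i)%N%:R%:E :> \bar R)%E.
  by elim/big_rec2: _ => // i x y _ ->; rewrite natrM EFinM.
rewrite volE inver pnatr_eq0 expn_eq0 (gtn_eqF M_gt0) -!EFinM; congr EFin.
by rewrite natrX /v; ring.
Qed.

Lemma rees_weighted_ge L r : (forall i, (0 < r i)%N) ->
  (forall i, L i `<=` weightedI (r i)) -> ((v * (\prod_i r i)%N%:R)%:E <= rees L)%E.
Proof.
move=> r0 Lr; have := rees_ge_volume hG M_gt0 phi_mdeg phi_G volE r0 Lr.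
by rewrite /v mulrAC.
Qed.

(** Linkage contributes a lower bound for the smallest of the three quantities; with the first two
    inequalities this closes the circle. *)
Lemma loj_exponent_newton_bounds L I : (forall i, iset (L i) <> setT) ->
  newton_nondegenerate G (fun i => iset (L i)) -> iset I <> setT -> iset I <> [set 0] ->
  let B := fun i => newton_ideal G (newton_nu_ideal G (L i)) in
  let bound := (max_nu G (fun i => iset (L i)) / newton_nu_ideal G I)%E in
  [/\ (loj_exponent I (fun i => iset (L i)) <= loj_exponent I B)%E,
      (loj_exponent I B <= bound)%E &
      newton_linked G I (fun i => iset (L i)) ->
        (bound <= loj_exponent I (fun i => iset (L i)))%E].
Proof.
move=> LT nd IT I0 B bound.
have [r r0 nu] := nondegenerate_nu LT nd.
have reesL := nondegenerate_rees nu nd.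
have [u u0 nuI] := newton_nu_ideal_nat IT I0.
have BE : B = fun i => iset (weightedI (r i)).
  by apply/funext => i; rewrite /B nu newton_ideal_nat.
pose W i := weightedI (r i).
have LW i : L i `<=` W i by exact: newton_nu_ideal_sub.
have reesW : rees W = (v * (\prod_i r i)%N%:R)%:E.
  apply/eqP; rewrite eq_le -{1}reesL rees_le //=.
  by apply: rees_weighted_ge => // i; exact: subset_refl.
pose p := \max_i r i.
have pE : max_nu G (fun i => iset (L i)) = p%:R%:E.
  apply/eqP; rewrite eq_le; apply/andP; split.
    apply/bigmax_leP; split=> [|i _]; first by rewrite leNye.
    by rewrite nu lee_fin ler_nat; exact: leq_bigmax.
  have [i ->] : exists i, p = r i.
    by have [|i ip] := @bigop.eq_bigmax _ r; [rewrite card_ord|exists i].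
  by rewrite -nu; exact: le_bigmax.
have boundE : bound = (p%:R / u%:R)%:E.
  by rewrite /bound pE nuI inver pnatr_eq0 (gtn_eqF u0).
split.
- by rewrite BE; apply: loj_exponent_le => //; rewrite reesL -reesW.
(* The infimum is tested at the single pair s = u, r = p. *)
- rewrite BE boundE; apply: loj_exponent_ub => //; rewrite /loj_set /=.
  apply/eqP; rewrite eq_le; apply/andP; split; last first.
    by apply: rees_le => i; exact: iadd_subl.
  rewrite (rees_iexp W (s := fun=> u)) // reesW -EFinM.
  rewrite (_ : _ * (v * _) = v * (\prod_i (r i * u)%N)%N%:R); last first.
    by rewrite [in RHS]big_split /= !natrM; ring.
  apply: rees_weighted_ge => i; first by rewrite muln_gt0 r0.
  apply: iadd_min; first exact: weightedI_exp.
  move=> x /(iexpSs (newton_nu_ideal_sub nuI)) /(@weightedI_exp R n' phi phiD).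
  by apply: weightedI_le; rewrite mulnC leq_mul //; exact: leq_bigmax.
move=> [_ [i0 [i0p nd']]]; rewrite boundE.
have ri0 : r i0 = p.
  by apply/eqP; rewrite -(eqr_nat R) -eqe -nu -pE i0p.
pose L' i := if i == i0 then I else L i.
have L'E : (fun i => if i == i0 then iset I else iset (L i)) = fun i => iset (L' i).
  by apply/funext => i; rewrite /L'; case: ifP.
rewrite L'E in nd'.
pose r' i := if i == i0 then u else r i.
have nu' i : newton_nu_ideal G (L' i) = (r' i)%:R%:E.
  by rewrite /L' /r'; case: ifP.
have reesL' := nondegenerate_rees nu' nd'.
apply: loj_exponent_lb => s q s0; rewrite /loj_set /= (rees_iexp L (s := fun=> s)) // reesL.
have rhs0 : 0 < v * (\prod_i r i)%N%:R by rewrite mulr_gt0 // ltr0n prodn_gt0.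
(* The exponent 0 is not admissible: it gives sigma = 0, whereas sigma(L^s) is positive. *)
case: q => [|q].
  rewrite (rees_one (n := n)) // => [|i]; last first.
    by apply: ideal_eq => // x _; exact: iadd_subr.
  by rewrite -EFinM => -[/eqP]; rewrite mulf_eq0 (gt_eqF rhs0) orbF pnatr_eq0
    gtn_eqF // prodn_gt0.
pose s' i := if i == i0 then q.+1 else s.
have le1 : (rees (fun i => iadd (iexp (L i) s) (iexp I q.+1)) <=
    rees (fun i => iexp (L' i) (s' i)))%E.
  apply: rees_le => i; rewrite /L' /s'; case: ifP => _; first exact: iadd_subr.
  exact: iadd_subl.
move=> e; move: le1; rewrite -e rees_iexp => [|i]; last by rewrite /s'; case: ifP.
rewrite reesL' -!EFinM lee_fin mulrCA [leRHS]mulrCA ler_pM2l // -!natrM ler_nat.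
have D1 F : (\prod_i F i = F i0 * \prod_(i | i != i0) F i)%N by rewrite (bigD1 i0).
rewrite (D1 (fun=> s)) (D1 r) (D1 s') (D1 r') /s' /r' eqxx ri0.
rewrite [X in (_ <= (_ * X) * _)%N](eq_bigr (fun=> s)) => [|i /negbTE -> //].
rewrite [X in (_ <= _ * (_ * X))%N](eq_bigr r) => [|i /negbTE -> //].
set S1 := (\prod_(i < n | i != i0) s)%N; set Q := (\prod_(i < n | _) r i)%N.
have S0 : (0 < S1)%N by rewrite prodn_cond_gt0.
have Q0 : (0 < Q)%N by rewrite prodn_cond_gt0.
(* Cancelling s^(n-1) and the product of the r_i with i <> i0 leaves s p <= (q + 1) u, where q + 1
   is the admissible exponent. *)
rewrite mulnACA [leqRHS]mulnACA leq_pmul2r ?muln_gt0 ?S0 // => h.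
by rewrite mulrAC ler_pdivrMr ?ltr0n // -!natrM ler_nat mulnC.
Qed.

End Main.

Theorem theorem3p11 (R : realType) (n : nat) (n_gt0 : (0 < n)%N)
    (G : set 'rV[R]_n) (J : 'I_n -> set (holo_germ R n))
    (I : set (holo_germ R n)) :
  newton_polyhedron G -> convenient G -> ~ G 0 ->
  (forall i, is_proper_ideal (J i)) -> newton_nondegenerate G J ->
  is_proper_ideal I -> I <> [set 0] ->
  let B := fun i => newton_ideal G (newton_nu_ideal G (J i)) in
  let bound := (max_nu G J / newton_nu_ideal G I)%E in
  [/\ (loj_exponent I J <= loj_exponent I B)%E,
      (loj_exponent I B <= bound)%E &
      newton_linked G I J -> loj_exponent I J = loj_exponent I B /\
                      loj_exponent I B = bound].
Proof.
case: n n_gt0 G J I => [n0|n' _] G J I; first by exfalso; rewrite ltnn in n0.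
move=> hG cG nG0 pJ nd [idI IT] I0 B bound.
have [M0 [phi [phiE phiD phi_mdeg phi_G]]] : (0 < newton_lcm G)%N /\
    exists phi : multinom n'.+1 -> nat,
  [/\ forall k, newton_phi G (mnm_row R k) = (phi k)%:R,
      forall k l, (phi k + phi l <= phi (mnm_add k l))%N,
      forall k, (mdeg k <= phi k)%N &
      forall k t, (0 < t)%N -> (newton_lcm G * t <= phi k)%N ->
        G (t%:R^-1 *: mnm_row R k)].
  have [A GE] := hG; have [ks [ksA Aks]] := dickson A.
  rewrite GE in cG nG0 *; split; last exact: (newton_phiP cG nG0 ksA Aks).
  by have [] := newton_lcmP cG nG0 ksA Aks.
have [c volE c0] := volume_newton_minus_fin hG nG0 phi_mdeg phi_G.
pose L i := Ideal (pJ i).1.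
have [le1 le2 le3] := loj_exponent_newton_bounds hG M0 phiE phiD phi_mdeg phi_G volE c0
  (L := L) (I := Ideal idI) (fun i => (pJ i).2) nd IT I0.
split; [exact: le1|exact: le2|move=> /le3 le4].
have ge1 := le_trans le2 le4.
split; apply: le_anti; apply/andP; split.
- exact: le1.
- exact: ge1.
- exact: le2.
- exact: (le_trans le4 le1).
Qed.
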